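(* Let $d\ge2$ and let $0<p,q\le1$ satisfy $\frac1d\left(1-\frac1q\right)\ge\frac12\left(1-\frac1p\right)$. Then $$\|\mathcal{R}f\|_{L^q(d(\nu\times\sigma))}\ge\|f\|_{L^p(d\sigma)}$$ for all non-negative measurable $f$ on $\mathbb{S}^{d-1}$.
   Context: $\sigma$ is normalized surface (probability) measure on $\mathbb{S}^{d-1}$ and $\nu$ is the probability measure $d\nu(t)=\frac{|\mathbb{S}^{d-2}|}{|\mathbb{S}^{d-1}|}(1-t^2)^{\frac{d-3}{2}}dt$ on $(-1,1)$ (the pushforward of $\sigma$ under $x\mapsto x_1$). For $\omega\in\mathbb{S}^{d-1}$ and $t\in(-1,1)$, $\mathcal{R}f(\omega,t):=\int_{\mathbb{S}^{d-1}}f\,d\sigma_{\omega,t}$, where $d\sigma_{\omega,t}(x)=\frac{|\mathbb{S}^{d-1}|}{|\mathbb{S}^{d-2}|}(1-t^2)^{-\frac{d-3}{2}}\delta(x\cdot\omega-t)\,d\sigma(x)$ is the normalized average over the $(d-2)$-sphere $\mathbb{S}^{d-1}\cap\{x\cdot\omega=t\}$; equivalently, $\int_{(-1,1)}\mathcal{R}f(\omega,t)g(t)\,d\nu(t)=\int_{\mathbb{S}^{d-1}}f(x)g(x\cdot\omega)\,d\sigma(x)$ for all measurable $g\ge0$. The norm on the left is taken on $(-1,1)\times\mathbb{S}^{d-1}$ with respect to $\nu(t)\times\sigma(\omega)$. *)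

(* Defs.v *)
From HB Require Import structures.
From mathcomp Require Import all_boot all_order all_algebra.
From mathcomp Require Import all_classical all_reals all_analysis measurable_realfun.
Set Implicit Arguments. Unset Strict Implicit. Unset Printing Implicit Defensive.
Import Order.TTheory GRing.Theory Num.Theory.
Import numFieldNormedType.Exports.
Local Open Scope classical_set_scope.
Local Open Scope ring_scope.

Section Defs.
Variable R : realType.

(* Points of R^n are n-tuples of reals (with the product Borel sigma-algebra
   that MathComp-Analysis puts on n.-tuple R). *)
Definition dotp (n : nat) (x y : n.-tuple R) : R := \sum_(i < n) tnth x i * tnth y i.
Definition enorm (n : nat) (x : n.-tuple R) : R := Num.sqrt (dotp x x).
(* radial projection x |-> x / |x| (sends 0 to 0, a null set) *)
Definition normalize (n : nat) (x : n.-tuple R) : n.-tuple R :=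
  [tuple tnth x i / enorm x | i < n].

Definition gdens (x : R) : R := expR (- (x ^+ 2) / 2) / Num.sqrt (2 * pi).

(* integral of a non-negative function against the standard Gaussian measure
   on R^n, written as an iterated Lebesgue integral (Tonelli) *)
Fixpoint gint (n : nat) : (n.-tuple R -> \bar R) -> \bar R :=
  match n return (n.-tuple R -> \bar R) -> \bar R with
  | 0 => fun F => F [tuple]
  | m.+1 => fun F =>
      (\int[lebesgue_measure]_x ((gdens x)%:E * gint (fun t => F [tuple of x :: t])))%E
  end.

(* integral against the normalized surface measure sigma on S^{n-1}:
   sigma is the push-forward of the standard Gaussian under x |-> x/|x| *)
Definition sph_int (n : nat) (h : n.-tuple R -> \bar R) : \bar R :=
  gint (fun x => h (normalize x)).

(* the probability measure nu on (-1,1) with density proportional to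
   (1-t^2)^((d-3)/2); the constant |S^{d-2}|/|S^{d-1}| is the normalizing one *)
Definition I11 : set R := `]-1, 1[.

Definition nu_weight (d : nat) (t : R) : R := (1 - t ^+ 2) `^ ((d%:R - 3) / 2).
Definition nu_const (d : nat) : R :=
  (fine (\int[lebesgue_measure]_(t in I11) (nu_weight d t)%:E)%E)^-1.
Definition nu_int (d : nat) (g : R -> \bar R) : \bar R :=
  (\int[lebesgue_measure]_(t in I11) ((nu_const d * nu_weight d t)%:E * g t))%E.

Definition perp_unit (n : nat) (w y : n.-tuple R) : n.-tuple R :=
  normalize [tuple tnth y i - dotp y w * tnth w i | i < n].

(* Rf(omega,t) = average of f over the (d-2)-sphere S^{d-1} ∩ {x.omega = t}
   = { t omega + sqrt(1-t^2) u : u unit vector in omega^perp }; the uniform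
   probability measure on the unit sphere of omega^perp is the push-forward of
   sigma under y |-> perp_unit omega y. *)
Definition radon (n : nat) (f : n.-tuple R -> \bar R) (w : n.-tuple R) (t : R) : \bar R :=
  sph_int (fun y => f [tuple t * tnth w i + Num.sqrt (1 - t ^+ 2) * tnth (perp_unit w y) i
                       | i < n]).

Definition Lp_sigma (n : nat) (p : R) (f : n.-tuple R -> \bar R) : \bar R :=
  poweR (sph_int (fun x => poweR (f x) p)) p^-1.

Definition Lq_nu_sigma (d : nat) (q : R) (F : d.-tuple R -> R -> \bar R) : \bar R :=
  poweR (sph_int (fun w => nu_int d (fun t => poweR (F w t) q))) q^-1.

End Defs.

(* Main.v *)
Require Import Defs.
From HB Require Import structures.
From mathcomp Require Import all_boot all_order all_algebra.
From mathcomp Require Import all_classical all_reals all_analysis measurable_realfun.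
From mathcomp Require Import unstable ring lra.
Set Implicit Arguments.
Unset Strict Implicit.
Unset Printing Implicit Defensive.
Import Order.TTheory GRing.Theory Num.Theory.
Import numFieldNormedType.Exports.
Import HBNNSimple.
Local Open Scope classical_set_scope.
Local Open Scope ring_scope.

(* Write R_i(t) for the average of f over the slice x.w_i = t, where (w_i) is an
   orthonormal frame of R^d, and a_i = E R_i(x.w_i)^q for x uniform on the sphere.
   It suffices to show ||f||_p^q <= (a_1 + ... + a_d) / d for each frame and to
   average over a random frame. Let
     U = f prod_i (R_i(x.w_i)^(q-1) / a_i)^(1/d),
     V = prod_i (R_i(x.w_i)^r / a_i^(r/q))^(1/2),  r = 2 (1-q) p / (d (1-p)) <= q.
   Then E U <= 1 by AM-GM and disintegration, and E V <= 1 by the Carlen-Lieb-Loss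
   inequality E prod_i u_i(x.w_i)^(1/2) <= prod_i (E u_i(x.w_i))^(1/2) and Jensen.
   As f^p = U^p V^(1-p) prod_i a_i^(p/(dq)), Young's inequality gives
   E f^p <= prod_i a_i^(p/(dq)), and AM-GM concludes.
   The Carlen-Lieb-Loss inequality is proved by a time-discretized heat flow on
   polynomials (the product's mean increases along the flow), then extended to
   Lipschitz functions by Bernstein polynomials and to bounded measurable ones by
   Lebesgue differentiation. *)

(** The surface measure is only given as the law of x/|x| under the Gaussian measure, so its
    symmetries come from the Gaussian: the product structure gives independence of coordinates,
    plane rotations give invariance, polar coordinates give the slice formula. The value of r is
    forced by cancelling the powers of R_i in U^p V^(1-p). The hypothesis on p and q says exactly
    that r <= q, which is what Jensen needs for E V <= 1; its factor 1/2 is the exponent of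
    Carlen-Lieb-Loss. At p = 1 the choice of r breaks down, but then q = 1 and the inequality for a
    frame is an equality. Logarithms require f to lie between positive constants. A general f is
    reached by simple functions below f^p, to whose p-th root a small constant is added; its cost is
    bounded by the subadditivity of x^q. The heat flow is run on polynomials because its generator
    is diagonalizable there: each mode decays explicitly, and s Euler steps of size of order e^2
    cost O(s e^3) = O(e) in total for a fixed time. *)

Lemma ge0_integral_density {dT} {T : measurableType dT} {R : realType}
    (mu nu : {measure set T -> \bar R}) (g : T -> R) :
  measurable_fun setT g -> (forall x, 0 <= g x) ->
  (forall A, measurable A -> nu A = (\int[mu]_(x in A) (g x)%:E)%E) ->
  forall f : T -> \bar R, measurable_fun setT f -> (forall x, (0 <= f x)%E) ->
  (\int[nu]_x f x = \int[mu]_x (f x * (g x)%:E))%E.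
Proof.
move=> mg g0 nuE f mf f0.
have mgE : measurable_fun setT (EFin \o g) by exact/measurable_EFinP.
(* Both sides are limits along the same increasing simple functions, so the claim reduces to their
   level sets. *)
pose h := nnsfun_approx measurableT mf.
have hcvg x : EFin \o h ^~ x @ \oo --> f x by apply: cvg_nnsfun_approx => //.
have hnd x m n : (m <= n)%N -> h m x <= h n x.
  by move=> mn; exact/lefP/nd_nnsfun_approx.
have -> : (\int[nu]_x f x = limn (fun n => \int[nu]_x (EFin \o h n) x))%E.
  rewrite -monotone_convergence//=.
  - by apply: eq_integral => x _; apply/esym/cvg_lim => //; exact: hcvg.
  - by move=> n; exact/measurable_EFinP.
  - by move=> n x _; rewrite lee_fin.
  - by move=> x _ m n mn; rewrite lee_fin hnd.
have -> : (\int[mu]_x (f x * (g x)%:E) =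
           limn (fun n => \int[mu]_x ((EFin \o h n) x * (g x)%:E)))%E.
  rewrite -monotone_convergence//=.
  - apply: eq_integral => x _; apply/esym/cvg_lim => //.
    by apply: cvgeZr => //; exact: hcvg.
  - by move=> n; apply: emeasurable_funM => //; exact/measurable_EFinP.
  - by move=> n x _; rewrite -EFinM lee_fin mulr_ge0.
  - by move=> x _ m n mn; rewrite -!EFinM lee_fin ler_wpM2r// hnd.
congr (limn _); apply/funext => n.
under eq_integral do rewrite /= fimfunE -fsumEFin//.
rewrite ge0_integral_fsum//=; last 2 first.
  - by move=> y; exact/measurable_EFinP/measurable_funM.
  - by move=> y x _; rewrite nnfun_muleindic_ge0.
have mset y : measurable (h n @^-1` [set y]) by [].
transitivity (\int[mu]_x \sum_(y \in range (h n))
    ((y * \1_(h n @^-1` [set y]) x)%:E * (g x)%:E))%E; last first.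
  apply: eq_integral => x _; rewrite /= (fimfunE (h n) x) -fsumEFin//.
  rewrite ge0_mule_fsuml// => y.
  by rewrite nnfun_muleindic_ge0.
rewrite ge0_integral_fsum//=; last 2 first.
  - move=> y; apply: emeasurable_funM => //.
    exact/measurable_EFinP/measurable_funM.
  - by move=> y x _; rewrite mule_ge0 ?nnfun_muleindic_ge0// lee_fin.
apply: eq_fsbigr => y; rewrite inE => -[x0 _ <-].
have y0 : 0 <= h n x0 by [].
under eq_integral do rewrite EFinM.
rewrite ge0_integralZl//; [|exact/measurable_EFinP].
rewrite integral_indic// setIT nuE//.
under [in RHS]eq_integral do rewrite EFinM -muleA.
rewrite ge0_integralZl//; first last.
- by move=> x _; rewrite -EFinM lee_fin mulr_ge0.
- by apply: emeasurable_funM => //; exact/measurable_EFinP.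
congr (_ * _)%E; rewrite integral_mkcond.
apply: eq_integral => x _; rewrite patchE indicE.
by case: ifPn => _; rewrite ?mul1e ?mul0e.
Qed.

Section Tonelli.
Context {d1 d2} {T1 : measurableType d1} {T2 : measurableType d2} {R : realType}.
Variables (m1 : {sigma_finite_measure set T1 -> \bar R})
  (m2 : {sigma_finite_measure set T2 -> \bar R}) (f : T1 -> T2 -> \bar R).
Local Open Scope ereal_scope.

Lemma measurable_integral_param :
  measurable_fun setT (fun p : T1 * T2 => f p.1 p.2) ->
  (forall x y, 0 <= f x y) ->
  measurable_fun setT (fun x => \int[m2]_y f x y).
Proof.
move=> mf f0; apply: (@measurable_fun_fubini_tonelli_F _ _ _ _ _ m2
  (fun p => f p.1 p.2)) => //.
Qed.

Lemma tonelli :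
  measurable_fun setT (fun p : T1 * T2 => f p.1 p.2) ->
  (forall x y, 0 <= f x y) ->
  \int[m1]_x \int[m2]_y f x y = \int[m2]_y \int[m1]_x f x y.
Proof.
by move=> mf f0; apply: (@fubini_tonelli _ _ _ _ _ m1 m2 (fun p => f p.1 p.2)).
Qed.

End Tonelli.

Lemma measurable_fun2_comp d1 d2 (T1 : measurableType d1) (T2 : measurableType d2)
    (R : realType) (F : T1 -> T2 -> \bar R) d (T : measurableType d) (u : T -> T1) (v : T -> T2) :
  measurable_fun setT (fun p => F p.1 p.2) ->
  measurable_fun setT u -> measurable_fun setT v ->
  measurable_fun setT (fun t => F (u t) (v t)).
Proof.
by move=> mF mu mv; exact: (measurableT_comp mF (measurable_fun_pair mu mv)).
Qed.

(** * Gaussian measure and its rotations *)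

Section GaussianMeasure.
Context {R : realType}.
Local Open Scope ereal_scope.

Definition consp n (p : R * n.-tuple R) : n.+1.-tuple R := [tuple of p.1 :: p.2].

Lemma measurable_consp n : measurable_fun setT (@consp n).
Proof. exact: measurable_cons. Qed.

HB.instance Definition _ n :=
  isMeasurableFun.Build _ _ _ _ (@consp n) (@measurable_consp n).

(* [measurableTypeR R], on which the Lebesgue measure lives, and [R] have the
   same measurable sets but different displays. *)
Definition idTR : measurableTypeR R -> R := idfun.

Lemma measurable_idTR : measurable_fun setT idTR.
Proof. by move=> _ A mA; rewrite setTI. Qed.

HB.instance Definition _ := isMeasurableFun.Build _ _ _ _ idTR measurable_idTR.

Definition gauss1 : probability R R := distribution (normal_prob 0 1) idTR.

Fixpoint gaussM (n : nat) : probability (n.-tuple R) R :=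
  match n return probability (n.-tuple R) R with
  | 0 => \d_([tuple] : 0.-tuple R)
  | m.+1 => distribution (gauss1 \x gaussM m)%E (@consp m)
  end.

Lemma gdens_ge0 (x : R) : (0 <= gdens x)%R.
Proof. by rewrite divr_ge0 ?expR_ge0 ?sqrtr_ge0. Qed.

Lemma normal_pdf01E (x : R) : normal_pdf 0 1 x = gdens x.
Proof.
rewrite normal_pdfE ?oner_eq0// /gdens /normal_peak /normal_fun.
by rewrite subr0 expr1n mul1r mulrC !mulr_natl.
Qed.

Lemma measurable_gdens : measurable_fun setT (@gdens R).
Proof.
rewrite (_ : @gdens R = normal_pdf 0 1); first exact: measurable_normal_pdf.
by apply/funext => x; rewrite normal_pdf01E.
Qed.

Lemma integral_gauss1 (f : R -> \bar R) :
  measurable_fun setT f -> (forall x, 0 <= f x) ->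
  \int[gauss1]_x f x = \int[lebesgue_measure]_x ((gdens x)%:E * f x).
Proof.
move=> mf f0; rewrite ge0_integral_distribution//=.
rewrite (@ge0_integral_density _ _ _ lebesgue_measure _ (@gdens R))//.
- by apply: eq_integral => x _; rewrite muleC.
- exact: measurable_gdens.
- exact: gdens_ge0.
- move=> A mA; rewrite /normal_prob.
  by apply: eq_integral => x _; rewrite normal_pdf01E.
Qed.

Lemma integral_gaussMS n (F : n.+1.-tuple R -> \bar R) :
  measurable_fun setT F -> (forall x, 0 <= F x) ->
  \int[gaussM n.+1]_x F x =
  \int[gauss1]_a \int[gaussM n]_x F (consp (a, x)).
Proof.
move=> mF F0; rewrite ge0_integral_distribution//=.
rewrite fubini_tonelli1//.
exact: measurableT_comp.
Qed.

(** Tonelli turns the iterated integral of the definitions into an integral against a genuine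
    probability measure, to which limit theorems and changes of variable apply. *)
Lemma gint_gaussM n (F : n.-tuple R -> \bar R) :
  measurable_fun setT F -> (forall x, 0 <= F x) ->
  gint F = \int[gaussM n]_x F x.
Proof.
elim: n F => [F mF F0|n IH F mF F0] /=.
  by rewrite integral_dirac//= diracT mul1e.
have mFc : measurable_fun setT (F \o @consp n) by exact: measurableT_comp.
rewrite -[RHS]/(\int[gaussM n.+1]_x F x) integral_gaussMS// integral_gauss1//.
- apply: eq_integral => a _; rewrite IH//.
  by apply: measurableT_comp => //; exact: measurable_cons.
- by apply: measurable_integral_param => // -[].
- by move=> x; exact: integral_ge0.
Qed.

End GaussianMeasure.

(** * Affine changes of variable on the line *)

Section LebesgueAffine.
Context {R : realType}.
Local Open Scope ereal_scope.
Local Notation mu := (@lebesgue_measure R).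

(** [k] times the push-forward of Lebesgue measure under x |-> k x + a gives every half-open
    interval its length, so it is Lebesgue measure by uniqueness. *)
Lemma integral_lebesgue_affine (k a : R) (h : R -> \bar R) :
  (0 < k)%R -> measurable_fun setT h -> (forall x, 0 <= h x) ->
  \int[mu]_x h (k * x + a)%R = k^-1%:E * \int[mu]_x h x.
Proof.
move=> k0 mh h0.
have kN0 : k != 0%R by rewrite gt_eqF.
pose phi : measurableTypeR R -> measurableTypeR R := fun x => (k * x + a)%R.
have mphi : measurable_fun setT phi.
  apply: (@measurable_funD _ _ _ _ (fun x : measurableTypeR R => k * x)%R) => //.
  exact: mulrl_measurable.
have k0' : (0 <= k)%R by exact: ltW.
pose nu : {measure set (measurableTypeR R) -> \bar R} :=
  mscale (NngNum k0')
    (measure_function_pushforward__canonical__measure_function_Measure mu mphi).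
have nuE A : measurable A -> mu A = nu A.
  apply: lebesgue_measure_unique => _ [[u v]] _ <-.
  rewrite -[RHS]/(k%:E * mu (phi @^-1` `]u, v]%classic)).
  rewrite (_ : phi @^-1` _ = [set` Interval (BRight ((u - a) / k)%R) (BRight ((v - a) / k)%R)]); last first.
    apply/seteqP; split => x /=; rewrite !in_itv/= /phi.
      by rewrite ltr_pdivrMr// ler_pdivlMr// ltrBlDr lerBrDr mulrC.
    by rewrite ltr_pdivrMr// ler_pdivlMr// ltrBlDr lerBrDr mulrC.
  rewrite !lebesgue_measure_itv/= !lte_fin ltr_pM2r ?invr_gt0// ltrBrDr subrK.
  case: ifPn => _; last by rewrite mule0.
  by rewrite -!EFinD -EFinM; congr EFin; field.
rewrite [in RHS](@eq_measure_integral _ _ _ _ nu)//; last first.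
  by move=> A mA _; exact: nuE.
rewrite ge0_integral_mscale//= ge0_integral_pushforward//=.
by rewrite muleA -EFinM mulVf// mul1e preimage_setT.
Qed.

Lemma tonelli_lebesgue2 (H : R -> R -> \bar R) :
  measurable_fun setT (fun p => H p.1 p.2) -> (forall x y, 0 <= H x y) ->
  \int[mu]_x \int[mu]_y H x y = \int[mu]_y \int[mu]_x H x y.
Proof.
move=> mH H0; apply: (@tonelli _ _ _ _ _ mu mu H) => //.
Qed.
End LebesgueAffine.

(** * Rotations of the two-dimensional Gaussian *)

Section Rotation2.
Context {R : realType}.
Local Open Scope ereal_scope.
Local Notation mu := (@lebesgue_measure R).
Local Notation gauss1 := (@gauss1 R).

Lemma integral_lebesgue_translation (a : R) (h : R -> \bar R) :
  measurable_fun setT h -> (forall x, 0 <= h x) ->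
  \int[mu]_x h (x + a)%R = \int[mu]_x h x.
Proof.
move=> mh h0; have := @integral_lebesgue_affine R 1 a h ltr01 mh h0.
by rewrite invr1 mul1e => <-; apply: eq_integral => x _; rewrite mul1r.
Qed.

Lemma integral_gauss1_2 (F : R -> R -> \bar R) :
  measurable_fun setT (fun p => F p.1 p.2) -> (forall x y, 0 <= F x y) ->
  \int[gauss1]_x \int[gauss1]_y F x y =
  \int[mu]_x \int[mu]_y ((gdens x * gdens y)%:E * F x y).
Proof.
move=> mF F0; rewrite integral_gauss1//; first last.
- by move=> x; exact: integral_ge0.
- exact: measurable_integral_param.
apply: eq_integral => x _.
have mFx : measurable_fun setT (F x).
  by have /= := measurableT_comp mF (pair1_measurable x).
rewrite integral_gauss1// -ge0_integralZl//; last 3 first.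
- apply: emeasurable_funM => //; apply/measurable_EFinP.
  exact: measurable_gdens.
- by move=> y _; rewrite mule_ge0// lee_fin gdens_ge0.
- by rewrite lee_fin gdens_ge0.
by apply: eq_integral => y _; rewrite EFinM muleA.
Qed.

Lemma gdens_rot (c s x y : R) : (c ^+ 2 + s ^+ 2 = 1 ->
  gdens (c * x - s * y) * gdens (s * x + c * y) = gdens x * gdens y)%R.
Proof.
move=> cs; rewrite /gdens.
rewrite [LHS]mulrACA [RHS]mulrACA -!expRD; congr (expR _ * _)%R.
rewrite -!mulrDl -!opprD; congr (- _ / _)%R.
transitivity ((c ^+ 2 + s ^+ 2) * (x ^+ 2 + y ^+ 2))%R; first by ring.
by rewrite cs mul1r.
Qed.

(* A plane rotation other than the half-turn is a product of three shears,
   each of which preserves the Lebesgue measure. *)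
Lemma integral_lebesgue_rot (c s : R) (H : R -> R -> \bar R) :
  (c ^+ 2 + s ^+ 2 = 1)%R -> c != (-1)%R ->
  measurable_fun setT (fun p => H p.1 p.2) -> (forall x y, 0 <= H x y) ->
  \int[mu]_x \int[mu]_y H (c * x - s * y)%R (s * x + c * y)%R =
  \int[mu]_x \int[mu]_y H x y.
Proof.
move=> cs cN1 mH H0.
have c1 : (1 + c != 0)%R by rewrite addrC addr_eq0.
(* The tangent of half the angle: the rotation is the horizontal shear by [- tau], the vertical one
   by [s], and the horizontal one by [- tau] again. *)
pose tau := (s / (1 + c))%R.
have shear1 (G : R -> R -> \bar R) (a : R) :
    measurable_fun setT (fun p => G p.1 p.2) -> (forall x y, 0 <= G x y) ->
    \int[mu]_x \int[mu]_y G (x + a * y)%R y = \int[mu]_x \int[mu]_y G x y.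
  move=> mG G0.
  have mGs : measurable_fun setT (fun p : R * R => G (p.1 + a * p.2)%R p.2).
    apply: measurable_fun2_comp => //.
    by apply: measurable_funD => //; apply: measurable_funM.
  apply: (etrans (@tonelli_lebesgue2 _ (fun x y => G (x + a * y)%R y) mGs _)) => //.
  apply: (etrans _ (esym (@tonelli_lebesgue2 _ G mG G0))).
  apply: eq_integral => y _.
  apply: (@integral_lebesgue_translation (a * y)%R (G ^~ y)) => //.
  exact: measurable_fun2_comp.
have shear2 (G : R -> R -> \bar R) (a : R) :
    measurable_fun setT (fun p => G p.1 p.2) -> (forall x y, 0 <= G x y) ->
    \int[mu]_x \int[mu]_y G x (y + a * x)%R = \int[mu]_x \int[mu]_y G x y.
  move=> mG G0; apply: eq_integral => x _.
  apply: (@integral_lebesgue_translation (a * x)%R (G x)) => //.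
  exact: measurable_fun2_comp.
have mS1 : measurable_fun setT (fun p : R * R => H (p.1 + - tau * p.2)%R p.2).
  apply: measurable_fun2_comp => //.
  by apply: measurable_funD => //; apply: measurable_funM.
have mS2 : measurable_fun setT
    (fun p : R * R => H (p.1 + - tau * (p.2 + s * p.1))%R (p.2 + s * p.1)%R).
  apply: (@measurable_fun2_comp _ _ _ _ _ (fun x y : R => H (x + - tau * y)%R y)) => //.
  by apply: measurable_funD => //; apply: measurable_funM.
apply: (etrans _ (shear1 H (- tau)%R mH H0)).
apply: (etrans _ (shear2 (fun x y => H (x + - tau * y)%R y) s mS1
  (fun x y => H0 _ _))).
apply: (etrans _ (shear1 (fun x y => H (x + - tau * (y + s * x))%R
  (y + s * x)%R) (- tau)%R mS2 (fun x y => H0 _ _))).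
apply: eq_integral => x _; apply: eq_integral => y _.
have s2 : (s ^+ 2 = (1 - c) * (1 + c))%R by rewrite -[in RHS](subrK 1%R c); lra.
have taus : (tau * s = 1 - c)%R.
  by rewrite /tau mulrAC -expr2 s2 mulfK.
have tauc : (tau * (1 + c) = s)%R by rewrite /tau divfK.
congr H.
  transitivity (x * (1 - tau * s) - tau * (1 + (1 - tau * s)) * y)%R; last by ring.
  by rewrite taus subKr tauc; ring.
transitivity (s * x + (1 - tau * s) * y)%R; last by ring.
by rewrite taus subKr.
Qed.

Lemma integral_gauss1_rot (c s : R) (F : R -> R -> \bar R) :
  (c ^+ 2 + s ^+ 2 = 1)%R ->
  measurable_fun setT (fun p => F p.1 p.2) -> (forall x y, 0 <= F x y) ->
  \int[gauss1]_x \int[gauss1]_y F (c * x - s * y)%R (s * x + c * y)%R =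
  \int[gauss1]_x \int[gauss1]_y F x y.
Proof.
(* The half-turn, where the half-angle tangent is infinite, is a quarter-turn applied twice. *)
wlog cN1 : c s F / c != (-1)%R => [wlg cs mF F0|cs mF F0].
  have [cN1|] := eqVneq c (-1)%R; last by move=> ?; exact: wlg.
  have s0 : s = 0%R by apply/eqP; rewrite -sqrf_eq0; move: cs; rewrite cN1; lra.
  have i01 : (0 ^+ 2 + 1 ^+ 2 = 1 :> R)%R by rewrite expr0n expr1n add0r.
  have N0 : 0%R != (-1)%R :> R by rewrite eq_sym oppr_eq0 oner_eq0.
  have mF' : measurable_fun setT
      (fun p : R * R => F (0 * p.1 - 1 * p.2)%R (1 * p.1 + 0 * p.2)%R).
    apply: measurable_fun2_comp => //.
      by apply: measurable_funB; apply: measurable_funM.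
    by apply: measurable_funD; apply: measurable_funM.
  have e1 := wlg 0%R 1%R F N0 i01 mF F0.
  have e2 := wlg 0%R 1%R (fun x y => F (0 * x - 1 * y)%R (1 * x + 0 * y)%R)
    N0 i01 mF' (fun x y => F0 _ _).
  rewrite -e1 -e2.
  apply: eq_integral => x _; apply: eq_integral => y _.
  by rewrite cN1 s0; congr F; ring.
have mrot : measurable_fun setT
    (fun p : R * R => F (c * p.1 - s * p.2)%R (s * p.1 + c * p.2)%R).
  apply: measurable_fun2_comp => //.
    by apply: measurable_funB; apply: measurable_funM.
  by apply: measurable_funD; apply: measurable_funM.
apply: (etrans (@integral_gauss1_2
  (fun x y => F (c * x - s * y)%R (s * x + c * y)%R) mrot (fun x y => F0 _ _))).
apply: (etrans _ (esym (integral_gauss1_2 mF F0))).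
pose H x y := (gdens x * gdens y)%:E * F x y.
have mH : measurable_fun setT (fun p : R * R => H p.1 p.2).
  apply: emeasurable_funM => //; apply/measurable_EFinP.
  by apply: measurable_funM; apply: (measurableT_comp (@measurable_gdens R)).
have H0 x y : 0 <= H x y by rewrite mule_ge0// lee_fin mulr_ge0// gdens_ge0.
apply: (etrans _ (integral_lebesgue_rot cs cN1 mH H0)).
apply: eq_integral => x _; apply: eq_integral => y _.
by rewrite /H gdens_rot.
Qed.

End Rotation2.

(** * Vectors as tuples *)

Section TupleVec.
Context {R : realType}.
Implicit Types n : nat.

(** Multiples of [x] are written with second coefficient 0, so that linearity of a map is a single
    identity. *)
Definition comb n (a : R) (x : n.-tuple R) (b : R) (y : n.-tuple R) : n.-tuple R :=
  [tuple a * tnth x i + b * tnth y i | i < n].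

Lemma tnth_comb n a (x : n.-tuple R) b y i :
  tnth (comb a x b y) i = a * tnth x i + b * tnth y i.
Proof. by rewrite tnth_mktuple. Qed.

Lemma tnth_consp0 n (a : R) (x : n.-tuple R) : tnth (consp (a, x)) ord0 = a.
Proof. by []. Qed.

Lemma tnth_consS n (a : R) (x : n.-tuple R) i :
  tnth (consp (a, x)) (lift ord0 i) = tnth x i.
Proof. by rewrite /consp tnthS. Qed.

Lemma tnth_normalize n (x : n.-tuple R) i :
  tnth (normalize x) i = tnth x i / enorm x.
Proof. by rewrite tnth_mktuple. Qed.

Lemma dotpC n (x y : n.-tuple R) : dotp x y = dotp y x.
Proof. by apply: eq_bigr => i _; rewrite mulrC. Qed.

Lemma dotp_combl n a (x : n.-tuple R) b y z :
  dotp (comb a x b y) z = a * dotp x z + b * dotp y z.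
Proof.
rewrite /dotp !mulr_sumr -big_split; apply: eq_bigr => i _ /=.
by rewrite tnth_comb; ring.
Qed.

Lemma dotp_combr n a (x : n.-tuple R) b y z :
  dotp z (comb a x b y) = a * dotp z x + b * dotp z y.
Proof. by rewrite dotpC dotp_combl ![dotp _ z]dotpC. Qed.

Lemma dotp_ge0 n (x : n.-tuple R) : 0 <= dotp x x.
Proof. by apply: sumr_ge0 => i _; rewrite -expr2 sqr_ge0. Qed.

Lemma dotp_cons n (a b : R) (x y : n.-tuple R) :
  dotp (consp (a, x)) (consp (b, y)) = a * b + dotp x y.
Proof.
rewrite /dotp big_ord_recl !tnth_consp0; congr (_ + _).
by apply: eq_bigr => i _; rewrite !tnth_consS.
Qed.

Lemma enorm_ge0 n (x : n.-tuple R) : 0 <= enorm x.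
Proof. exact: sqrtr_ge0. Qed.

Lemma sqr_enorm n (x : n.-tuple R) : enorm x ^+ 2 = dotp x x.
Proof. by rewrite sqr_sqrtr// dotp_ge0. Qed.

Lemma enorm_eq0 n (x : n.-tuple R) : enorm x = 0 -> forall i, tnth x i = 0.
Proof.
move=> x0 i; have : dotp x x = 0 by rewrite -sqr_enorm x0 expr0n.
move/eqP; rewrite psumr_eq0 => [|j _]; last by rewrite -expr2 sqr_ge0.
by move/allP => /(_ i); rewrite mem_index_enum => /(_ isT); rewrite -expr2 sqrf_eq0 => /eqP.
Qed.

Lemma normalizeE n (x : n.-tuple R) : normalize x = comb (enorm x)^-1 x 0 x.
Proof.
by apply: eq_from_tnth => i; rewrite tnth_normalize tnth_comb mul0r addr0 mulrC.
Qed.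

Lemma enorm_comb0 n a (x : n.-tuple R) y : enorm (comb a x 0 y) = `|a| * enorm x.
Proof.
rewrite /enorm dotp_combl !dotp_combr !mul0r !addr0 mulrA -expr2.
by rewrite sqrtrM ?sqr_ge0// sqrtr_sqr.
Qed.

Lemma normalize_comb0 n a (x : n.-tuple R) y : 0 < a ->
  normalize (comb a x 0 y) = normalize x.
Proof.
move=> a0; apply: eq_from_tnth => i; rewrite !tnth_normalize enorm_comb0 tnth_comb.
rewrite mul0r addr0 gtr0_norm// -mulf_div divff ?mul1r//.
by rewrite gt_eqF.
Qed.

Lemma enorm_normalize n (x : n.-tuple R) : enorm x != 0 -> enorm (normalize x) = 1.
Proof.
by move=> x0; rewrite normalizeE enorm_comb0 ger0_norm ?invr_ge0 ?enorm_ge0// mulVf.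
Qed.

Lemma dotp_normalize n (x : n.-tuple R) : enorm x != 0 ->
  dotp (normalize x) (normalize x) = 1.
Proof. by move=> x0; rewrite -sqr_enorm enorm_normalize// expr1n. Qed.

Lemma normK n (x : n.-tuple R) : comb (enorm x) (normalize x) 0 x = x.
Proof.
apply: eq_from_tnth => i; rewrite tnth_comb tnth_normalize mul0r addr0.
have [x0|x0] := eqVneq (enorm x) 0; first by rewrite x0 enorm_eq0// mul0r.
by rewrite mulrC divfK.
Qed.

Lemma tnth_sqr_le n (x : n.-tuple R) i : tnth x i ^+ 2 <= dotp x x.
Proof.
rewrite /dotp (bigD1 i)//= -expr2 lerDl.
by apply: sumr_ge0 => j _; rewrite -expr2 sqr_ge0.
Qed.

(** Only an inequality: division by 0 gives 0, so the zero vector is its own normalization. *)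
Lemma normalize_le1 n (x : n.-tuple R) : dotp (normalize x) (normalize x) <= 1.
Proof.
have [x0|x0] := eqVneq (enorm x) 0; last by rewrite dotp_normalize.
rewrite [leLHS]big1// => i _; rewrite tnth_normalize enorm_eq0//.
by rewrite mul0r mul0r.
Qed.

Definition e0 n : n.+1.-tuple R := [tuple (i == ord0)%:R | i < n.+1].

Lemma dotp_e0 n (x : n.+1.-tuple R) : dotp x (e0 n) = tnth x ord0.
Proof.
rewrite /dotp (bigD1 ord0)//= big1 ?addr0 ?tnth_mktuple ?mulr1// => i i0.
by rewrite tnth_mktuple (negbTE i0) mulr0.
Qed.

Lemma consp_eta n (x : n.+1.-tuple R) : x = consp (tnth x ord0, [tuple of behead x]).
Proof. by rewrite {1}(tuple_eta x). Qed.

End TupleVec.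

Section TupleMeasurable.
Context {R : realType} {d : measure_display} {T : measurableType d}.

Lemma measurable_mktuple n (F : 'I_n -> T -> R) :
  (forall i, measurable_fun setT (F i)) ->
  measurable_fun setT (fun t => [tuple F i t | i < n]).
Proof.
move=> mF; apply/measurable_fun_tnthP => i.
by rewrite (_ : _ \o _ = F i)//; apply/funext => t /=; rewrite tnth_mktuple.
Qed.

Lemma measurable_tnth_comp n (f : T -> n.-tuple R) i :
  measurable_fun setT f -> measurable_fun setT (fun t => tnth (f t) i).
Proof. by move=> mf; apply: (measurableT_comp (measurable_tnth i)). Qed.

Lemma measurable_dotp n (f g : T -> n.-tuple R) :
  measurable_fun setT f -> measurable_fun setT g ->
  measurable_fun setT (fun t => dotp (f t) (g t)).
Proof.
move=> mf mg; apply: measurable_sum => i.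
by apply: measurable_funM; exact: measurable_tnth_comp.
Qed.

Lemma measurable_sqrt_comp (f : T -> R) :
  measurable_fun setT f -> measurable_fun setT (fun t => Num.sqrt (f t)).
Proof.
move=> mf; apply: (measurableT_comp _ mf).
by apply: continuous_measurable_fun; exact: sqrt_continuous.
Qed.

Lemma measurable_enorm n (f : T -> n.-tuple R) :
  measurable_fun setT f -> measurable_fun setT (fun t => enorm (f t)).
Proof. by move=> mf; apply: measurable_sqrt_comp; exact: measurable_dotp. Qed.

Lemma measurable_inv_comp (f : T -> R) :
  measurable_fun setT f -> measurable_fun setT (fun t => (f t)^-1).
Proof.
move=> mf.
(* The power -1 is the inverse on nonnegative reals, hence the square; where f vanishes both sides
   are 0. *)
rewrite (_ : (fun t => _) = (fun t => f t * (f t ^+ 2) `^ (-1))); last first.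
  apply/funext => t; rewrite powR_inv1 ?sqr_ge0//.
  have [->|ft0] := eqVneq (f t) 0; first by rewrite invr0 mul0r.
  by rewrite expr2 invfM mulrA divff// mul1r.
apply: measurable_funM => //; apply: (measurableT_comp (measurable_powR _)).
exact: measurable_funX.
Qed.

Lemma measurable_comb n (a b : T -> R) (f g : T -> n.-tuple R) :
  measurable_fun setT a -> measurable_fun setT f ->
  measurable_fun setT b -> measurable_fun setT g ->
  measurable_fun setT (fun t => comb (a t) (f t) (b t) (g t)).
Proof.
move=> ma mf mb mg; apply: measurable_mktuple => i.
by apply: measurable_funD; apply: measurable_funM => //; exact: measurable_tnth_comp.
Qed.

Lemma measurable_normalize n (f : T -> n.-tuple R) :
  measurable_fun setT f -> measurable_fun setT (fun t => normalize (f t)).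
Proof.
move=> mf; apply: measurable_mktuple => i.
apply: measurable_funM; first exact: measurable_tnth_comp.
by apply: measurable_inv_comp; exact: measurable_enorm.
Qed.

Lemma measurable_consp_comp n (a : T -> R) (f : T -> n.-tuple R) :
  measurable_fun setT a -> measurable_fun setT f ->
  measurable_fun setT (fun t => consp (a t, f t)).
Proof. exact: measurable_cons. Qed.

End TupleMeasurable.

(** * Linear isometries preserving the Gaussian measure *)

Section GaussianIsometries.
Context {R : realType}.
Local Open Scope ereal_scope.

(** Invariance of the Gaussian is carried along instead of being derived from orthogonality. The
    class contains the plane rotations and is stable under composition and under adding a fixed
    first coordinate, which suffices to build random frames. *)
Definition gauss_isom n (O : n.-tuple R -> n.-tuple R) :=
  [/\ measurable_fun setT O,
      forall a x b y, O (comb a x b y) = comb a (O x) b (O y),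
      forall x y, dotp (O x) (O y) = dotp x y
    & forall F : n.-tuple R -> \bar R, measurable_fun setT F ->
        (forall x, 0 <= F x) ->
        \int[gaussM n]_x F (O x) = \int[gaussM n]_x F x].

Lemma gauss_isom_comp n (O1 O2 : n.-tuple R -> n.-tuple R) :
  gauss_isom O1 -> gauss_isom O2 -> gauss_isom (O1 \o O2).
Proof.
move=> [m1 l1 d1 i1] [m2 l2 d2 i2]; split => /=.
- exact: measurableT_comp.
- by move=> a x b y; rewrite l2 l1.
- by move=> x y; rewrite d1 d2.
- move=> F mF F0; rewrite -[RHS]i1//.
  by apply: (i2 (F \o O1)) => [|x] /=; [exact: measurableT_comp|].
Qed.

Lemma gauss_isom_id n : gauss_isom (@id (n.-tuple R)).
Proof. by split => //; exact: measurable_id. Qed.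

Lemma gauss_isom_enorm n (O : n.-tuple R -> n.-tuple R) x : gauss_isom O ->
  enorm (O x) = enorm x.
Proof. by move=> [_ _ dO _]; rewrite /enorm dO. Qed.

Lemma gauss_isom_normalize n (O : n.-tuple R -> n.-tuple R) x : gauss_isom O ->
  O (normalize x) = normalize (O x).
Proof.
by move=> gO; have [_ lO _ _] := gO; rewrite !normalizeE lO gauss_isom_enorm.
Qed.

Lemma gauss_isom_cons n (O : n.-tuple R -> n.-tuple R) : gauss_isom O ->
  gauss_isom (fun x : n.+1.-tuple R => consp (tnth x ord0, O [tuple of behead x])).
Proof.
move=> [mO lO dO iO].
have mcO : measurable_fun setT
    (fun x : n.+1.-tuple R => consp (tnth x ord0, O [tuple of behead x])).
  apply: measurable_consp_comp; first exact: measurable_tnth.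
  by apply: measurableT_comp => //; exact: measurable_behead.
split => //.
- move=> a x b y; rewrite (consp_eta x) (consp_eta y) !tnth_consp0.
  set x' := [tuple of behead x]; set y' := [tuple of behead y].
  rewrite (_ : comb a (consp (_, x')) b _ =
    consp (a * tnth x ord0 + b * tnth y ord0, comb a x' b y')%R); last first.
    apply: eq_from_tnth => i; rewrite tnth_comb.
    case: (unliftP ord0 i) => [j ->|->]; last by rewrite !tnth_consp0.
    by rewrite !tnth_consS tnth_comb.
  have bK (c : R) (z : n.-tuple R) : [tuple of behead (consp (c, z))] = z.
    exact: val_inj.
  rewrite tnth_consp0 !bK lO; apply: eq_from_tnth => i; rewrite tnth_comb.
  case: (unliftP ord0 i) => [j ->|->]; last by rewrite !tnth_consp0.
  by rewrite !tnth_consS tnth_comb.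
- move=> x y; rewrite dotp_cons dO.
  by rewrite [in RHS](consp_eta x) [in RHS](consp_eta y) dotp_cons.
- move=> F mF F0.
  have bK (c : R) (z : n.-tuple R) : [tuple of behead (consp (c, z))] = z.
    exact: val_inj.
  rewrite !integral_gaussMS//; last exact: measurableT_comp.
  apply: eq_integral => a _.
  under eq_integral do rewrite tnth_consp0 bK.
  apply: (iO (fun x => F (consp (a, x)))) => //.
  by apply: measurableT_comp => //; apply: measurable_consp_comp.
Qed.

Definition upd n (x : n.-tuple R) (j : 'I_n) (a : R) : n.-tuple R :=
  [tuple if k == j then a else tnth x k | k < n].

Lemma measurable_upd d (T : measurableType d) n (f : T -> n.-tuple R) j (a : T -> R) :
  measurable_fun setT f -> measurable_fun setT a ->
  measurable_fun setT (fun t => upd (f t) j (a t)).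
Proof.
move=> mf ma; apply: measurable_mktuple => k.
by case: eqP => _ //; exact: measurable_tnth_comp.
Qed.

Lemma upd_cons0 n (a b : R) (x : n.-tuple R) :
  upd (consp (b, x)) ord0 a = consp (a, x).
Proof.
apply: eq_from_tnth => i; rewrite tnth_mktuple.
case: (unliftP ord0 i) => [j ->|->]; last by rewrite eqxx tnth_consp0.
by rewrite !tnth_consS.
Qed.

Lemma upd_consS n (a b : R) (x : n.-tuple R) j :
  upd (consp (b, x)) (lift ord0 j) a = consp (b, upd x j a).
Proof.
apply: eq_from_tnth => i; rewrite tnth_mktuple.
case: (unliftP ord0 i) => [k ->|->]; last by rewrite !tnth_consp0.
by rewrite !tnth_consS tnth_mktuple (inj_eq lift_inj).
Qed.

(** Coordinates are independent, so any one of them may be redrawn; this isolates chosen coordinates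
    without permuting the factors of the product. *)
Lemma gaussM_resample n (j : 'I_n) (F : n.-tuple R -> \bar R) :
  measurable_fun setT F -> (forall x, 0 <= F x) ->
  \int[gaussM n]_x F x = \int[gaussM n]_x \int[gauss1]_a F (upd x j a).
Proof.
elim: n j F => [[]//|n IH j F mF F0].
have mU (k : 'I_n.+1) : measurable_fun setT (fun x => \int[gauss1]_a F (upd x k a)).
  apply: measurable_integral_param => //.
  by apply: measurableT_comp => //; exact: measurable_upd.
rewrite !integral_gaussMS//; last by move=> x; exact: integral_ge0.
case: (unliftP ord0 j) => [k ->|->].
  apply: eq_integral => b _.
  under [RHS]eq_integral do under eq_integral do rewrite upd_consS.
  apply: (IH k (fun x => F (consp (b, x)))) => //.
  by apply: measurableT_comp => //; apply: measurable_consp_comp.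
under [RHS]eq_integral do under eq_integral do under eq_integral do rewrite upd_cons0.
rewrite integral_cst//= probability_setT mule1.
apply: (@tonelli _ _ _ _ _ gauss1 (gaussM n) (fun a x => F (consp (a, x)))) => //.
by apply: measurableT_comp => //; exact: measurable_consp_comp.
Qed.

Definition giv n (i j : 'I_n) (c s : R) (x : n.-tuple R) : n.-tuple R :=
  [tuple if k == i then c * tnth x i - s * tnth x j
         else if k == j then s * tnth x i + c * tnth x j else tnth x k | k < n]%R.

Lemma measurable_giv d (T : measurableType d) n (i j : 'I_n) (c s : T -> R)
    (f : T -> n.-tuple R) :
  measurable_fun setT c -> measurable_fun setT s -> measurable_fun setT f ->
  measurable_fun setT (fun t => giv i j (c t) (s t) (f t)).
Proof.
move=> mc ms mf; apply: measurable_mktuple => k.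
have mt l := measurable_tnth_comp l mf.
case: eqP => _; first by apply: measurable_funB; apply: measurable_funM.
by case: eqP => _ //; apply: measurable_funD; apply: measurable_funM.
Qed.

Lemma gauss_isom_giv n (i j : 'I_n) c s : i != j -> (c ^+ 2 + s ^+ 2 = 1)%R ->
  gauss_isom (giv i j c s).
Proof.
move=> ij cs.
have mg : measurable_fun setT (giv i j c s) by exact: measurable_giv.
split => //.
- move=> a x b y; apply: eq_from_tnth => k; rewrite tnth_comb !tnth_mktuple.
  by case: ifP => _; [ring|case: ifP => _; [ring|]].
- move=> x y; rewrite /dotp (bigD1 i)//= (bigD1 j) 1?eq_sym//=.
  rewrite [in RHS](bigD1 i)//= [in RHS](bigD1 j) 1?eq_sym//=.
  rewrite !addrA; congr (_ + _)%R.
    rewrite !tnth_mktuple !eqxx [j == i]eq_sym (negbTE ij).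
    transitivity ((c ^+ 2 + s ^+ 2) * (tnth x i * tnth y i + tnth x j * tnth y j))%R.
      by ring.
    by rewrite cs mul1r.
  apply: eq_bigr => k /andP[ki kj].
  by rewrite !tnth_mktuple (negbTE ki) (negbTE kj).
- move=> F mF F0.
  (* With coordinates i and j redrawn, the rotation only acts on a two-dimensional Gaussian. *)
  have two (G : n.-tuple R -> \bar R) : measurable_fun setT G ->
      (forall x, 0 <= G x) -> \int[gaussM n]_x G x =
      \int[gaussM n]_x \int[gauss1]_a \int[gauss1]_b G (upd (upd x i a) j b).
    move=> mG G0; rewrite (gaussM_resample j)// (gaussM_resample i)//.
      apply: measurable_integral_param => //.
      by apply: measurableT_comp => //; exact: measurable_upd.
    by move=> x; exact: integral_ge0.
  apply: (etrans (two (fun x => F (giv i j c s x)) _ _)) => //.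
    exact: measurableT_comp.
  apply: (etrans _ (esym (two F mF F0))).
  apply: eq_integral => x _.
  have mFu : measurable_fun setT (fun p : R * R => F (upd (upd x i p.1) j p.2)).
    apply: measurableT_comp => //.
    by apply: measurable_upd => //; exact: measurable_upd.
  apply: (etrans _ (@integral_gauss1_rot _ c s
    (fun a b => F (upd (upd x i a) j b)) cs mFu (fun a b => F0 _))).
  apply: eq_integral => a _; apply: eq_integral => b _; congr F.
  apply: eq_from_tnth => k; rewrite !tnth_mktuple !eqxx (negbTE ij).
  have [->|ki] := eqVneq k i; first by rewrite (negbTE ij).
  by case: (k == j).
Qed.

End GaussianIsometries.

(** * Polar coordinates and disintegration of the sphere *)

Section Substitution.
Context {R : realType}.
Local Open Scope ereal_scope.
Local Notation mu := (@lebesgue_measure R).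
Variables (phi psi dphi : R -> R) (a b : R).
Hypothesis phi_itv : forall s, phi s \in `]a, b[%R.
Hypothesis psiK : {in `]a, b[%R, cancel psi phi}.
Hypothesis phi_lt : {mono phi : x y / (x < y)%R}.
Hypothesis mpsi : measurable_fun setT psi.
Hypothesis phi_deriv : forall s : R, is_derive s 1%R phi (dphi s).
Hypothesis dphi_cont : continuous dphi.
Hypothesis dphi_ge0 : forall s, (0 <= dphi s)%R.

Let measurable_dphi : measurable_fun setT dphi.
Proof. exact: continuous_measurable_fun. Qed.

Let density (A : set (measurableTypeR R)) := \int[mu]_(x in A) (dphi x)%:E.

Let density0 : density set0 = 0.
Proof. by rewrite /density integral_set0. Qed.

Let density_ge0 A : 0 <= density A.
Proof. by apply: integral_ge0 => x _; rewrite lee_fin. Qed.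

Let density_sigma_additive : semi_sigma_additive density.
Proof.
move=> F mF tF mUF; rewrite /density ge0_integral_bigcup//.
- by apply: is_cvg_ereal_nneg_natsum_cond => n _ _; exact: density_ge0.
- exact/measurable_funTS/measurable_EFinP.
- by move=> x _; rewrite lee_fin.
Qed.

HB.instance Definition _ :=
  isMeasure.Build _ _ _ density density0 density_ge0 density_sigma_additive.

Let densM : {measure set (measurableTypeR R) -> \bar R} := density.

Let psiT : measurableTypeR R -> measurableTypeR R := psi.

Let mpsiT : measurable_fun setT psiT.
Proof. exact: mpsi. Qed.

Let itvab : set (measurableTypeR R) := `]a, b[%classic.

Let mitv : measurable itvab.
Proof. exact: measurable_itv. Qed.

Let pushM : {measure set (measurableTypeR R) -> \bar R} :=
  measure_function_pushforward__canonical__measure_function_Measure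
    (mrestr mu mitv) mpsiT.

Let phi_cvg (x : R) : {for x, continuous phi}.
Proof.
apply: differentiable_continuous; apply/derivable1_diffP.
exact: (ex_derive (is_derive := phi_deriv x)).
Qed.

Let density_itv (u v : R) : (u < v)%R ->
  density `]u, v]%classic = (phi v - phi u)%:E.
Proof.
move=> uv; rewrite /density integral_itv_obnd_cbnd; last first.
  exact/measurable_funTS/measurable_EFinP.
rewrite (@continuous_FTC2 _ dphi phi)//.
- exact: continuous_subspaceT.
- split.
  + by move=> x _; exact: (ex_derive (is_derive := phi_deriv x)).
  + by apply: cvg_at_right_filter; exact: phi_cvg.
  + by apply: cvg_at_left_filter; exact: phi_cvg.
- move=> x _; rewrite derive1E.
  exact: (derive_val (is_derive := phi_deriv x)).
Qed.

Let push_itv (u v : R) : (u < v)%R ->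
  pushM `]u, v]%classic = (phi v - phi u)%:E.
Proof.
move=> uv; rewrite -[LHS]/(mu (psi @^-1` `]u, v] `&` itvab)).
rewrite (_ : _ `&` _ = [set` `]phi u, phi v]%R]).
  by rewrite lebesgue_measure_itv/= lte_fin phi_lt uv EFinB.
have phi_le : {mono phi : x y / (x <= y)%R}.
  by apply: le_mono => x y xy; rewrite phi_lt.
apply/seteqP; split => x /=.
  rewrite /itvab/= => -[+ xab]; rewrite !in_itv/= => /andP[upx pxv].
  by rewrite -(psiK xab) phi_lt phi_le upx pxv.
rewrite in_itv/= => /andP[ux xv].
have xab : x \in `]a, b[%R.
  rewrite in_itv/=; apply/andP; split.
    by apply: lt_trans ux; have := phi_itv u; rewrite in_itv/= => /andP[].
  by apply: le_lt_trans xv _; have := phi_itv v; rewrite in_itv/= => /andP[].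
split; last exact: xab.
by rewrite in_itv/= -phi_lt -phi_le psiK// ux xv.
Qed.

(** The measure with density [dphi] and the push-forward under [psi] of Lebesgue measure on the
    interval agree on half-open intervals, by the fundamental theorem of calculus; uniqueness of
    measures extends this to all measurable sets. *)
Lemma ge0_integral_subst (G : R -> \bar R) :
  measurable_fun setT G -> (forall t, 0 <= G t) ->
  \int[mu]_(t in `]a, b[) G t = \int[mu]_s (G (phi s) * (dphi s)%:E).
Proof.
move=> mG G0.
have mphi : measurable_fun setT phi.
  by apply: continuous_measurable_fun => x; exact: phi_cvg.
have pushE A : measurable A -> pushM A = \int[mu]_(x in A) (dphi x)%:E.
  move: A; change (forall A, measurable A -> pushM A = densM A).
  apply: (@measure_unique _ R (measurableTypeR R) (@ocitv R)
    (fun k : nat => [set` Interval (BRight (- k%:R)%R) (BRight (k%:R : R))])).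
  - by [].
  - exact: ocitvI.
  - by move=> k; exact: is_ocitv.
  - rewrite -subTset => /= x _ /=.
    exists (Num.bound x) => //=.
    by rewrite in_itv/= ltrNl ltrNbound ltW// ltr_bound.
  - move=> _ [[u v] _ <-] /=; have [uv|vu] := ltP u v.
      by rewrite push_itv// -density_itv.
    by rewrite set_itv_ge ?measure0// bnd_simp -leNgt.
  - move=> k; have [->|k0] := eqVneq k 0%N.
      by rewrite set_itv_ge ?measure0// bnd_simp oppr0 ltxx.
    rewrite push_itv ?ltry// (@lt_le_trans _ _ 0%R) ?ler0n// ltrNl oppr0.
    by rewrite ltr0n lt0n.
have := @ge0_integral_density _ _ _ mu pushM dphi measurable_dphi dphi_ge0
  pushE (G \o phi) (measurableT_comp mG mphi) (fun x => G0 _).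
move=> <-; rewrite ge0_integral_pushforward//=; last first.
  exact: (measurableT_comp mG mphi).
rewrite preimage_setT.
have mGpp : measurable_fun setT (G \o phi \o psiT).
  by apply: measurableT_comp => //; exact: (measurableT_comp mG mphi).
rewrite (@ge0_integral_density _ _ _ mu (mrestr mu mitv) \1_itvab)//=; last first.
  by move=> A mA; rewrite integral_indic// /mrestr setIC.
rewrite integral_mkcond; apply: eq_integral => x _.
rewrite patchE indicE; have [xab|xab] := boolP (x \in _); last by rewrite mule0.
by rewrite mule1 /psiT psiK//; rewrite inE in xab.
Qed.

End Substitution.

Ltac mfun :=
  repeat first
  [ done
  | exact: measurable_fst | exact: measurable_snd
  | exact: measurable_id | exact: measurable_cst | exact: measurable_gdens
  | exact: (measurable_enorm (@measurable_id _ _ setT))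
  | exact: (measurable_normalize (@measurable_id _ _ setT))
  | match goal with
    | |- measurable_fun _ (fun t => ((@?f t) + (@?g t))%R) => apply: measurable_funD
    | |- measurable_fun _ (fun t => ((@?f t) * (@?g t))%R) => apply: measurable_funM
    | |- measurable_fun _ (fun t => (- (@?f t))%R) => apply: measurable_funN
    | |- measurable_fun _ (fun t => ((@?f t) ^+ _)%R) => apply: measurable_funX
    | |- measurable_fun _ (fun t => ((@?f t) ^-1)%R) => apply: measurable_inv_comp
    | |- measurable_fun _ (fun t => Num.sqrt (@?f t)) => apply: measurable_sqrt_comp
    | |- measurable_fun _ (fun t => enorm (@?f t)) => apply: measurable_enorm
    | |- measurable_fun _ (fun t => dotp (@?f t) (@?g t)) => apply: measurable_dotp
    | |- measurable_fun _ (fun t => normalize (@?f t)) => apply: measurable_normalize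
    | |- measurable_fun _ (fun t => comb (@?a t) (@?f t) (@?b t) (@?g t)) =>
        apply: measurable_comb
    | |- measurable_fun _ (fun t => consp (@?a t, @?f t)) =>
        apply: measurable_consp_comp
    | |- measurable_fun _ (fun t => tnth (@?f t) ?i) => apply: measurable_tnth_comp
    | |- measurable_fun _ (fun t => gdens (@?f t)) =>
        apply: (measurableT_comp (@measurable_gdens _))
    | |- measurable_fun _ (fun t => powR (@?f t) ?p) =>
        apply: (measurableT_comp (@measurable_powR _ p))
    | |- measurable_fun _ (fun t => expR (@?f t)) =>
        apply: (measurableT_comp (@measurable_expR _))
    | |- measurable_fun _ (fun t => ((@?f t) * (@?g t))%E) => apply: emeasurable_funM
    | |- measurable_fun _ (fun t => EFin (@?f t)) => apply/measurable_EFinP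
    end ].

(** * From slope to height, and folding the line at 0 *)

Section Polar.
Context {R : realType}.
Local Open Scope ereal_scope.
Local Notation mu := (@lebesgue_measure R).

(** The cosine of the angle of slope [s]; the sine is [tanR s * s]. *)
Definition tanR (s : R) : R := (Num.sqrt (1 + s ^+ 2))^-1%R.

Lemma sqrt1s_gt0 (s : R) : (0 < Num.sqrt (1 + s ^+ 2))%R.
Proof. by rewrite sqrtr_gt0 ltr_pwDl// sqr_ge0. Qed.

Lemma tanR_gt0 (s : R) : (0 < tanR s)%R.
Proof. by rewrite invr_gt0 sqrt1s_gt0. Qed.

Lemma tanR_sqr (s : R) : (tanR s ^+ 2 * (1 + s ^+ 2) = 1)%R.
Proof.
rewrite /tanR exprVn sqr_sqrtr ?mulVf//.
  by rewrite gt_eqF// ltr_pwDl// sqr_ge0.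
by rewrite addr_ge0// sqr_ge0.
Qed.

Lemma tanR_compl (s : R) : (1 - (tanR s * s) ^+ 2 = tanR s ^+ 2)%R.
Proof. by have := tanR_sqr s; rewrite exprMn mulrDr mulr1 => <-; ring. Qed.

Lemma is_derive_tan (s : R) :
  is_derive s 1%R (fun s => tanR s * s)%R (tanR s ^+ 3)%R.
Proof.
have s1 : (0 < 1 + s ^+ 2)%R by rewrite ltr_pwDl// sqr_ge0.
have h1 : is_derive s 1%R (fun s : R => 1 + s ^+ 2)%R (2 * s)%R.
  apply: is_derive_eq; rewrite /GRing.scale/=; ring.
have h2 := is_derive1_sqrt s1.
have h3 : is_derive s 1%R (fun s : R => Num.sqrt (1 + s ^+ 2))
   (s * tanR s)%R.
  have h := @is_derive1_comp R Num.sqrt (fun s : R => 1 + s ^+ 2)%R s _ _ h2 h1.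
  apply: (is_derive_eq h).
  rewrite /tanR invfM /GRing.scale/=; field.
  by rewrite gt_eqF ?sqrt1s_gt0.
have h4 : is_derive s 1%R tanR (- (s * tanR s ^+ 3))%R.
  apply: (is_derive_eq (is_deriveV _ h3)).
    by rewrite gt_eqF ?sqrt1s_gt0.
  by rewrite /tanR /GRing.scale/= !exprVn; field; rewrite gt_eqF ?sqrt1s_gt0.
apply: is_derive_eq; rewrite /GRing.scale/=.
have := tanR_sqr s; set k := tanR s => k2.
transitivity (k * (k ^+ 2 * (1 + s ^+ 2)) - s ^+ 2 * k ^+ 3)%R; last by ring.
by rewrite k2; ring.
Qed.

Lemma measurable_tanR : measurable_fun setT (fun s => tanR s).
Proof. by rewrite /tanR; mfun. Qed.

(** The substitution t = sin (arctan s), whose derivative is the cube of the cosine. *)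
Lemma integral_tan (G : R -> \bar R) :
  measurable_fun setT G -> (forall t, 0 <= G t) ->
  \int[mu]_(t in @I11 R) G t =
  \int[mu]_s (G (tanR s * s)%R * (tanR s ^+ 3)%:E).
Proof.
move=> mG G0.
have phi_itv s : (tanR s * s)%R \in `](-1)%R, 1%R[.
  rewrite in_itv/= -ltr_norml -(@ltr_pXn2r _ 2)// ?nnegrE ?normr_ge0//.
  rewrite real_normK ?num_real// expr1n -subr_gt0 tanR_compl exprn_gt0//.
  exact: tanR_gt0.
pose psi (t : R) : R := (t / Num.sqrt (1 - t ^+ 2))%R.
have psiK : {in `](-1)%R, 1%R[, cancel psi (fun s => tanR s * s)%R}.
  move=> t; rewrite in_itv/= -ltr_norml => t1.
  have t2 : (0 < 1 - t ^+ 2)%R.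
    rewrite subr_gt0 -real_normK ?num_real// expr_lt1 ?normr_ge0//.
  have s2 := sqr_sqrtr (ltW t2).
  have s0 : (0 < Num.sqrt (1 - t ^+ 2))%R by rewrite sqrtr_gt0.
  rewrite /tanR /psi expr_div_n s2.
  rewrite (_ : 1 + t ^+ 2 / (1 - t ^+ 2) = (1 - t ^+ 2)^-1)%R; last first.
    by field; rewrite gt_eqF.
  by rewrite sqrtrV ?ltW// invrK mulrC divfK// gt_eqF.
apply: (@ge0_integral_subst _ (fun s => tanR s * s)%R psi
  (fun s => tanR s ^+ 3)%R (-1)%R 1%R) => //.
(* For nonnegative arguments the squares 1 - 1 / (1 + s^2) are compared; oddness gives the rest. *)
- have pos x y : (0 <= x)%R -> (x < y)%R -> (tanR x * x < tanR y * y)%R.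
    move=> x0 xy; have y0 := le_lt_trans x0 xy.
    rewrite -(@ltr_pXn2r _ 2)// ?nnegrE ?mulr_ge0 ?(ltW (tanR_gt0 _)) ?(ltW y0)//.
    have tE s : ((tanR s * s) ^+ 2 = 1 - tanR s ^+ 2)%R.
      by rewrite -tanR_compl subKr.
    rewrite !tE ltrD2l ltrN2 /tanR !exprVn !sqr_sqrtr ?addr_ge0 ?sqr_ge0//.
    have p s : (0 < 1 + s ^+ 2 :> R)%R by rewrite ltr_pwDl// sqr_ge0.
    rewrite ltf_pV2 ?posrE ?p// ltrD2l.
    by rewrite ltr_pXn2r ?nnegrE ?(ltW y0).
  apply: leW_mono; apply: le_mono => x y xy.
  have tN s : (tanR (- s) * - s = - (tanR s * s))%R.
    by rewrite /tanR sqrrN mulrN.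
  have [y0|y0] := leP y 0%R.
    by rewrite -ltrN2 -!tN; apply: pos; rewrite ?oppr_ge0 ?ltrN2.
  have [x0|x0] := leP 0%R x; first exact: pos.
  apply: (@lt_trans _ _ 0%R); first by rewrite pmulr_rlt0 ?tanR_gt0.
  by rewrite mulr_gt0 ?tanR_gt0.
- by rewrite /psi; mfun.
- exact: is_derive_tan.
- move=> s; apply: (@continuous_comp _ _ _ tanR (fun x => x ^+ 3)%R);
    last exact: exprn_continuous.
  rewrite /tanR.
  apply: continuousV; first by rewrite gt_eqF ?sqrt1s_gt0.
  apply: continuous_comp; last exact: sqrt_continuous.
  by apply: continuousD; [exact: cvg_cst|exact: exprn_continuous].
- by move=> s; rewrite exprn_ge0 ?ltW ?tanR_gt0.
Qed.

Lemma integral_lebesgue_opp (h : R -> \bar R) :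
  measurable_fun setT h -> (forall x, 0 <= h x) ->
  \int[mu]_x h (- x)%R = \int[mu]_x h x.
Proof.
move=> mh h0.
have mN : measurable_fun setT (-%R : measurableTypeR R -> measurableTypeR R).
  exact: oppr_measurable.
rewrite [in RHS](@eq_measure_integral _ _ _ _
  (measure_function_pushforward__canonical__measure_function_Measure mu mN))//;
    last first.
  by move=> A mA _; exact/esym/lebesgue_measureN.
by rewrite ge0_integral_pushforward//= preimage_setT.
Qed.

(** Up to a constant, the density of the norm of a Gaussian vector in dimension n + 1. *)
Definition pw (n : nat) (r : R) : R :=
  if (0 < r)%R then (r ^+ n * expR (- (r ^+ 2) / 2))%R else 0%R.

Lemma pw_ge0 n r : (0 <= pw n r)%R.
Proof.
by rewrite /pw; case: ifPn => // r0; rewrite mulr_ge0 ?expR_ge0 ?exprn_ge0 ?ltW.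
Qed.

Lemma measurable_pw n : measurable_fun setT (pw n).
Proof.
rewrite /pw; apply: measurable_fun_ifT => //=.
  by apply: measurable_fun_ltr => //; exact: measurable_cst.
by mfun.
Qed.

Lemma gdensN (x : R) : gdens (- x) = gdens x.
Proof. by rewrite /gdens sqrrN. Qed.

Lemma gdens_pw (x : R) : (0 < x)%R -> gdens x = ((Num.sqrt (2 * pi))^-1 * pw 0 x)%R.
Proof. by move=> x0; rewrite /pw x0 expr0 mul1r mulrC. Qed.

(** The base case of polar coordinates: in dimension 1 the radius is |a| and the direction is a
    sign. The point 0 is a null set. *)
Lemma integral_gdens_half (h : R -> \bar R) :
  measurable_fun setT h -> (forall x, 0 <= h x) ->
  \int[mu]_a ((gdens a)%:E * h a) =
  \int[mu]_a (((Num.sqrt (2 * pi))^-1 * pw 0 a)%:E * (h a + h (- a)%R)).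
Proof.
move=> mh h0; set k := ((Num.sqrt (2 * pi))^-1)%R.
have k0 : (0 <= k)%R by rewrite invr_ge0 sqrtr_ge0.
have mpw : measurable_fun setT (fun a => (k * pw 0 a)%:E).
  by mfun; exact: measurable_pw.
have mhN : measurable_fun setT (fun a : R => h (- a)%R).
  by apply: (measurableT_comp mh); exact: oppr_measurable.
have kp0 a : 0 <= (k * pw 0 a)%:E by rewrite lee_fin mulr_ge0 ?pw_ge0.
under [RHS]eq_integral do rewrite ge0_muleDr//.
rewrite ge0_integralD//=; first last.
- exact: emeasurable_funM.
- by move=> a _; rewrite mule_ge0.
- exact: emeasurable_funM.
- by move=> a _; rewrite mule_ge0.
have mpN : measurable_fun setT (fun a : R => (k * pw 0 (- a))%:E).
  mfun; apply: (measurableT_comp (measurable_pw 0)).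
  exact: oppr_measurable.
have -> : \int[mu]_x ((k * pw 0 x)%:E * h (- x)%R) =
    \int[mu]_x ((k * pw 0 (- x))%:E * h x).
  apply: (etrans (esym (@integral_lebesgue_opp
    (fun x => (k * pw 0 x)%:E * h (- x)%R) _ _))).
  - exact: emeasurable_funM.
  - by move=> x; rewrite mule_ge0.
  - by apply: eq_integral => x _; rewrite opprK.
rewrite -ge0_integralD//=; first last.
- exact: emeasurable_funM.
- by move=> a _; rewrite mule_ge0.
- exact: emeasurable_funM.
- by move=> a _; rewrite mule_ge0.
have mgh : measurable_fun setT (fun x : R => (gdens x)%:E * h x).
  by apply: emeasurable_funM => //; mfun.
apply: ge0_ae_eq_integral => //=.
- by apply: emeasurable_funD; exact: emeasurable_funM.
- by move=> a _; rewrite mule_ge0// lee_fin gdens_ge0.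
- by move=> a _; rewrite adde_ge0// mule_ge0.
exists [set 0%R]; split => [|//=|].
- exact: measurable_set1.
- by rewrite lebesgue_measure_set1.
move=> a /= aN; apply: contra_notP aN => /eqP a0 _.
have [ap|an] := ltP 0%R a.
  by rewrite gdens_pw// [in pw 0 (- a)]/pw ltrNr oppr0 ltNge ltW//= mulr0 mul0e adde0.
have an' : (0 < - a)%R by rewrite ltrNr oppr0 lt_neqAle a0.
by rewrite -gdensN gdens_pw// [in pw 0 a]/pw ltNge an/= mulr0 mul0e add0e.
Qed.

End Polar.

(** * Polar coordinates, one dimension up *)

Section PolarStep.
Context {R : realType}.
Local Open Scope ereal_scope.
Local Notation mu := (@lebesgue_measure R).

(** For a unit vector [x] of one dimension less and |t| <= 1, the point of the sphere at height [t]
    in the direction [x]. *)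
Definition slice n (t : R) (x : n.-tuple R) : n.+1.-tuple R :=
  consp (t, comb (Num.sqrt (1 - t ^+ 2)) x 0 x).

Lemma measurable_slice d (T : measurableType d) n (a : T -> R) (f : T -> n.-tuple R) :
  measurable_fun setT a -> measurable_fun setT f ->
  measurable_fun setT (fun t => slice (a t) (f t)).
Proof. by move=> ma mf; rewrite /slice; mfun. Qed.

(** Radius and direction are independent. The constant stays abstract: it is never computed as a
    Gamma value but recovered from total mass 1. *)
Definition is_polar n (c : R) := (0 <= c)%R /\
  forall F : R -> n.-tuple R -> \bar R,
    measurable_fun setT (fun p => F p.1 p.2) -> (forall r x, 0 <= F r x) ->
  \int[gaussM n]_x F (enorm x) (normalize x) =
  \int[mu]_r ((c * pw n.-1 r)%:E * \int[gaussM n]_y F r (normalize y)).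

Lemma enorm_consp n (a : R) (x : n.-tuple R) :
  enorm (consp (a, x)) = Num.sqrt (a ^+ 2 + enorm x ^+ 2).
Proof. by rewrite sqr_enorm [in LHS]/enorm dotp_cons expr2. Qed.

Lemma normalize_consp n (a : R) (x : n.-tuple R) :
  normalize (consp (a, x)) =
  consp (a / Num.sqrt (a ^+ 2 + enorm x ^+ 2),
    comb (enorm x / Num.sqrt (a ^+ 2 + enorm x ^+ 2)) (normalize x) 0 (normalize x))%R.
Proof.
apply: eq_from_tnth => i; rewrite tnth_normalize enorm_consp.
case: (unliftP ord0 i) => [j ->|->]; last by rewrite !tnth_consp0.
rewrite !tnth_consS tnth_comb tnth_normalize mul0r addr0.
have [x0|x0] := eqVneq (enorm x) 0%R; first by rewrite enorm_eq0// x0 !mul0r.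
rewrite -{1}[tnth x j](divfK x0); set S := Num.sqrt _.
by ring.
Qed.

(** This is where the exponent of the weight comes from: it contributes cos^(n - 1) and the Jacobian
    cos^3. *)
Lemma nu_weight_tan n (s : R) :
  (nu_weight n.+2 (tanR s * s) * tanR s ^+ 3 = tanR s ^+ n.+2)%R.
Proof.
have k0 := tanR_gt0 s.
rewrite /nu_weight tanR_compl -!powR_mulrn ?(ltW k0)// -powRrM -powRD; last first.
  by rewrite (gt_eqF k0) implybT.
by congr powR; rewrite -!natr1; field.
Qed.

Lemma nu_weight_ge0 n (t : R) : (0 <= nu_weight n t)%R.
Proof. exact: powR_ge0. Qed.

Lemma measurable_nu_weight n : measurable_fun setT (fun t : R => nu_weight n t).
Proof. by rewrite /nu_weight; mfun. Qed.

Lemma integral_lebesgue_scale (k : R) (h : R -> \bar R) :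
  (0 < k)%R -> measurable_fun setT h -> (forall x, 0 <= h x) ->
  \int[mu]_x h x = k%:E * \int[mu]_x h (k * x)%R.
Proof.
move=> k0 mh h0; have := @integral_lebesgue_affine _ k 0%R h k0 mh h0.
under eq_integral do rewrite addr0.
by move=> ->; rewrite muleA -EFinM divff ?gt_eqF// mul1e.
Qed.

(* For x = (a, y) substitute a = |y| s, then put the radius r = |y| sqrt (1 + s^2)
   and t = s / sqrt (1 + s^2). *)
Lemma polar_step n c (F : R -> n.+2.-tuple R -> \bar R) : is_polar n.+1 c ->
  measurable_fun setT (fun p => F p.1 p.2) -> (forall r x, 0 <= F r x) ->
  \int[gaussM n.+2]_x F (enorm x) (normalize x) =
  \int[mu]_r ((c / Num.sqrt (2 * pi) * pw n.+1 r)%:E *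
    \int[mu]_(t in @I11 R) ((nu_weight n.+2 t)%:E *
       \int[gaussM n.+1]_y F r (slice t (normalize y)))).
Proof.
move=> [c0 polar] mF F0.
pose S a rho : R := Num.sqrt (a ^+ 2 + rho ^+ 2).
pose G a rho (th : n.+1.-tuple R) :=
  F (S a rho) (consp (a / S a rho, comb (rho / S a rho) th 0 th))%R.
have G0 a rho th : 0 <= G a rho th by exact: F0.
have mS : measurable_fun setT (fun p : R * R => S p.1 p.2) by rewrite /S; mfun.
have mG : measurable_fun setT (fun p : (R * R) * n.+1.-tuple R => G p.1.1 p.1.2 p.2).
  have mS' : measurable_fun setT
      (fun p : (R * R) * n.+1.-tuple R => S p.1.1 p.1.2).
    exact: (measurableT_comp mS measurable_fst).
  by apply: measurable_fun2_comp => //; mfun; exact: measurableT_comp.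
pose K a rho := \int[gaussM n.+1]_y G a rho (normalize y).
have K0 a rho : 0 <= K a rho by exact: integral_ge0.
have mK : measurable_fun setT (fun p : R * R => K p.1 p.2).
  apply: (@measurable_integral_param _ _ _ _ _ (gaussM n.+1)
    (fun (p : R * R) y => G p.1 p.2 (normalize y))) => //.
  apply: (@measurable_fun2_comp _ _ _ _ _ (fun (p : R * R) y => G p.1 p.2 y)) => //.
  by mfun.
pose H a rho := (gdens a * (c * pw n rho))%:E * K a rho.
have gp0 a rho : (0 <= gdens a * (c * pw n rho))%R.
  by rewrite !mulr_ge0 ?gdens_ge0 ?pw_ge0.
have H0 a rho : 0 <= H a rho by rewrite mule_ge0// lee_fin.
have mpw1 m : measurable_fun setT (@pw R m) by exact: measurable_pw.
have mH : measurable_fun setT (fun p : R * R => H p.1 p.2).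
  by rewrite /H; mfun; exact: (measurableT_comp (mpw1 _)).
(* The factor is the Jacobian of a = rho s; cutting it at 0 keeps [H1] nonnegative and loses
   nothing, as [pw] vanishes for rho <= 0. *)
pose H1 s rho := (Num.max 0 rho)%:E * H (rho * s)%R rho.
have H10 s rho : 0 <= H1 s rho by rewrite mule_ge0// lee_fin le_max lexx.
have mH1 : measurable_fun setT (fun p : R * R => H1 p.1 p.2).
  rewrite /H1; apply: emeasurable_funM.
    by apply/measurable_EFinP; apply: measurable_maxr; mfun.
  by apply: measurable_fun2_comp => //; mfun.
pose K2 r t := \int[gaussM n.+1]_y F r (slice t (normalize y)).
have K20 r t : 0 <= K2 r t by exact: integral_ge0.
have mK2 : measurable_fun setT (fun p : R * R => K2 p.1 p.2).
  apply: (@measurable_integral_param _ _ _ _ _ (gaussM n.+1)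
    (fun (p : R * R) y => F p.1 (slice p.2 (normalize y)))) => //.
  apply: measurable_fun2_comp => //; first by exact: measurableT_comp.
  apply: measurable_slice; last by mfun.
  exact: measurableT_comp.
transitivity (\int[mu]_a \int[mu]_rho H a rho).
  rewrite integral_gaussMS//; last first.
    by apply: (@measurable_fun2_comp _ _ _ _ _ F) => //; mfun.
  rewrite integral_gauss1//; last first.
  - by move=> a; exact: integral_ge0.
  - apply: measurable_integral_param => //.
    apply: (@measurable_fun2_comp _ _ _ _ _ F) => //.
      by apply: measurable_enorm; exact: measurable_consp.
    by apply: measurable_normalize; exact: measurable_consp.
  apply: eq_integral => a _.
  have mGa : measurable_fun setT (fun p : R * n.+1.-tuple R => G a p.1 p.2).
    apply: (@measurable_fun2_comp _ _ _ _ _ (fun (p : R * R) y => G p.1 p.2 y)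
      _ (R * n.+1.-tuple R)%type (fun p => (a, p.1)) snd) => //.
    by apply: measurable_fun_pair => //; exact: measurable_cst.
  have -> : \int[gaussM n.+1]_x
      F (enorm (consp (a, x))) (normalize (consp (a, x))) =
      \int[mu]_rho ((c * pw n rho)%:E * K a rho).
    rewrite -(polar (G a) mGa (G0 a)).
    by apply: eq_integral => x _; rewrite /G normalize_consp enorm_consp.
  rewrite -ge0_integralZl//=.
  - by apply: eq_integral => rho _; rewrite /H EFinM muleA.
  - have h : measurable_fun setT (fun x : R => (c * pw n x)%:E * K a x).
      mfun; exact: (measurable_fun2_comp (F := K) (u := cst a) (v := id)).
    exact: h.
  - by move=> x _; rewrite mule_ge0// lee_fin mulr_ge0 ?pw_ge0.
  - by rewrite lee_fin gdens_ge0.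
apply: (etrans (tonelli_lebesgue2 mH H0)).
transitivity (\int[mu]_rho \int[mu]_s H1 s rho).
  apply: eq_integral => rho _.
  have [rho0|rho0] := leP rho 0%R.
    rewrite !integral0_eq// => x _.
      by rewrite /H1 (max_idPl rho0) mul0e.
    by rewrite /H /pw ltNge rho0/= !mulr0 mul0e.
  apply: (etrans (@integral_lebesgue_scale rho (H^~ rho) rho0 _ _)) => //.
    exact: (measurable_fun2_comp (F := H) (u := id) (v := cst rho)).
  rewrite -ge0_integralZl//=.
  - by apply: eq_integral => s _; rewrite /H1 max_r// ltW.
  - have h : measurable_fun setT (fun x : R => H (rho * x)%R rho).
      by apply: (@measurable_fun2_comp _ _ _ _ _ H) => //; mfun.
    exact: h.
  - by rewrite lee_fin ltW.
apply: (etrans (esym (tonelli_lebesgue2 mH1 H10))).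
pose C : R := (c / Num.sqrt (2 * pi))%R.
have C0 : (0 <= C)%R by rewrite divr_ge0 ?sqrtr_ge0.
(* With rho = r [tanR s] the cosine occurs n times from [pw n rho], once from the Jacobian rho and
   once from d rho. *)
pose H2 s r := (C * (tanR s ^+ n.+2 * pw n.+1 r))%:E * K2 r (tanR s * s)%R.
have tp0 s r : (0 <= C * (tanR s ^+ n.+2 * pw n.+1 r))%R.
  apply: mulr_ge0 => //; apply: mulr_ge0; last exact: pw_ge0.
  by apply: exprn_ge0; exact/ltW/tanR_gt0.
have H20 s r : 0 <= H2 s r by rewrite mule_ge0// lee_fin.
have mtan : measurable_fun setT (@tanR R) by exact: measurable_tanR.
have mH2 : measurable_fun setT (fun p : R * R => H2 p.1 p.2).
  rewrite /H2; mfun.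
  - by apply: (measurableT_comp mtan).
  - by apply: (measurableT_comp (mpw1 _)).
  - apply: (@measurable_fun2_comp _ _ _ _ _ K2) => //; mfun.
    by apply: (measurableT_comp mtan).
transitivity (\int[mu]_s \int[mu]_r H2 s r).
  apply: eq_integral => s _; have k0 := tanR_gt0 s.
  apply: (etrans (@integral_lebesgue_scale (tanR s) (H1 s) k0 _ _)) => //.
    exact: (measurable_fun2_comp (F := H1) (u := cst s) (v := id)).
  rewrite -ge0_integralZl//=; last 2 first.
  - have h : measurable_fun setT (fun x : R => H1 s (tanR s * x)%R).
      by apply: (@measurable_fun2_comp _ _ _ _ _ H1) => //; mfun.
    exact: h.
  - by rewrite lee_fin ltW.
  apply: eq_integral => r _; rewrite /H1 /H2 /H.
  have [r0|r0] := leP r 0%R.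
    rewrite max_l ?mul0e ?mule0; last by rewrite pmulr_rle0.
    by rewrite /pw ltNge r0/= !mulr0 mul0e.
  have kr0 : (0 < tanR s * r)%R by rewrite mulr_gt0.
  have SE : S (tanR s * r * s)%R (tanR s * r)%R = r.
    rewrite /S (_ : _ + _ = r ^+ 2)%R ?sqrtr_sqr ?gtr0_norm//.
    transitivity (r ^+ 2 * (tanR s ^+ 2 * (1 + s ^+ 2)))%R; first by ring.
    by rewrite tanR_sqr mulr1.
  have KE : K (tanR s * r * s)%R (tanR s * r)%R = K2 r (tanR s * s)%R.
    apply: eq_integral => y _; rewrite /G SE /slice tanR_compl sqrtr_sqr.
    rewrite gtr0_norm// mulfK ?gt_eqF//.
    by rewrite [(tanR s * r * s)%R]mulrAC mulfK ?gt_eqF.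
  rewrite KE max_r ?(ltW kr0)// !muleA -!EFinM; congr (EFin _ * _).
  rewrite /gdens /pw kr0 r0 /C !exprMn [in RHS]exprS [in RHS]exprS.
  rewrite (exprS _ n).
  have -> : expR (- r ^+ 2 / 2) = (expR (- (tanR s ^+ 2 * r ^+ 2 * s ^+ 2) / 2) *
      expR (- (tanR s ^+ 2 * r ^+ 2) / 2))%R.
    rewrite -expRD; congr expR.
    by rewrite -{1}[(r ^+ 2)%R]mulr1 -(tanR_sqr s); ring.
  by ring.
apply: (etrans (tonelli_lebesgue2 mH2 H20)).
apply: eq_integral => r _.
have mK2r : measurable_fun setT (fun t : R => (nu_weight n.+2 t)%:E * K2 r t).
  mfun; first exact: measurable_nu_weight.
  exact: (measurable_fun2_comp (F := K2) (u := cst r) (v := id)).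
rewrite (integral_tan mK2r) => [|t]; last by rewrite mule_ge0// lee_fin nu_weight_ge0.
rewrite -ge0_integralZl//=; last 3 first.
- have h : measurable_fun setT (fun s : R =>
      (nu_weight n.+2 (tanR s * s))%:E * K2 r (tanR s * s)%R * (tanR s ^+ 3)%:E).
    apply: emeasurable_funM; last by mfun.
    by apply: (measurableT_comp mK2r); mfun.
  exact: h.
- move=> s _; rewrite !mule_ge0// lee_fin ?nu_weight_ge0// exprn_ge0// ltW//.
  exact: tanR_gt0.
- by rewrite lee_fin mulr_ge0 ?pw_ge0.
apply: eq_integral => s _; rewrite /H2 -nu_weight_tan.
rewrite muleAC -EFinM muleA -EFinM; congr (EFin _ * _).
by rewrite -/C; ring.
Qed.

End PolarStep.

(** * Disintegration of the sphere along the first coordinate *)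

Section Disintegration.
Context {R : realType}.
Local Open Scope ereal_scope.
Local Notation mu := (@lebesgue_measure R).

Lemma measurable_normalizeT n : measurable_fun setT (@normalize R n).
Proof. exact: (measurable_normalize (@measurable_id _ _ setT)). Qed.

HB.instance Definition _ n :=
  isMeasurableFun.Build _ _ _ _ (@normalize R n) (@measurable_normalizeT n).

Definition sphM n : probability (n.-tuple R) R := distribution (gaussM n) (@normalize R n).
Arguments sphM : simpl never.

Lemma integral_sphM n (h : n.-tuple R -> \bar R) :
  measurable_fun setT h -> (forall x, 0 <= h x) ->
  \int[sphM n]_x h x = \int[gaussM n]_x h (normalize x).
Proof. by move=> mh h0; rewrite ge0_integral_distribution. Qed.

Lemma sph_intE n (h : n.-tuple R -> \bar R) :
  measurable_fun setT h -> (forall x, 0 <= h x) ->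
  sph_int h = \int[sphM n]_x h x.
Proof.
move=> mh h0; rewrite integral_sphM// /sph_int gint_gaussM//.
exact: (measurableT_comp mh (@measurable_normalizeT n)).
Qed.

Lemma integral_gaussM1 (h : 1.-tuple R -> \bar R) :
  measurable_fun setT h -> (forall x, 0 <= h x) ->
  \int[gaussM 1]_x h x =
  \int[mu]_a (((Num.sqrt (2 * pi))^-1 * pw 0 a)%:E *
    (h (consp (a, [tuple])) + h (consp (- a, [tuple]))%R)).
Proof.
move=> mh h0; rewrite integral_gaussMS//.
have mh1 : measurable_fun setT (fun a : R => h (consp (a, [tuple]))).
  by apply: (measurableT_comp mh); mfun.
transitivity (\int[gauss1]_a h (consp (a, [tuple]))).
  apply: eq_integral => a _; rewrite integral_dirac ?diracT ?mul1e//.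
  by apply: (measurableT_comp mh); mfun.
rewrite integral_gauss1//.
exact: (integral_gdens_half mh1).
Qed.

Lemma polar1 : @is_polar R 1 (2 / Num.sqrt (2 * pi))%R.
Proof.
split; first by rewrite divr_ge0 ?sqrtr_ge0.
move=> F mF F0 /=; set k := ((Num.sqrt (2 * pi))^-1)%R.
have k0 : (0 <= k)%R by rewrite invr_ge0 sqrtr_ge0.
pose p1 : 1.-tuple R := consp (1%R, [tuple]).
pose m1 : 1.-tuple R := consp ((-1)%R, [tuple]).
have nE (b a : R) : (0 < a)%R -> (b ^+ 2 = 1)%R ->
    enorm (consp ((b * a)%R, [tuple])) = a /\
    normalize (consp ((b * a)%R, [tuple])) = consp (b, [tuple]).
  move=> a0 b1.
  have e : enorm (consp ((b * a)%R, [tuple])) = a.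
    rewrite enorm_consp /enorm /dotp big_ord0 sqrtr0 expr0n addr0.
    by rewrite exprMn b1 mul1r sqrtr_sqr gtr0_norm.
  split=> //; apply: eq_from_tnth => i; rewrite tnth_normalize e.
  by rewrite (ord1 i) !tnth_consp0 mulfK// gt_eqF.
have split1 (h : R -> 1.-tuple R -> \bar R) :
    measurable_fun setT (fun p => h p.1 p.2) -> (forall r x, 0 <= h r x) ->
    \int[gaussM 1]_x h (enorm x) (normalize x) =
    \int[mu]_a ((k * pw 0 a)%:E * (h a p1 + h a m1)).
  move=> mh h0.
  have := @integral_gaussM1 (fun x => h (enorm x) (normalize x)) _ _.
  move=> ->//; last by apply: (measurable_fun2_comp mh); mfun.
  apply: eq_integral => a _.
  have [a0|a0] := ltP 0%R a; last by rewrite /pw ltNge a0/= mulr0 !mul0e.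
  have [] := nE 1%R a a0 (expr1n _ _); rewrite mul1r => -> ->.
  have [] := nE (-1)%R a a0; first by rewrite sqrrN expr1n.
  by rewrite mulN1r => -> ->.
have mpw : measurable_fun setT (fun b : R => (k * pw 0 b)%:E).
  by mfun; exact: measurable_pw.
have M0 (u : \bar R) : 0 <= u ->
    \int[mu]_b ((k * pw 0 b)%:E * u) = \int[mu]_b (k * pw 0 b)%:E * u.
  move=> u0; rewrite ge0_integralZr//= => x _.
  by rewrite lee_fin mulr_ge0// pw_ge0.
(* The Gaussian mass of the half-line is read off from the total mass, by testing on the constant
   1. *)
have Mhalf : \int[mu]_b (k * pw 0 b)%:E = (1 / 2)%:E.
  have := split1 (fun _ _ => 1) (measurable_cst _) (fun _ _ => lee01).
  rewrite integral_cst//= probability_setT mul1e (M0 (1 + 1)); last first.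
    by rewrite adde_ge0.
  have : 0 <= \int[mu]_b (k * pw 0 b)%:E.
    by apply: integral_ge0 => x _; rewrite lee_fin mulr_ge0// pw_ge0.
  have two0 : 0 < (1 + 1 : \bar R) by rewrite -EFinD lte_fin.
  case: (\int[mu]_b _) => [r| |] // _.
    by rewrite -EFinD -EFinM => -[h]; congr EFin; lra.
  by rewrite gt0_mulye.
rewrite split1//; apply: eq_integral => r _.
have -> : \int[gaussM 1]_y F r (normalize y) = (1 / 2)%:E * (F r p1 + F r m1).
  rewrite (split1 (fun _ => F r))//; last first.
    by apply: (measurable_fun2_comp mF); mfun.
  by rewrite M0 ?adde_ge0// Mhalf.
rewrite muleA -EFinM; congr (EFin _ * _).
by rewrite -/k; field.
Qed.

(** Both conclusions follow from [polar_step] up to a constant, which testing on 1 determines; the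
    second one feeds the induction on the dimension. *)
Lemma disint_polar n (c : R) : is_polar n.+1 c ->
  (forall h : n.+2.-tuple R -> \bar R,
    measurable_fun setT h -> (forall x, 0 <= h x) ->
    \int[sphM n.+2]_x h x =
    nu_int n.+2 (fun t => \int[sphM n.+1]_th h (slice t th))) /\
  exists c' : R, is_polar n.+2 c'.
Proof.
move=> pol; have c0 := pol.1.
set C := (c / Num.sqrt (2 * pi))%R.
have C0 : (0 <= C)%R by rewrite divr_ge0 ?sqrtr_ge0.
have mw := @measurable_nu_weight R n.+2.
have mpw : measurable_fun setT (@pw R n.+1) by exact: measurable_pw.
have mI : measurable (@I11 R : set (measurableTypeR R)) by exact: measurable_itv.
have mwE : measurable_fun (@I11 R : set (measurableTypeR R))
    (fun t : R => (nu_weight n.+2 t)%:E).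
  exact/measurable_funTS/measurable_EFinP.
pose W := \int[mu]_(t in @I11 R) (nu_weight n.+2 t)%:E.
have W0 : 0 <= W by apply: integral_ge0 => t _; rewrite lee_fin nu_weight_ge0.
have mCpw : measurable_fun setT (fun r : R => (C * pw n.+1 r)%:E) by mfun.
have [M M0 MC] : exists2 M : \bar R, 0 <= M & forall u : \bar R, 0 <= u ->
    \int[mu]_r ((C * pw n.+1 r)%:E * u) = M * u.
  exists (\int[mu]_r (C * pw n.+1 r)%:E).
    by apply: integral_ge0 => r _; rewrite lee_fin mulr_ge0// pw_ge0.
  move=> u u0; rewrite ge0_integralZr//= => x _.
  by rewrite lee_fin mulr_ge0// pw_ge0.
have sphE (h : n.+2.-tuple R -> \bar R) :
    measurable_fun setT h -> (forall x, 0 <= h x) ->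
    \int[sphM n.+2]_x h x =
    M * \int[mu]_(t in @I11 R) ((nu_weight n.+2 t)%:E *
          \int[sphM n.+1]_th h (slice t th)).
  move=> mh h0; pose J t := \int[sphM n.+1]_th h (slice t th).
  have J0 t : 0 <= J t by exact: integral_ge0.
  have IJ0 : 0 <= \int[mu]_(t in @I11 R) ((nu_weight n.+2 t)%:E * J t).
    by apply: integral_ge0 => t _; rewrite mule_ge0 ?lee_fin ?nu_weight_ge0.
  apply: (etrans (integral_sphM mh h0)); apply: (etrans _ (MC _ IJ0)).
  have mF : measurable_fun setT (fun p : R * n.+2.-tuple R => h p.2).
    exact: (measurableT_comp mh).
  apply: (etrans (polar_step (F := fun _ => h) pol mF (fun _ => h0))).
  apply: eq_integral => r _; rewrite -/C.
  have JE t : \int[gaussM n.+1]_y h (slice t (normalize y)) = J t.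
    apply: (esym (@integral_sphM n.+1 (fun th => h (slice t th)) _ _)) => //.
    by apply: (measurableT_comp mh); exact: measurable_slice.
  apply: (congr1 (fun u => (C * pw n.+1 r)%:E * u)).
  by apply: eq_integral => t _; rewrite JE.
(* The radial mass [M] and the mass [W] of the weight could each be 0 or infinite a priori; their
   product being 1 excludes this and identifies [M] with [nu_const]. *)
have MW : M * W = 1.
  have := sphE (fun=> 1) (measurable_cst _) (fun=> lee01).
  rewrite integral_cst//= probability_setT mul1e => ->; congr (_ * _).
  apply: eq_integral => t _.
  by rewrite integral_cst//= probability_setT !mule1.
have [w w0 WE] : exists2 w : R, (0 < w)%R & W = w%:E.
  move: MW W0; case: W => [w| |] //.
    move=> MW; rewrite le_eqVlt => /predU1P[w0|]; last by rewrite lte_fin => ?; exists w.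
    by move: MW; rewrite -w0 mule0 => /esym/eqP; rewrite onee_eq0.
  move: M0; rewrite le_eqVlt => /predU1P[<-|M0].
    by rewrite mul0e => /esym/eqP; rewrite onee_eq0.
  by rewrite gt0_muley.
have inv (m : \bar R) : m * w%:E = 1 -> 0 <= m -> m = w^-1%:E.
  case: m => [m| |] //; last by rewrite gt0_mulye ?lte_fin.
  rewrite -EFinM => -[mw1] _; congr EFin.
  by rewrite -[LHS](mulfK (lt0r_neq0 w0)) mw1 mul1r.
have ME : M = w^-1%:E by apply: inv => //; rewrite -WE.
have nucE : nu_const R n.+2 = w^-1%R by rewrite /nu_const -/W WE.
have disint (h : n.+2.-tuple R -> \bar R) :
    measurable_fun setT h -> (forall x, 0 <= h x) ->
    \int[sphM n.+2]_x h x =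
    nu_int n.+2 (fun t => \int[sphM n.+1]_th h (slice t th)).
  move=> mh h0; rewrite sphE// /nu_int nucE ME -ge0_integralZl//=.
  - by apply: eq_integral => t _; rewrite muleA -EFinM.
  - have hh : measurable_fun setT (fun t : R =>
        (nu_weight n.+2 t)%:E * \int[sphM n.+1]_th h (slice t th)).
      apply: emeasurable_funM; first exact/measurable_EFinP.
      apply: measurable_integral_param => //.
      by apply: (measurableT_comp mh); apply: measurable_slice.
    by apply: measurable_funTS; exact: hh.
  - move=> t _; rewrite mule_ge0 ?lee_fin ?nu_weight_ge0//.
    exact: integral_ge0.
  - by rewrite lee_fin invr_ge0 ltW.
split => //; exists (C * w)%R; split; first by rewrite mulr_ge0// ltW.
move=> F mF F0; rewrite (polar_step pol)//; apply: eq_integral => r _ /=.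
have mFr : measurable_fun setT (F r) by apply: (measurable_fun2_comp mF); mfun.
rewrite -integral_sphM// sphE// ME -/C.
rewrite [RHS]muleA -[in RHS]EFinM.
rewrite (_ : C * w * pw n.+1 r / w = C * pw n.+1 r)%R; last first.
  by rewrite mulrAC mulfK// gt_eqF.
apply: (congr1 (fun u => (C * pw n.+1 r)%:E * u)).
apply: eq_integral => t _; apply: (congr1 (fun u => (nu_weight n.+2 t)%:E * u)).
apply: (esym (@integral_sphM n.+1 (fun th => F r (slice t th)) _ _)) => //.
by apply: (measurableT_comp mFr); exact: measurable_slice.
Qed.

Lemma polar_exists n : exists c, @is_polar R n.+1 c.
Proof.
elim: n => [|n [c /disint_polar[]]//].
by exists (2 / Num.sqrt (2 * pi))%R; exact: polar1.
Qed.

Lemma disintegration n (h : n.+2.-tuple R -> \bar R) :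
  measurable_fun setT h -> (forall x, 0 <= h x) ->
  \int[sphM n.+2]_x h x =
  nu_int n.+2 (fun t => \int[sphM n.+1]_th h (slice t th)).
Proof. by have [c /disint_polar[+ _]] := polar_exists n; exact. Qed.

End Disintegration.

(** * Random isometries *)

Section Haar.
Context {R : realType}.
Local Open Scope ereal_scope.
Local Notation mu := (@lebesgue_measure R).

Lemma integral_sphM_isom n (O : n.-tuple R -> n.-tuple R) (h : n.-tuple R -> \bar R) :
  gauss_isom O -> measurable_fun setT h -> (forall x, 0 <= h x) ->
  \int[sphM n]_x h (O x) = \int[sphM n]_x h x.
Proof.
move=> gO mh h0; have [mO _ _ iO] := gO.
rewrite !integral_sphM//; last exact: (measurableT_comp mh).
rewrite -[RHS](iO (fun x => h (normalize x)))//; last first.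
  exact: (measurableT_comp mh (@measurable_normalizeT R n)).
by apply: eq_integral => x _; rewrite gauss_isom_normalize.
Qed.

(** [normalize] misses the unit sphere only at the origin, which lies in the null set where the
    first coordinate vanishes. *)
Lemma eq_integral_sphM n (h1 h2 : n.+1.-tuple R -> \bar R) :
  measurable_fun setT h1 -> (forall x, 0 <= h1 x) ->
  measurable_fun setT h2 -> (forall x, 0 <= h2 x) ->
  (forall x, dotp x x = 1%R -> h1 x = h2 x) ->
  \int[sphM n.+1]_x h1 x = \int[sphM n.+1]_x h2 x.
Proof.
move=> mh1 h10 mh2 h20 h12.
pose k (h : n.+1.-tuple R -> \bar R) a := \int[gaussM n]_x h (normalize (consp (a, x))).
have kE h : measurable_fun setT h -> (forall x, 0 <= h x) ->
    \int[sphM n.+1]_x h x = \int[mu]_a ((gdens a)%:E * k h a) /\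
    measurable_fun setT (fun a => (gdens a)%:E * k h a).
  move=> mh h0; have mhn : measurable_fun setT (fun x => h (normalize x)).
    exact: (measurableT_comp mh (@measurable_normalizeT R n.+1)).
  have mk : measurable_fun setT (fun a => k h a).
    apply: measurable_integral_param => //.
    by apply: (measurableT_comp mhn); mfun.
  split; last by mfun.
  rewrite integral_sphM// integral_gaussMS// integral_gauss1// => a.
  exact: integral_ge0.
have [e1 m1] := kE _ mh1 h10; have [e2 m2] := kE _ mh2 h20.
rewrite e1 e2; apply: ge0_ae_eq_integral => //=.
- by move=> a _; rewrite mule_ge0 ?integral_ge0// lee_fin gdens_ge0.
- by move=> a _; rewrite mule_ge0 ?integral_ge0// lee_fin gdens_ge0.
exists [set 0%R]; split => [|//=|].
- exact: measurable_set1.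
- by rewrite lebesgue_measure_set1.
move=> a /= aN; apply: contra_notP aN => /eqP a0 _.
congr (_ * _); apply: eq_integral => x _; apply: h12; apply: dotp_normalize.
apply/eqP => /enorm_eq0 /(_ ord0); rewrite tnth_consp0 => a00.
by rewrite a00 eqxx in a0.
Qed.

Lemma behead_consp n (c : R) (z : n.-tuple R) : [tuple of behead (consp (c, z))] = z.
Proof. exact: val_inj. Qed.

Definition consO n (O : n.-tuple R -> n.-tuple R) (x : n.+1.-tuple R) :=
  consp (tnth x ord0, O [tuple of behead x]).

Lemma consO_slice n (O : n.-tuple R -> n.-tuple R) t x : gauss_isom O ->
  consO O (slice t x) = slice t (O x).
Proof.
by move=> [_ lO _ _]; rewrite /consO /slice tnth_consp0 behead_consp lO.
Qed.

Lemma dotp_slice n t (x : n.-tuple R) : (t ^+ 2 <= 1)%R -> dotp x x = 1%R ->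
  dotp (slice t x) (slice t x) = 1%R.
Proof.
move=> t1 x1; rewrite dotp_cons dotp_combl !dotp_combr x1 !mul0r !addr0 mulr1.
by rewrite -!expr2 sqr_sqrtr ?subr_ge0// addrC subrK.
Qed.

Lemma dotp_e0e0 n : dotp (e0 n) (e0 n) = 1%R :> R.
Proof. by rewrite dotp_e0 tnth_mktuple eqxx. Qed.

Lemma slice_decomp n (w : n.+2.-tuple R) : dotp w w = 1%R ->
  exists2 th, dotp th th = 1%R & w = slice (tnth w ord0) th.
Proof.
move=> w1; set t := tnth w ord0.
set w' := [tuple of behead w].
have e : (1 - t ^+ 2 = enorm w' ^+ 2)%R.
  by rewrite -w1 {1 2}(consp_eta w) dotp_cons sqr_enorm expr2 -/w' -/t; ring.
have se : Num.sqrt (1 - t ^+ 2) = enorm w'.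
  by rewrite e sqrtr_sqr ger0_norm// enorm_ge0.
(* At a pole the equatorial direction is arbitrary. *)
have [w0|w0] := eqVneq (enorm w') 0%R.
  exists (e0 n); first exact: dotp_e0e0.
  rewrite [LHS]consp_eta -/t -/w' /slice se w0; congr (consp (_, _)).
  by apply: eq_from_tnth => i; rewrite tnth_comb !mul0r addr0 enorm_eq0.
exists (normalize w'); first exact: dotp_normalize.
rewrite [LHS]consp_eta -/t -/w' /slice se; congr (consp (_, _)).
rewrite -{1}(normK w'); apply: eq_from_tnth => i.
by rewrite !tnth_comb !mul0r.
Qed.

Definition ord01 n : 'I_n.+2 := lift ord0 ord0.

Definition giv01 n (c s : R) : n.+2.-tuple R -> n.+2.-tuple R := giv ord0 (ord01 n) c s.

(* A substitute for Haar measure: only the law of the image of one unit vector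
   matters. *)
Definition haar n := exists (dZ : measure_display) (Z : measurableType dZ)
  (P : probability Z R) (O : Z -> n.-tuple R -> n.-tuple R),
  [/\ measurable_fun setT (fun p => O p.1 p.2), forall z, gauss_isom (O z) &
   forall w, dotp w w = 1%R -> forall B : n.-tuple R -> \bar R,
     measurable_fun setT B -> (forall x, 0 <= B x) ->
     \int[P]_z B (O z w) = \int[sphM n]_x B x].

(** Plane rotations act as multiplication of complex numbers, which commutes: turning [w] by a
    uniform [z] is turning [z] by [w]. Off the circle the identity is used, so that every [O z] is
    an isometry. *)
Lemma haar2 : haar 2.
Proof.
pose O (z : 2.-tuple R) : 2.-tuple R -> 2.-tuple R := if dotp z z == 1%R then
  @giv01 0 (tnth z ord0) (tnth z (ord01 0)) else id.
have mg1 : measurable_fun setT (fun p : 2.-tuple R * 2.-tuple R =>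
    @giv01 0 (tnth p.1 ord0) (tnth p.1 (ord01 0)) p.2).
  by apply: measurable_giv; mfun.
have mO : measurable_fun setT (fun p : 2.-tuple R * 2.-tuple R => O p.1 p.2).
  rewrite (_ : (fun p => _) = fun p => if dotp p.1 p.1 == 1%R then
      @giv01 0 (tnth p.1 ord0) (tnth p.1 (ord01 0)) p.2 else p.2); last first.
    by apply/funext => p; rewrite /O; case: ifP.
  apply: measurable_fun_ifT => //.
  by apply: measurable_fun_eqr; mfun.
exists _, _, (sphM 2), O; split => // [z|w w1 B mB B0].
  rewrite /O; case: eqP => [z1|_]; last exact: gauss_isom_id.
  apply: gauss_isom_giv => //.
  by rewrite -z1 /dotp !big_ord_recl big_ord0 addr0 !expr2.
have gw : gauss_isom (@giv01 0 (tnth w ord0) (tnth w (ord01 0))).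
  apply: gauss_isom_giv => //.
  by rewrite -w1 /dotp !big_ord_recl big_ord0 addr0 !expr2.
apply: (etrans _ (integral_sphM_isom gw mB B0)).
apply: eq_integral_sphM => //.
- apply: (measurableT_comp mB).
  exact: (measurableT_comp mO (measurable_fun_pair (@measurable_id _ _ setT)
    (@measurable_cst _ _ _ _ setT w))).
- by apply: (measurableT_comp mB); have [] := gw.
move=> z z1; rewrite /O z1 eqxx; congr B.
apply: eq_from_tnth => k; rewrite !tnth_mktuple.
case: (unliftP ord0 k) => [j ->|->] /=; first by rewrite (ord1 j) eqxx; ring.
by ring.
Qed.

Lemma integral_prob_prod3 d1 d2 (Z : measurableType d1) (X : measurableType d2)
    (P : probability Z R) (Q : probability X R) (F : (Z * X) * Z -> \bar R) :
  measurable_fun setT F -> (forall p, 0 <= F p) ->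
  \int[((P \x Q) \x P)%E]_p F p = \int[P]_z \int[Q]_x \int[P]_z' F ((z, x), z').
Proof.
move=> mF F0; pose PQ : probability (Z * X)%type R := (P \x Q)%E.
apply: (etrans (@fubini_tonelli1 _ _ _ _ R PQ P F mF F0)).
apply: (@fubini_tonelli1 _ _ _ _ R P Q (fun q => \int[P]_z' F (q, z'))).
  apply: (@measurable_integral_param _ _ _ _ _ P (fun q z' => F (q, z'))) => //.
  by rewrite (_ : (fun p => _) = F)//; apply/funext => -[].
by move=> q; exact: integral_ge0.
Qed.

(* The random isometry is (1 + S') G (1 + S), with S and S' independent random
   isometries of the last coordinates and G the rotation of the first two
   coordinates taking e0 to a vector of uniform first coordinate. *)
Lemma haarS n : haar n.+2 -> haar n.+3.
Proof.
move=> [dZ [Z [P [Oz [mO gO iO]]]]].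
pose T (x : n.+3.-tuple R) : R := tnth (normalize x) ord0.
have T1 x : (T x ^+ 2 <= 1)%R.
  by apply: le_trans (normalize_le1 x); exact: tnth_sqr_le.
have mT : measurable_fun setT T.
  exact: (measurable_tnth_comp ord0 (@measurable_normalizeT R n.+3)).
pose Q x := giv01 (T x) (Num.sqrt (1 - T x ^+ 2)) : n.+3.-tuple R -> n.+3.-tuple R.
have gQ x : gauss_isom (Q x).
  by apply: gauss_isom_giv => //; rewrite sqr_sqrtr ?subr_ge0// addrC subrK.
pose O' (p : (Z * n.+3.-tuple R) * Z) :=
  consO (Oz p.1.1) \o Q p.1.2 \o consO (Oz p.2).
have mconsO d (U : measurableType d) (z : U -> Z) (f : U -> n.+3.-tuple R) :
    measurable_fun setT z -> measurable_fun setT f ->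
    measurable_fun setT (fun u => consO (Oz (z u)) (f u)).
  move=> mz mf; apply: measurable_consp_comp; first exact: measurable_tnth_comp.
  have mb : measurable_fun setT (fun u => [tuple of behead (f u)]).
    exact: (measurableT_comp (@measurable_behead _ _ _) mf).
  exact: (measurableT_comp mO (measurable_fun_pair mz mb)).
have mQ d (U : measurableType d) (x f : U -> n.+3.-tuple R) :
    measurable_fun setT x -> measurable_fun setT f ->
    measurable_fun setT (fun u => Q (x u) (f u)).
  move=> mx mf; have mTx := measurableT_comp mT mx.
  by apply: measurable_giv => //; mfun.
have mO' : measurable_fun setT
    (fun q : ((Z * n.+3.-tuple R) * Z) * n.+3.-tuple R => O' q.1 q.2).
  have m11 : measurable_fun setT
      (fun q : ((Z * n.+3.-tuple R) * Z) * n.+3.-tuple R => q.1.1).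
    exact: (measurableT_comp measurable_fst measurable_fst).
  have mz1 := measurableT_comp measurable_fst m11.
  have mx := measurableT_comp measurable_snd m11.
  have mz2 := measurableT_comp measurable_snd (@measurable_fst _ _
    ((Z * n.+3.-tuple R) * Z)%type (n.+3.-tuple R)).
  exact: (mconsO _ _ _ _ mz1 (mQ _ _ _ _ mx (mconsO _ _ _ _ mz2 measurable_snd))).
exists _, _, ((P \x gaussM n.+3) \x P)%E, O'; split => // [p|w w1 B mB B0].
  by apply: gauss_isom_comp; [apply: gauss_isom_comp => //|]; apply: gauss_isom_cons.
have [th0 th1 we] := slice_decomp w1.
set a := tnth w ord0 in we.
have a1 : (a ^+ 2 <= 1)%R by rewrite -w1 tnth_sqr_le.
set b := Num.sqrt (1 - a ^+ 2)%R.
have ab1 : (a ^+ 2 + b ^+ 2 = 1)%R.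
  by rewrite sqr_sqrtr ?subr_ge0// addrC subrK.
have mBO : measurable_fun setT (fun p => B (O' p w)).
  apply: (measurableT_comp mB).
  exact: (measurableT_comp mO' (measurable_fun_pair (@measurable_id _ _ setT)
    (@measurable_cst _ _ _ _ setT w))).
pose G (z : Z) x (th : n.+2.-tuple R) := B (consO (Oz z) (Q x (slice a th))).
have G0 z x th : 0 <= G z x th by exact: B0.
have mG d (U : measurableType d) (z : U -> Z) x th :
    measurable_fun setT z -> measurable_fun setT x -> measurable_fun setT th ->
    measurable_fun setT (fun u => G (z u) (x u) (th u)).
  move=> mz mx mth; apply: (measurableT_comp mB); apply: mconsO => //.
  by apply: mQ => //; apply: measurable_slice.
(* The inner isometry makes the equatorial direction of [w] uniform. *)
have e1 : \int[(P \x gaussM n.+3) \x P]_p B (O' p w) =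
    \int[P]_z \int[gaussM n.+3]_x \int[sphM n.+2]_th G z x th.
  apply: (etrans (@integral_prob_prod3 _ _ _ _ P (gaussM n.+3)
    (fun p => B (O' p w)) mBO (fun=> B0 _))).
  apply: eq_integral => z _; apply: eq_integral => x _.
  have mGq : measurable_fun setT (fun th => G z x th) by exact: mG.
  apply: (etrans _ (iO _ th1 (G z x) mGq (fun=> G0 _ _ _))).
  by apply: eq_integral => z' _; rewrite /G /O' /= we consO_slice.
pose Psi (tau : R) := \int[sphM n.+2]_eta B (slice tau eta).
have Psi0 tau : 0 <= Psi tau by exact: integral_ge0.
have mPsi : measurable_fun setT Psi.
  apply: measurable_integral_param => //; apply: (measurableT_comp mB).
  exact: measurable_slice.
(* This height is symmetric in the two angles: it is also the first coordinate of [slice t th] after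
   the fixed rotation by [a] and [b]. *)
pose tau (t : R) (th : n.+2.-tuple R) : R :=
  (t * a - Num.sqrt (1 - t ^+ 2) * (b * tnth th ord0))%R.
have mtau d (U : measurableType d) (t : U -> R) th :
    measurable_fun setT t -> measurable_fun setT th ->
    measurable_fun setT (fun u => tau (t u) (th u)).
  by move=> mt mth; rewrite /tau; mfun.
have mPt d (U : measurableType d) (t : U -> R) th :
    measurable_fun setT t -> measurable_fun setT th ->
    measurable_fun setT (fun u => Psi (tau (t u) (th u))).
  by move=> mt mth; apply: (measurableT_comp mPsi); exact: mtau.
(* The outer isometry makes the equatorial direction of the rotated vector uniform, so only its
   height is left. *)
have e2 x : \int[P]_z \int[sphM n.+2]_th G z x th =
    \int[sphM n.+2]_th Psi (tau (T x) th).
  have -> : \int[P]_z \int[sphM n.+2]_th G z x th =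
      \int[sphM n.+2]_th \int[P]_z G z x th.
    by apply: (@tonelli _ _ _ _ _ P (sphM n.+2) (fun z th => G z x th)) => //; apply: mG.
  apply: eq_integral_sphM => //.
  - apply: (@measurable_integral_param _ _ _ _ _ P (fun th z => G z x th)) => //.
    by apply: mG.
  - by move=> th; exact: integral_ge0.
  - by apply: mPt.
  move=> th thn; set v := Q x (slice a th).
  have v1 : dotp v v = 1%R.
    by have [_ _ dQ _] := gQ x; rewrite dQ dotp_slice.
  have [eta eta1 ve] := slice_decomp v1.
  have vtau : tnth v ord0 = tau (T x) th.
    rewrite /v tnth_mktuple eqxx /slice tnth_consp0 tnth_consS tnth_comb mul0r addr0.
    by rewrite /tau.
  rewrite vtau in ve.
  transitivity (\int[P]_z B (slice (tau (T x) th) (Oz z eta))).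
    by apply: eq_integral => z _; rewrite /G -/v ve consO_slice.
  apply: (iO _ eta1 (fun eta => B (slice (tau (T x) th) eta))) => //.
  by apply: (measurableT_comp mB); apply: measurable_slice.
have cstE (c : \bar R) : \int[sphM n.+2]_th c = c.
  by rewrite integral_cst//= probability_setT mule1.
pose I z x := \int[sphM n.+2]_th G z x th.
have I0 z x : 0 <= I z x by exact: integral_ge0.
have mI : measurable_fun setT (fun p => I p.1 p.2).
  apply: (@measurable_integral_param _ _ _ _ _ (sphM n.+2)
    (fun (q : Z * n.+3.-tuple R) th => G q.1 q.2 th)) => //.
  apply: mG => //; first exact: (measurableT_comp measurable_fst).
  exact: (measurableT_comp measurable_snd).
pose Xi (t : R) := \int[sphM n.+2]_th Psi (tau t th).
have Xi0 t : 0 <= Xi t by exact: integral_ge0.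
have mXi : measurable_fun setT Xi.
  by apply: measurable_integral_param => //; apply: mPt.
have mXi0 : measurable_fun setT (fun y : n.+3.-tuple R => Xi (tnth y ord0)).
  by apply: (measurableT_comp mXi); exact: measurable_tnth.
have mPsi0 : measurable_fun setT (fun y : n.+3.-tuple R => Psi (tnth y ord0)).
  by apply: (measurableT_comp mPsi); exact: measurable_tnth.
have ggiv : gauss_isom (@giv01 n.+1 a b) by exact: gauss_isom_giv.
have mPsig : measurable_fun setT
    (fun y : n.+3.-tuple R => Psi (tnth (giv01 a b y) ord0)).
  by have [mg _ _ _] := ggiv; exact: (measurableT_comp mPsi0 mg).
apply: (etrans e1).
apply: (etrans (@tonelli _ _ _ _ _ P (gaussM n.+3) I mI I0)).
transitivity (\int[gaussM n.+3]_x Xi (T x)); first by apply: eq_integral => x _; exact: e2.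
(* [T x] is the height of a uniform vector. Combined with the independent direction [th] it rebuilds
   a uniform vector, and the fixed rotation preserves its law. *)
apply: (etrans (esym (integral_sphM mXi0 (fun y => Xi0 _)))).
apply: (etrans (disintegration mXi0 (fun y => Xi0 _))).
transitivity (nu_int n.+3 Xi).
  apply: eq_integral => t _; apply: (congr1 (mule _)).
  rewrite -[RHS]cstE; apply: eq_integral => th _.
 by rewrite tnth_consp0.
transitivity (nu_int n.+3
    (fun t => \int[sphM n.+2]_th Psi (tnth (giv01 a b (slice t th)) ord0))).
  apply: eq_integral => t _; apply: (congr1 (mule _)).
  apply: eq_integral => th _; apply: congr1.
  rewrite /tau tnth_mktuple eqxx /slice tnth_consp0 tnth_consS tnth_comb.
  by ring.
apply: (etrans (esym (disintegration mPsig (fun y => Psi0 _)))).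
apply: (etrans (integral_sphM_isom ggiv mPsi0 (fun y => Psi0 _))).
apply: (etrans (disintegration mPsi0 (fun y => Psi0 _))).
apply: (etrans _ (esym (disintegration mB B0))).
apply: eq_integral => t _; apply: (congr1 (mule _)).
rewrite -[RHS]cstE; apply: eq_integral => th _.
by rewrite tnth_consp0.
Qed.

Lemma haar_exists n : haar n.+2.
Proof. by elim: n => [|n IH]; [exact: haar2|exact: haarS]. Qed.

End Haar.

(** * The Carlen-Lieb-Loss inequality *)

Section PolyTaylor.
Context {R : realType}.
Implicit Types p q : {poly R}.

Definition bd1 p (K : R) := forall t : R, `|t| <= 1 -> `|p.[t]| <= K.

Lemma bd1_exists p : exists2 K : R, 0 <= K & bd1 p K.
Proof.
elim/poly_ind: p => [|p c [K K0 pK]].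
  by exists 0 => // t _; rewrite horner0 normr0.
exists (K + `|c|) => [|t t1]; first by rewrite addr_ge0.
rewrite hornerD hornerMX hornerC (le_trans (ler_normD _ _))// lerD2r normrM.
by rewrite -[leRHS]mulr1 ler_pM// pK.
Qed.

Lemma bd1D p q K K' : bd1 p K -> bd1 q K' -> bd1 (p + q) (K + K').
Proof.
move=> pK qK t t1; rewrite hornerD (le_trans (ler_normD _ _))// lerD// ?pK ?qK//.
Qed.

Lemma bd1Z p K a : `|a| <= 1 -> bd1 p K -> bd1 (a *: p) K.
Proof.
move=> a1 pK t t1; rewrite hornerZ normrM -[leRHS]mul1r ler_pM// pK//.
Qed.

(** Passing from p to p X + c turns the remainder r into p''(t) e^3 / 2 + (t + e) r, and |t + e| <=
    3. *)
Lemma poly_taylor2 p : exists2 K : R, 0 <= K & forall t e : R, `|t| <= 1 -> `|e| <= 2 ->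
  `|p.[t + e] - (p.[t] + p^`().[t] * e + p^`()^`().[t] * e ^+ 2 / 2)| <= K * `|e| ^+ 3.
Proof.
elim/poly_ind: p => [|p c [K K0 pK]].
  exists 0 => // t e _ _.
  by rewrite !raddf0 !horner0 !mul0r !addr0 subrr normr0.
have [K2 K20 bK2] := bd1_exists p^`()^`().
exists (K2 + 3 * K) => [|t e t1 e2]; first by rewrite addr_ge0// mulr_ge0.
have pK' := pK t e t1 e2.
set r := p.[t + e] - _ in pK'.
have pE : p.[t + e] = p.[t] + p^`().[t] * e + p^`()^`().[t] * e ^+ 2 / 2 + r.
  by rewrite /r; ring.
rewrite derivD derivC addr0 derivM derivX mulr1 derivD derivM derivX mulr1.
rewrite !(hornerD, hornerMX, hornerC) pE.
rewrite (_ : _ - _ = p^`()^`().[t] / 2 * e ^+ 3 + (t + e) * r); last by field.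
rewrite (le_trans (ler_normD _ _))// [leRHS]mulrDl lerD//.
  rewrite normrM normrX ler_wpM2r ?exprn_ge0//.
  rewrite normrM (gtr0_norm (_ : 0 < 2^-1))//.
  have := bK2 t t1; have : 0 <= `|p^`()^`().[t]| by []. lra.
rewrite normrM -mulrA ler_pM//.
by rewrite (le_trans (ler_normD _ _))//; lra.
Qed.

(* The average of [p] over the two points at angle [arcsin e] from [t] in the
   direction [y]; its second-order part is a piece of the spherical Laplacian. *)
Definition two_point p (K : R) := forall t y c e : R, `|t| <= 1 -> `|y| <= 1 ->
  0 <= c -> 0 <= e <= 1 -> c ^+ 2 + e ^+ 2 = 1 ->
  `|(p.[c * t + e * y] + p.[c * t - e * y]) / 2 -
    (p.[t] + e ^+ 2 / 2 * (p^`()^`().[t] * y ^+ 2 - p^`().[t] * t))| <= K * e ^+ 3.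

Lemma two_point_exists p : exists2 K : R, 0 <= K & two_point p K.
Proof.
have [K K0 tK] := poly_taylor2 p.
have [K1 K10 bK1] := bd1_exists p^`().
have [K2 K20 bK2] := bd1_exists p^`()^`().
exists (8 * K + K1 + K2) => [|t y c e t1 y1 c0 /andP[e0 e1] ce]; first by lra.
have c1 : c <= 1.
  by rewrite -(@ler_pXn2r _ 2)// ?nnegrE// expr1n -ce lerDl sqr_ge0.
(* The two points are t - g t +- e y with g = e^2 / 2 up to order e^4. In the average the
   first-order terms in y cancel and - g t p'(t) survives. *)
pose g := 1 - c.
have g0 : 0 <= g by rewrite subr_ge0.
have gE : 2 * g = e ^+ 2 + g ^+ 2.
  have -> : e ^+ 2 = 1 - c ^+ 2 by rewrite -ce; ring.
  by rewrite /g; ring.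
have ge2 : g <= e ^+ 2.
  have g1 : g <= 1 by rewrite /g; lra.
  have : g ^+ 2 <= g by rewrite expr2 ler_piMl.
  by lra.
have e2e : e ^+ 2 <= e by rewrite expr2 ler_piMl.
pose r1 := p.[t + (e * y - g * t)] -
  (p.[t] + p^`().[t] * (e * y - g * t) + p^`()^`().[t] * (e * y - g * t) ^+ 2 / 2).
pose r2 := p.[t + (- (e * y) - g * t)] -
  (p.[t] + p^`().[t] * (- (e * y) - g * t) + p^`()^`().[t] * (- (e * y) - g * t) ^+ 2 / 2).
have eta_le (s : R) : `|s| <= e -> `|s - g * t| <= 2 * e.
  move=> se; rewrite (le_trans (ler_normB _ _))// normrM (ger0_norm g0).
  have : g * `|t| <= e.
    by rewrite (le_trans _ (le_trans ge2 e2e))// -[leRHS]mulr1 ler_pM.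
  by lra.
have ey : `|e * y| <= e by rewrite normrM (ger0_norm e0) ler_piMr.
have small (s : R) : `|s| <= e -> K * `|s - g * t| ^+ 3 <= 8 * K * e ^+ 3.
  move=> se; rewrite [8 * K]mulrC -mulrA ler_wpM2l//.
  have -> : 8 * e ^+ 3 = (2 * e) ^+ 3 by ring.
  by rewrite lerXn2r ?nnegrE ?mulr_ge0// eta_le.
have r1K : `|r1| <= 8 * K * e ^+ 3.
  rewrite (le_trans (tK _ _ t1 _)) ?small// (le_trans (eta_le _ ey))//; lra.
have r2K : `|r2| <= 8 * K * e ^+ 3.
  rewrite (le_trans (tK _ _ t1 _)) ?small ?normrN// (le_trans (eta_le _ _)) ?normrN//.
  lra.
have p1E : p.[c * t + e * y] = p.[t] + p^`().[t] * (e * y - g * t) +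
    p^`()^`().[t] * (e * y - g * t) ^+ 2 / 2 + r1.
  rewrite /r1 (_ : c * t + e * y = t + (e * y - g * t)); first by ring.
  by rewrite /g; ring.
have p2E : p.[c * t - e * y] = p.[t] + p^`().[t] * (- (e * y) - g * t) +
    p^`()^`().[t] * (- (e * y) - g * t) ^+ 2 / 2 + r2.
  rewrite /r2 (_ : c * t - e * y = t + (- (e * y) - g * t)); first by ring.
  by rewrite /g; ring.
rewrite p1E p2E.
rewrite (_ : _ - _ = (r1 + r2) / 2 + (- p^`().[t] * t * (g - e ^+ 2 / 2) +
   p^`()^`().[t] * t ^+ 2 * (g ^+ 2 / 2))); last by field.
rewrite (_ : g - e ^+ 2 / 2 = g ^+ 2 / 2); last by lra.
have g3 : g ^+ 2 <= e ^+ 3.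
  rewrite (le_trans (_ : _ <= (e ^+ 2) ^+ 2))// ?lerXn2r ?nnegrE ?sqr_ge0//.
  have -> : (e ^+ 2) ^+ 2 = e ^+ 3 * e by ring.
  by rewrite ler_piMr ?exprn_ge0.
have e30 : 0 <= e ^+ 3 by rewrite exprn_ge0.
have gg : `|g ^+ 2 / 2| <= e ^+ 3.
  have g20 : 0 <= g ^+ 2 / 2 by rewrite divr_ge0 ?sqr_ge0.
  by rewrite (ger0_norm g20); lra.
have b1 : `|- p^`().[t] * t * (g ^+ 2 / 2)| <= K1 * e ^+ 3.
  rewrite normrM ler_pM// normrM normrN -[leRHS]mulr1.
  by apply: ler_pM => //; exact: bK1.
have b2 : `|p^`()^`().[t] * t ^+ 2 * (g ^+ 2 / 2)| <= K2 * e ^+ 3.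
  have t2 : `|t| ^+ 2 <= 1 by rewrite -(expr1n _ 2) lerXn2r ?nnegrE.
  rewrite normrM ler_pM// normrM normrX -[leRHS]mulr1.
  by apply: ler_pM => //; exact: bK2.
have b3 : `|(r1 + r2) / 2| <= 8 * K * e ^+ 3.
  rewrite normrM (gtr0_norm (_ : 0 < 2^-1))//.
  by move: (ler_normD r1 r2) r1K r2K; lra.
rewrite (_ : (8 * K + K1 + K2) * e ^+ 3 =
  8 * K * e ^+ 3 + (K1 * e ^+ 3 + K2 * e ^+ 3)); last by ring.
apply: (le_trans (ler_normD _ _)); apply: lerD => //.
by apply: (le_trans (ler_normD _ _)); exact: lerD.
Qed.

Lemma two_pointD p q K K' : two_point p K -> two_point q K' ->
  two_point (p + q) (K + K').
Proof.
move=> pK qK t y c e t1 y1 c0 e0 ce.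
have h1 := pK t y c e t1 y1 c0 e0 ce; have h2 := qK t y c e t1 y1 c0 e0 ce.
rewrite !derivD !hornerD [leRHS]mulrDl.
apply: le_trans (lerD h1 h2); apply: le_trans (ler_normD _ _).
by rewrite le_eqVlt; apply/orP; left; apply/eqP; congr `|_|; field.
Qed.

Lemma two_pointZ p K a : `|a| <= 1 -> two_point p K -> two_point (a *: p) K.
Proof.
move=> a1 pK t y c e t1 y1 c0 e0 ce; have := pK t y c e t1 y1 c0 e0 ce.
rewrite !derivZ !hornerZ => h.
rewrite (_ : _ - _ = a * ((p.[c * t + e * y] + p.[c * t - e * y]) / 2 -
  (p.[t] + e ^+ 2 / 2 * (p^`()^`().[t] * y ^+ 2 - p^`().[t] * t)))); last by field.
by rewrite normrM -[leRHS]mul1r ler_pM.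
Qed.

End PolyTaylor.

(** * Eigenpolynomials of the zonal Laplacian *)

Section Gegenbauer.
Context {R : realType}.
Variable m : nat.
Implicit Types p q : {poly R}.

(* The spherical Laplacian of S^m acting on zonal functions p(x_1). *)
Definition zlap p : {poly R} := (1 - 'X^2) * p^`()^`() - m%:R *: ('X * p^`()).

Lemma zlap_linear a p q : zlap (a *: p + q) = a *: zlap p + zlap q.
Proof.
by rewrite /zlap !derivD !derivZ -!mul_polyC; ring.
Qed.

Lemma zlapZ a p : zlap (a *: p) = a *: zlap p.
Proof.
by rewrite -[a *: p]addr0 zlap_linear /zlap !derivC !mulr0 scaler0 subr0 addr0.
Qed.

Lemma zlapD p q : zlap (p + q) = zlap p + zlap q.
Proof. by rewrite -[p in LHS]scale1r zlap_linear scale1r. Qed.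

Lemma zlap_sum I (r : seq I) (P : pred I) (F : I -> {poly R}) :
  zlap (\sum_(i <- r | P i) F i) = \sum_(i <- r | P i) zlap (F i).
Proof.
apply: (big_morph zlap zlapD).
by rewrite /zlap !derivC !mulr0 scaler0 subr0.
Qed.

(** The eigenvalue k (k + m - 1) of minus the Laplacian of the m-sphere on spherical harmonics of
    degree k. *)
Definition eigv (k : nat) : R := k%:R * (k%:R - 1 + m%:R).

(** [zlap] is triangular in the monomials, with diagonal entries [- eigv n]. *)
Lemma size_zlap_Xn n : (size (zlap 'X^n + eigv n *: 'X^n)%R <= n)%N.
Proof.
case: n => [|[|k]].
- by rewrite /zlap /eigv expr0 !derivC mulr0 mulr0 scaler0 mul0r scale0r subr0 addr0 size_poly0.
- rewrite /zlap /eigv expr1 derivX derivC mulr0 sub0r mulr1 mul1r subrr add0r.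
  by rewrite addNr size_poly0.
pose c : R := k.+2%:R.
have d1 : ('X^(k.+2))^`() = c *: 'X^(k.+1) :> {poly R} by rewrite derivXn -scaler_nat.
have d2 : ('X^(k.+1))^`() = (c - 1) *: 'X^k :> {poly R}.
  by rewrite derivXn -scaler_nat /c -[k.+2%:R]natr1 addrK.
rewrite (_ : _ + _ = (c * (c - 1)) *: 'X^k).
  by rewrite (leq_trans (size_scale_leq _ _))// size_polyXn.
rewrite /zlap /eigv d1 derivZ d2 -/c {d1 d2}; clearbody c; move: (m%:R : R) => M.
rewrite (exprS _ k.+1) (exprS _ k); move: ('X^k : {poly R}) => Y.
by rewrite -!mul_polyC !(polyCM, polyCD, polyCB, polyC1); ring.
Qed.

Hypothesis m_gt0 : (0 < m)%N.

Lemma eigv_ge1 k : (0 < k)%N -> 1 <= eigv k.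
Proof.
move=> k0; have k1 : 1 <= k%:R :> R by rewrite ler1n.
have m1 : 1 <= m%:R :> R by rewrite ler1n.
rewrite /eigv -[leLHS]mulr1 ler_pM//; lra.
Qed.

Lemma eigv_ge0 k : 0 <= eigv k.
Proof.
case: k => [|k]; first by rewrite /eigv mul0r.
by rewrite (le_trans ler01)// eigv_ge1.
Qed.

Lemma eigv_lt k n : (k < n)%N -> eigv k < eigv n.
Proof.
move=> kn; have kn1 : k%:R + 1 <= n%:R :> R by rewrite natr1 ler_nat.
have k0 : 0 <= k%:R :> R by [].
have m1 : 1 <= m%:R :> R by rewrite ler1n.
rewrite -subr_gt0 (_ : _ - _ = (n%:R - k%:R) * (n%:R + k%:R - 1 + m%:R)); last first.
  by rewrite /eigv; ring.
by apply: mulr_gt0; lra.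
Qed.

(** A triangular operator with distinct diagonal entries is diagonalizable: the leading monomial is
    corrected to an eigenpolynomial, and what remains has lower degree. *)
Lemma eigen_decomposition n p : (size p <= n)%N ->
  exists Q : nat -> {poly R}, p = \sum_(k < n) Q k /\
    forall k, (k < n)%N -> zlap (Q k) = - eigv k *: Q k /\ (size (Q k) <= k.+1)%N.
Proof.
elim: n p => [|n IH] p sp.
  exists (fun=> 0); split => //; rewrite big_ord0; apply/eqP.
  by rewrite -size_poly_leq0.
set a := p`_n.
have sz : (size (- (zlap (a *: 'X^n) + eigv n *: (a *: 'X^n)))%R <= n)%N.
  rewrite size_polyN zlapZ !scalerA [_ * a]mulrC -scalerA -scalerDr.
  by rewrite (leq_trans (size_scale_leq _ _))// size_zlap_Xn.
have [S [SE SP]] := IH _ sz.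
(* The correction is found mode by mode; the divisors are nonzero by [eigv_lt]. *)
pose q := \sum_(k < n) (eigv n - eigv k)^-1 *: S k.
have qE : zlap q + eigv n *: q = - (zlap (a *: 'X^n) + eigv n *: (a *: 'X^n)).
  rewrite SE /q zlap_sum scaler_sumr -big_split /=; apply: eq_bigr => k _.
  have [e _] := SP k (ltn_ord k); rewrite zlapZ e !scalerA -scalerDl.
  rewrite mulrN addrC [_ * eigv k]mulrC -mulrBl divff ?scale1r//.
  by rewrite gt_eqF// subr_gt0 eigv_lt.
have sq : (size q <= n)%N.
  rewrite /q; elim/big_ind: _ => [|x y xn yn|k _]; first by rewrite size_poly0.
    by rewrite (leq_trans (size_polyD _ _))// geq_max xn.
  rewrite (leq_trans (size_scale_leq _ _))//.
  by have [_ /leq_trans] := SP k (ltn_ord k); apply.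
pose P := a *: 'X^n + q.
have PE : zlap P = - eigv n *: P.
  apply/eqP; rewrite scaleNr -addr_eq0 /P zlapD scalerDr addrACA qE addrN//.
have sPn : (size P <= n.+1)%N.
  rewrite (leq_trans (size_polyD _ _))// geq_max (leqW sq) andbT.
  by rewrite (leq_trans (size_scale_leq _ _))// size_polyXn.
have sr : (size (p - P)%R <= n)%N.
  apply/leq_sizeP => j; rewrite leq_eqVlt => /predU1P[<-|nj].
    rewrite coefB coefD coefZ coefXn eqxx mulr1 [q`_n]nth_default// addr0.
    by rewrite subrr.
  rewrite nth_default//; apply: leq_trans nj.
  by rewrite (leq_trans (size_polyD _ _))// size_polyN geq_max sp.
have [S' [S'E S'P]] := IH _ sr.
exists (fun k => if (k < n)%N then S' k else P); split.
  rewrite big_ord_recr /= ltnn -[LHS](subrK P) S'E; congr (_ + _).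
  by apply: eq_bigr => k _; rewrite ltn_ord.
move=> k; rewrite ltnS leq_eqVlt => /predU1P[->|kn]; first by rewrite ltnn.
by rewrite kn; exact: S'P.
Qed.

End Gegenbauer.

(** * Expectations of bounded functions on the sphere *)

Section SphereExpectation.
Context {R : realType}.

(* Functions on the unit ball containing the range of [normalize]; values
   outside the ball are irrelevant. *)
Definition sbd n (h : n.-tuple R -> R) := measurable_fun setT h /\
  exists M, forall x, dotp x x <= 1 -> `|h x| <= M.

Definition ES n (h : n.-tuple R -> R) : R :=
  \int[gaussM n]_x h (normalize x).

Lemma sbd_integrable n (h : n.-tuple R -> R) : sbd h ->
  (gaussM n).-integrable setT (fun x => (h (normalize x))%:E).
Proof.
move=> [mh [M hM]]; apply: measurable_bounded_integrable => //.
- by rewrite (le_lt_trans (probability_le1 _ measurableT))// ltry.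
- exact: (measurableT_comp mh (@measurable_normalizeT R n)).
exists M; split; first by rewrite num_real.
move=> x Mx y _; apply: le_trans (ltW Mx); apply: hM.
exact: normalize_le1.
Qed.

Lemma sbd_cst n (c : R) : sbd (fun _ : n.-tuple R => c).
Proof. by split; [exact: measurable_cst|exists `|c|]. Qed.

Lemma sbdD n (f g : n.-tuple R -> R) : sbd f -> sbd g -> sbd (fun x => f x + g x).
Proof.
move=> [mf [M fM]] [mg [N gN]]; split; first exact: measurable_funD.
exists (M + N) => x x1; rewrite (le_trans (ler_normD _ _))// lerD ?fM ?gN//.
Qed.

Lemma sbdM n (f g : n.-tuple R -> R) : sbd f -> sbd g -> sbd (fun x => f x * g x).
Proof.
move=> [mf [M fM]] [mg [N gN]]; split; first exact: measurable_funM.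
by exists (M * N) => x x1; rewrite normrM ler_pM// ?fM ?gN.
Qed.

Lemma sbdN n (f : n.-tuple R -> R) : sbd f -> sbd (fun x => - f x).
Proof.
move=> [mf [M fM]]; split; first exact: measurable_funN.
by exists M => x x1; rewrite normrN fM.
Qed.

Lemma sbd_sum n I (r : seq I) (f : I -> n.-tuple R -> R) :
  (forall i, sbd (f i)) -> sbd (fun x => \sum_(i <- r) f i x).
Proof.
move=> fb; elim: r => [|i r IH].
  rewrite (_ : (fun x => _) = fun=> 0); first exact: sbd_cst.
  by apply/funext => x; rewrite big_nil.
rewrite (_ : (fun x => _) = fun x => f i x + \sum_(j <- r) f j x).
  exact: sbdD.
by apply/funext => x; rewrite big_cons.
Qed.

Lemma sbd_prod n I (r : seq I) (P : pred I) (f : I -> n.-tuple R -> R) :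
  (forall i, sbd (f i)) -> sbd (fun x => \prod_(i <- r | P i) f i x).
Proof.
move=> fb; elim: r => [|i r IH].
  rewrite (_ : (fun x => _) = fun=> 1); first exact: sbd_cst.
  by apply/funext => x; rewrite big_nil.
rewrite (_ : (fun x => _) =
    fun x => if P i then f i x * \prod_(j <- r | P j) f j x
             else \prod_(j <- r | P j) f j x).
  by case: (P i) => //; exact: sbdM.
by apply/funext => x; rewrite big_cons.
Qed.

Lemma sbd_sqrt n (f : n.-tuple R -> R) : sbd f -> sbd (fun x => Num.sqrt (f x)).
Proof.
move=> [mf [M fM]]; split; first exact: measurable_sqrt_comp.
exists (Num.sqrt M) => x x1; rewrite ger0_norm ?sqrtr_ge0// ler_sqrt.
  by rewrite (le_trans (ler_norm _))// fM.
by rewrite (le_trans _ (fM _ x1)).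
Qed.

Lemma sbd_comp n (f : n.-tuple R -> R) (O : n.-tuple R -> n.-tuple R) :
  gauss_isom O -> sbd f -> sbd (fun x => f (O x)).
Proof.
move=> [mO _ dO _] [mf [M fM]]; split; first exact: (measurableT_comp mf).
by exists M => x x1; apply: fM; rewrite dO.
Qed.

Lemma sbd_inv n (f : n.-tuple R -> R) (m : R) : 0 < m ->
  (forall x, dotp x x <= 1 -> m <= f x) -> sbd f -> sbd (fun x => (f x)^-1).
Proof.
move=> m0 fm [mf _]; split; first exact: measurable_inv_comp.
exists m^-1 => x x1; have f0 := lt_le_trans m0 (fm _ x1).
rewrite ger0_norm; last by rewrite invr_ge0 ltW.
by rewrite lef_pV2 ?posrE// fm.
Qed.

Lemma sbd_poly n (p : {poly R}) (i : 'I_n) : sbd (fun x => p.[tnth x i]).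
Proof.
have [K _ pK] := bd1_exists p; split.
  apply: (measurableT_comp _ (measurable_tnth i)).
  by apply: continuous_measurable_fun; exact: continuous_horner.
exists K => x x1; apply: pK.
rewrite -(@ler_pXn2r _ 2)// ?nnegrE// expr1n real_normK ?num_real//.
exact: le_trans (tnth_sqr_le x i) x1.
Qed.

Lemma ESD n (f g : n.-tuple R -> R) : sbd f -> sbd g ->
  ES (fun x => f x + g x) = ES f + ES g.
Proof.
move=> bf bg; rewrite /ES.
exact: (RintegralD measurableT (sbd_integrable bf) (sbd_integrable bg)).
Qed.

Lemma ESZ n (c : R) (f : n.-tuple R -> R) : sbd f ->
  ES (fun x => c * f x) = c * ES f.
Proof.
move=> bf; rewrite /ES.
exact: (@RintegralZl _ _ _ (gaussM n) setT (fun x => f (normalize x)) c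
  measurableT (sbd_integrable bf)).
Qed.

Lemma ES_cst n (c : R) : ES (fun _ : n.-tuple R => c) = c.
Proof.
rewrite /ES Rintegral_cst//= probability_setT ?mulr1//.
Qed.

Lemma ESN n (f : n.-tuple R -> R) : sbd f -> ES (fun x => - f x) = - ES f.
Proof.
move=> bf; rewrite -mulN1r -ESZ//; congr ES.
by apply/funext => x; rewrite mulN1r.
Qed.

Lemma ES_le n (f g : n.-tuple R -> R) : sbd f -> sbd g ->
  (forall x, dotp x x <= 1 -> f x <= g x) -> ES f <= ES g.
Proof.
move=> bf bg fg; apply: le_Rintegral => //.
- exact: sbd_integrable.
- exact: sbd_integrable.
- by move=> x _; apply: fg; exact: normalize_le1.
Qed.

Lemma ES_sum n I (r : seq I) (f : I -> n.-tuple R -> R) :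
  (forall i, sbd (f i)) -> ES (fun x => \sum_(i <- r) f i x) = \sum_(i <- r) ES (f i).
Proof.
move=> fb; elim: r => [|i r IH].
  rewrite big_nil -[RHS](@ES_cst n 0); congr ES.
  by apply/funext => x; rewrite big_nil.
rewrite big_cons -IH -ESD//; last exact: sbd_sum.
by congr ES; apply/funext => x; rewrite big_cons.
Qed.

Lemma EFin_ES n (f : n.-tuple R -> R) : sbd f ->
  (ES f)%:E = (\int[gaussM n]_x (f (normalize x))%:E)%E.
Proof.
move=> bf; rewrite /ES /Rintegral fineK//.
by apply: integrable_fin_num => //; exact: sbd_integrable.
Qed.

Lemma ES_isom n (O : n.-tuple R -> n.-tuple R) (f : n.-tuple R -> R) :
  gauss_isom O -> sbd f -> ES (fun x => f (O x)) = ES f.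
Proof.
move=> gO bf; have [mf [M fM]] := bf.
(* Invariance is available for nonnegative integrands. Adding the bound achieves this on the ball,
   and the absolute value extends it to all vectors. *)
have shift (g : n.-tuple R -> R) : sbd g ->
    (forall x, dotp x x <= 1 -> `|g x| <= M) ->
    (ES g + M)%:E = (\int[gaussM n]_x `|g (normalize x) + M|%:E)%E.
  move=> bg gM; rewrite -[M in LHS](@ES_cst n) -ESD//; last exact: sbd_cst.
  rewrite EFin_ES; last by apply: sbdD => //; exact: sbd_cst.
  apply: eq_integral => x _; congr EFin; rewrite ger0_norm//.
  have := gM (normalize x) (normalize_le1 x); rewrite ler_norml => /andP[+ _].
  by rewrite -lerBlDr sub0r.
have [mO _ dO iO] := gO.
apply: (addIr M); apply: EFin_inj; rewrite !shift//; last 2 first.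
- exact: sbd_comp.
- by move=> x x1; apply: fM; rewrite dO.
have mF : measurable_fun setT (fun x : n.-tuple R => `|f (normalize x) + M|%:E).
  apply/measurable_EFinP; apply: measurableT_comp => //.
  apply: measurable_funD => //.
  exact: (measurableT_comp mf (@measurable_normalizeT R n)).
rewrite -(iO _ mF)//.
by apply: eq_integral => x _; rewrite (gauss_isom_normalize _ gO).
Qed.

Lemma ES_eq n (f g : n.+1.-tuple R -> R) : sbd f -> sbd g ->
  (forall x, dotp x x = 1 -> f x = g x) -> ES f = ES g.
Proof.
move=> bf bg fg; have [mf [M fM]] := bf; have [mg [N gN]] := bg.
pose K := Num.max M N.
have shift (h : n.+1.-tuple R -> R) : sbd h ->
    (forall x, dotp x x <= 1 -> `|h x| <= K) ->
    (ES h + K)%:E = (\int[sphM n.+1]_x `|h x + K|%:E)%E.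
  move=> bh hK; have [mh _] := bh.
  rewrite -[K in LHS](@ES_cst n.+1) -ESD//; last exact: sbd_cst.
  rewrite EFin_ES; last by apply: sbdD => //; exact: sbd_cst.
  rewrite integral_sphM//; last first.
    by apply/measurable_EFinP; apply: measurableT_comp => //; exact: measurable_funD.
  apply: eq_integral => x _; congr EFin; rewrite ger0_norm//.
  have := hK (normalize x) (normalize_le1 x); rewrite ler_norml => /andP[+ _].
  by rewrite -lerBlDr sub0r.
apply: (addIr K); apply: EFin_inj; rewrite !shift//; last 2 first.
- by move=> x x1; rewrite le_max gN ?orbT.
- by move=> x x1; rewrite le_max fM.
apply: eq_integral_sphM => //.
- by apply/measurable_EFinP; apply: measurableT_comp => //; exact: measurable_funD.
- by apply/measurable_EFinP; apply: measurableT_comp => //; exact: measurable_funD.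
by move=> x x1; rewrite fg.
Qed.

End SphereExpectation.

(** * Growth of the weight along the heat flow, to second order *)

Section Infinitesimal.
Context {R : realType}.
Variable m : nat.
Local Notation n := m.+1.
Implicit Types (u : 'I_n -> {poly R}) (x : n.-tuple R).

Definition ge_ball u (a : R) := forall i t, `|t| <= 1 -> a <= (u i).[t].

Definition geoW u x := \prod_(i < n) Num.sqrt (u i).[tnth x i].

Lemma coord_le1 x i : dotp x x <= 1 -> `|tnth x i| <= 1.
Proof.
move=> x1; rewrite -(@ler_pXn2r _ 2)// ?nnegrE// expr1n real_normK ?num_real//.
exact: le_trans (tnth_sqr_le x i) x1.
Qed.

Lemma sbd_geoW u : sbd (geoW u).
Proof. by apply: sbd_prod => i; apply: sbd_sqrt; exact: sbd_poly. Qed.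

Lemma geoW_ge0 u x : 0 <= geoW u x.
Proof. by apply: prodr_ge0 => i _; exact: sqrtr_ge0. Qed.

(* The contribution of rotations in the (i, j) plane to the Laplacian of p(x_i). *)
Definition lapij (p : {poly R}) (i j : 'I_n) x :=
  p^`()^`().[tnth x i] * tnth x j ^+ 2 - p^`().[tnth x i] * tnth x i.

Lemma sbd_coord (j : 'I_n) : sbd (fun x => tnth x j).
Proof.
rewrite (_ : (fun x => _) = fun x => ('X : {poly R}).[tnth x j]); first exact: sbd_poly.
by apply/funext => x; rewrite hornerX.
Qed.

Lemma sbd_lapij (p : {poly R}) i j : sbd (lapij p i j).
Proof.
rewrite /lapij; apply: sbdD.
  apply: sbdM; first exact: sbd_poly.
  by rewrite (_ : (fun x => _) = fun x => tnth x j * tnth x j); [apply: sbdM; exact: sbd_coord|apply/funext => x; rewrite expr2].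
by apply: sbdN; apply: sbdM; [exact: sbd_poly|exact: sbd_coord].
Qed.

Lemma sbd_quot (u : {poly R}) (a : R) i (f : n.-tuple R -> R) : 0 < a ->
  (forall t, `|t| <= 1 -> a <= u.[t]) -> sbd f ->
  sbd (fun x => f x / u.[tnth x i]).
Proof.
move=> a0 ua bf; apply: sbdM => //; apply: (sbd_inv a0); last exact: sbd_poly.
by move=> x x1; apply: ua; exact: coord_le1.
Qed.

(** Stands in for the limit e -> 0 in all the perturbation arguments below. *)
Lemma le_small (X Y : R) : 0 <= Y -> (forall e, 0 < e <= 1 -> 0 <= X + e * Y) -> 0 <= X.
Proof.
move=> Y0 h; rewrite leNgt; apply/negP => X0.
pose e := Num.min 1 (- X / (2 * (Y + 1))).
have Y1 : 0 < 2 * (Y + 1) by lra.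
have e0 : 0 < e by rewrite lt_min ltr01 divr_gt0// oppr_gt0.
have := h e; rewrite e0 ge_min lexx => /(_ isT).
have : e * (2 * (Y + 1)) <= - X.
  by rewrite -ler_pdivlMr// ge_min lexx orbT.
by move: e0; lra.
Qed.

(** AM-GM for the ratios a1 / a and b1 / b. The bound is linear in [a1] and [b1], so it can be
    averaged over the two rotations. *)
Lemma sqrt_pair_amgm (a b a1 b1 : R) : 0 < a -> 0 < b -> 0 <= a1 -> 0 <= b1 ->
  Num.sqrt a1 * Num.sqrt b1 <= Num.sqrt a * Num.sqrt b * ((a1 / a + b1 / b) / 2).
Proof.
move=> a0 b0 a10 b10.
have sa : 0 < Num.sqrt a by rewrite sqrtr_gt0.
have sb : 0 < Num.sqrt b by rewrite sqrtr_gt0.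
have ra := sqr_sqrtr (ltW a0); have rb := sqr_sqrtr (ltW b0).
have ra1 := sqr_sqrtr a10; have rb1 := sqr_sqrtr b10.
rewrite -ra -rb -{2}ra1 -{2}rb1 !sqrtr_sqr !(gtr0_norm sa) !(gtr0_norm sb).
move: (Num.sqrt a1) (Num.sqrt b1) (Num.sqrt a) (Num.sqrt b) sa sb => p q r s r0 s0.
rewrite -subr_ge0 (_ : _ - _ = r * s / 2 * (p / r - q / s) ^+ 2); last first.
  by field; rewrite !gt_eqF.
by rewrite mulr_ge0 ?sqr_ge0// divr_ge0// mulr_ge0 ?ltW.
Qed.

Section Pair.
Variables (u : 'I_n -> {poly R}) (a : R) (i j : 'I_n).
Hypotheses (a0 : 0 < a) (ua : ge_ball u a) (ij : i != j).

Let S x := lapij (u i) i j x / (u i).[tnth x i] + lapij (u j) j i x / (u j).[tnth x j].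

Lemma giv_coord (c e : R) x : c ^+ 2 + e ^+ 2 = 1 -> dotp x x <= 1 ->
  [/\ `|c * tnth x i - e * tnth x j| <= 1, `|e * tnth x i + c * tnth x j| <= 1,
      geoW u (giv i j c e x) =
        Num.sqrt (u i).[c * tnth x i - e * tnth x j] *
        Num.sqrt (u j).[e * tnth x i + c * tnth x j] *
        \prod_(k < n | (k != i) && (k != j)) Num.sqrt (u k).[tnth x k]
    & geoW u x = Num.sqrt (u i).[tnth x i] * Num.sqrt (u j).[tnth x j] *
        \prod_(k < n | (k != i) && (k != j)) Num.sqrt (u k).[tnth x k]].
Proof.
move=> ce x1; have gO := gauss_isom_giv ij ce; have [_ _ dO _] := gO.
have y1 : dotp (giv i j c e x) (giv i j c e x) <= 1 by rewrite dO.
have yi : tnth (giv i j c e x) i = c * tnth x i - e * tnth x j.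
  by rewrite tnth_mktuple eqxx.
have yj : tnth (giv i j c e x) j = e * tnth x i + c * tnth x j.
  by rewrite tnth_mktuple [j == i]eq_sym (negbTE ij) eqxx.
split; [by rewrite -yi coord_le1|by rewrite -yj coord_le1| |].
  rewrite /geoW (bigD1 i)//= (bigD1 j) 1?eq_sym//= mulrA yi yj.
  congr (_ * _); apply: eq_bigr => k /andP[ki kj].
  by rewrite tnth_mktuple (negbTE ki) (negbTE kj).
by rewrite /geoW (bigD1 i)//= (bigD1 j) 1?eq_sym//= mulrA.
Qed.

Lemma sbd_S : sbd S.
Proof.
apply: sbdD.
  exact: (@sbd_quot (u i) a i _ a0 (ua i) (sbd_lapij (u i) i j)).
exact: (@sbd_quot (u j) a j _ a0 (ua j) (sbd_lapij (u j) j i)).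
Qed.

(* The weight [geoW u] has the same mean after rotation by +-e in the (i, j)
   plane; expand to second order in e and use [sqrt_pair_amgm]. *)
Lemma pair_ge0 : 0 <= ES (fun x => geoW u x * S x).
Proof.
have [Ki Ki0 tKi] := two_point_exists (u i).
have [Kj Kj0 tKj] := two_point_exists (u j).
have bW := sbd_geoW u; have bS := sbd_S.
(* The mean of the two cubic errors, each divided by the lower bound [a] of the function it belongs
   to. *)
pose C := (Ki + Kj) / (2 * a).
have C0 : 0 <= C by rewrite divr_ge0 ?addr_ge0// mulr_ge0// ltW.
have EW0 : 0 <= ES (geoW u).
  by rewrite -(@ES_cst _ n 0) ES_le//; [exact: sbd_cst|move=> x _; exact: geoW_ge0].
apply: (@le_small _ (4 * C * ES (geoW u))) => [|e /andP[e0 e1]].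
  by rewrite mulr_ge0// mulr_ge0.
pose c := Num.sqrt (1 - e ^+ 2).
have ce : c ^+ 2 + e ^+ 2 = 1.
  rewrite sqr_sqrtr ?subrK// subr_ge0 expr_le1// ltW//.
have ceN : c ^+ 2 + (- e) ^+ 2 = 1 by rewrite sqrrN.
have e01 : 0 <= e <= 1 by rewrite ltW.
have main x : dotp x x <= 1 ->
    2^-1 * geoW u (giv i j c e x) + 2^-1 * geoW u (giv i j c (- e) x) <=
    geoW u x + (e ^+ 2 / 4 * (geoW u x * S x) + C * e ^+ 3 * geoW u x).
  move=> x1; have xi1 := coord_le1 i x1; have xj1 := coord_le1 j x1.
  have [pi pj Wp WE] := giv_coord ce x1.
  have [qi qj Wq _] := giv_coord ceN x1.
  rewrite Wp Wq WE; set P := \prod_(k < n | _) _.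
  have P0 : 0 <= P by apply: prodr_ge0 => k _; exact: sqrtr_ge0.
  set A := (u i).[tnth x i]; set B := (u j).[tnth x j].
  have A0 : a <= A by exact: ua.
  have B0 : a <= B by exact: ua.
  have Agt : 0 < A by exact: lt_le_trans A0.
  have Bgt : 0 < B by exact: lt_le_trans B0.
  have ge0u k t : `|t| <= 1 -> 0 <= (u k).[t].
    by move=> t1; rewrite (le_trans (ltW a0))// ua.
  have h1 := sqrt_pair_amgm Agt Bgt (ge0u i _ pi) (ge0u j _ pj).
  have h2 := sqrt_pair_amgm Agt Bgt (ge0u i _ qi) (ge0u j _ qj).
  have ti := tKi (tnth x i) (tnth x j) c e xi1 xj1 (sqrtr_ge0 _) e01 ce.
  have tj := tKj (tnth x j) (tnth x i) c e xj1 xi1 (sqrtr_ge0 _) e01 ce.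
  move: h1 h2 ti tj.
  rewrite mulNr opprK [- e * tnth x i + _]addrC mulNr [e * tnth x i + _]addrC.
  rewrite -/(lapij (u i) i j x) -/(lapij (u j) j i x) -/A -/B.
  set a1 := (u i).[_ - _]; set a2 := (u i).[_ + _].
  set b1 := (u j).[_ + _]; set b2 := (u j).[_ - _].
  move=> h1 h2 /(le_trans (ler_norm _)) ti /(le_trans (ler_norm _)) tj.
  pose W := Num.sqrt A * Num.sqrt B.
  have W0 : 0 <= W by rewrite mulr_ge0 ?sqrtr_ge0.
  have qa : (a1 + a2) / 2 / A <= 1 + e ^+ 2 / 2 * (lapij (u i) i j x / A) + Ki / a * e ^+ 3.
    rewrite ler_pdivrMr//.
    apply: (@le_trans _ _ (A + e ^+ 2 / 2 * lapij (u i) i j x + Ki * e ^+ 3)); first lra.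
    rewrite [leRHS](_ : _ = A + e ^+ 2 / 2 * lapij (u i) i j x +
      Ki * e ^+ 3 * (A / a)); last by field; rewrite !gt_eqF.
    rewrite lerD2l ler_peMr ?ler_pdivlMr ?mul1r//.
    by rewrite mulr_ge0// exprn_ge0// ltW.
  have qb : (b1 + b2) / 2 / B <= 1 + e ^+ 2 / 2 * (lapij (u j) j i x / B) + Kj / a * e ^+ 3.
    rewrite ler_pdivrMr//.
    apply: (@le_trans _ _ (B + e ^+ 2 / 2 * lapij (u j) j i x + Kj * e ^+ 3)); first lra.
    rewrite [leRHS](_ : _ = B + e ^+ 2 / 2 * lapij (u j) j i x +
      Kj * e ^+ 3 * (B / a)); last by field; rewrite !gt_eqF.
    rewrite lerD2l ler_peMr ?ler_pdivlMr ?mul1r//.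
    by rewrite mulr_ge0// exprn_ge0// ltW.
  have -> : W * P + (e ^+ 2 / 4 * (W * P * S x) + C * e ^+ 3 * (W * P)) =
     P * (W * (1 + e ^+ 2 / 4 * S x + C * e ^+ 3)) by ring.
  apply: (@le_trans _ _ (P * (W * (((a1 + a2) / 2 / A + (b1 + b2) / 2 / B) / 2)))).
    rewrite [leLHS](_ : _ = P * ((Num.sqrt a1 * Num.sqrt b1 + Num.sqrt a2 * Num.sqrt b2) / 2));
      last by field.
    rewrite ler_wpM2l// [leRHS](_ : _ = (W * ((a1 / A + b1 / B) / 2) +
      W * ((a2 / A + b2 / B) / 2)) / 2); last by field; rewrite !gt_eqF.
    by rewrite ler_pM2r ?invr_gt0// lerD.
  rewrite ler_wpM2l// ler_wpM2l//.
  rewrite /S -/A -/B (_ : C = (Ki / a + Kj / a) / 2); last first.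
    by rewrite /C; field; rewrite gt_eqF.
  lra.
have bg s : c ^+ 2 + s ^+ 2 = 1 -> sbd (fun x => geoW u (giv i j c s x)).
  by move=> cs; apply: sbd_comp => //; exact: gauss_isom_giv.
have bgZ (k : R) f : sbd f -> sbd (fun x : n.-tuple R => k * f x).
  by move=> bf; apply: sbdM => //; exact: sbd_cst.
have bWS : sbd (fun x => geoW u x * S x) by exact: sbdM.
have := ES_le (sbdD (bgZ _ _ (bg _ ce)) (bgZ _ _ (bg _ ceN)))
  (sbdD bW (sbdD (bgZ _ _ bWS) (bgZ _ _ bW))) main.
(* By invariance the left side is the mean of [geoW u], which cancels; dividing by e^2 / 4 leaves
   the form required by [le_small]. *)
rewrite !ESD ?ESZ ?(ES_isom (gauss_isom_giv ij ce)) ?(ES_isom (gauss_isom_giv ij ceN))//;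
  do ?[exact: bg|exact: bgZ|apply: bgZ|apply: sbdD|done].
set E := ES (geoW u); set X := ES _ => h.
rewrite -(pmulr_rge0 _ (_ : 0 < e ^+ 2 / 4)) ?divr_gt0 ?exprn_gt0//.
rewrite [leRHS](_ : _ = e ^+ 2 / 4 * X + C * e ^+ 3 * E); last by field.
lra.
Qed.

(** A mean does not change under rotation, so the second-order term of the expansion in the angle
    has mean 0. *)
Lemma ES_lapij0 (p : {poly R}) : ES (lapij p i j) = 0.
Proof.
have [K K0 tK] := two_point_exists p.
have bL := sbd_lapij p i j.
have bgZ (k : R) f : sbd f -> sbd (fun x : n.-tuple R => k * f x).
  by move=> bf; apply: sbdM => //; exact: sbd_cst.
have bp : sbd (fun x => p.[tnth x i]) by exact: sbd_poly.
suff [h1 h2] : (forall e, 0 < e <= 1 -> 0 <= ES (lapij p i j) + e * (2 * K)) /\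
    (forall e, 0 < e <= 1 -> 0 <= - ES (lapij p i j) + e * (2 * K)).
  have K20 : 0 <= 2 * K by rewrite mulr_ge0.
  by apply/eqP; rewrite eq_le -oppr_ge0 (le_small K20 h1) (le_small K20 h2).
apply/all_and2 => e; apply/all_and2 => /andP[e0 e1].
pose c := Num.sqrt (1 - e ^+ 2).
have ce : c ^+ 2 + e ^+ 2 = 1.
  by rewrite sqr_sqrtr ?subrK// subr_ge0 expr_le1// ltW.
have ceN : c ^+ 2 + (- e) ^+ 2 = 1 by rewrite sqrrN.
have e01 : 0 <= e <= 1 by rewrite ltW.
pose T x := 2^-1 * p.[tnth (giv i j c e x) i] + 2^-1 * p.[tnth (giv i j c (- e) x) i].
have bg s : c ^+ 2 + s ^+ 2 = 1 -> sbd (fun x => p.[tnth (giv i j c s x) i]).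
  move=> cs; apply: (@sbd_comp _ _ (fun x => p.[tnth x i])) => //.
  exact: gauss_isom_giv.
have bT : sbd T by apply: sbdD; apply: bgZ; exact: bg.
have ET : ES T = ES (fun x => p.[tnth x i]).
  rewrite ESD ?ESZ; do ?[exact: bg|apply: bgZ; exact: bg].
  rewrite (ES_isom (f := fun x => p.[tnth x i]) (gauss_isom_giv ij ce))//.
  rewrite (ES_isom (f := fun x => p.[tnth x i]) (gauss_isom_giv ij ceN))//.
  by field.
have TE x : dotp x x <= 1 ->
    `|T x - (p.[tnth x i] + e ^+ 2 / 2 * lapij p i j x)| <= K * e ^+ 3.
  move=> x1; have := tK (tnth x i) (tnth x j) c e (coord_le1 i x1) (coord_le1 j x1)
    (sqrtr_ge0 _) e01 ce.
  congr (`|_ - _| <= _); rewrite /T !tnth_mktuple eqxx mulNr opprK.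
  by field.
have e2 : 0 < e ^+ 2 / 2 by rewrite divr_gt0 ?exprn_gt0.
have bR k : sbd (fun x => p.[tnth x i] + (e ^+ 2 / 2 * lapij p i j x + k)).
  by apply: sbdD => //; apply: sbdD; [exact: bgZ|exact: sbd_cst].
have ER k : ES (fun x => p.[tnth x i] + (e ^+ 2 / 2 * lapij p i j x + k)) =
    ES (fun x => p.[tnth x i]) + (e ^+ 2 / 2 * ES (lapij p i j) + k).
  rewrite ESD//; last by apply: sbdD; [exact: bgZ|exact: sbd_cst].
  by rewrite ESD ?ESZ ?ES_cst//; [exact: bgZ|exact: sbd_cst].
split.
- have : ES T <= ES (fun x => p.[tnth x i] + (e ^+ 2 / 2 * lapij p i j x + K * e ^+ 3)).
    apply: ES_le => // x /TE /(le_trans (ler_norm _)); lra.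
  rewrite ET ER => h.
  rewrite -(pmulr_rge0 _ e2) [leRHS](_ : _ = e ^+ 2 / 2 * ES (lapij p i j) + K * e ^+ 3); first lra.
  by field.
- have : ES (fun x => p.[tnth x i] + (e ^+ 2 / 2 * lapij p i j x + - (K * e ^+ 3))) <= ES T.
    apply: ES_le => // x /TE; rewrite ler_norml => /andP[+ _]; lra.
  rewrite ET ER => h.
  rewrite -(pmulr_rge0 _ e2) [leRHS](_ : _ = - (e ^+ 2 / 2 * ES (lapij p i j)) + K * e ^+ 3); first lra.
  by field.
Qed.

End Pair.

(** On the sphere the other m coordinates have squares adding up to 1 - x_i^2. *)
Lemma sum_lapij (p : {poly R}) i x : dotp x x = 1 ->
  \sum_(j < n | j != i) lapij p i j x = (zlap m p).[tnth x i].
Proof.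
move=> x1; rewrite /lapij sumrB -mulr_sumr.
have -> : \sum_(j < n | j != i) tnth x j ^+ 2 = 1 - tnth x i ^+ 2.
  rewrite -x1 /dotp [in RHS](bigD1 i)//= -expr2 addrAC subrr add0r.
  by apply: eq_bigr => j _; rewrite expr2.
rewrite sumr_const cardC1 card_ord /= /zlap.
rewrite hornerD hornerN hornerZ !hornerM hornerD hornerN hornerXn hornerX.
rewrite -polyC1 hornerC -mulr_natl.
by ring.
Qed.

Lemma sbd_zlap (p : {poly R}) i : sbd (fun x => (zlap m p).[tnth x i]).
Proof. exact: sbd_poly. Qed.

Lemma ES_zlap0 (p : {poly R}) i : ES (fun x => (zlap m p).[tnth x i]) = 0.
Proof.
pose F j x := if j != i then lapij p i j x else 0.
have bF j : sbd (F j).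
  rewrite /F; case: (j != i); [exact: sbd_lapij|exact: sbd_cst].
transitivity (ES (fun x => \sum_(j < n) F j x)).
  apply: ES_eq; [exact: sbd_zlap|exact: sbd_sum|].
  by move=> x x1; rewrite -big_mkcond sum_lapij.
rewrite ES_sum// big1// => j _; rewrite /F.
have [_|ji] := eqVneq j i; first exact: ES_cst.
by rewrite -[RHS](@ES_lapij0 i j _ p)// eq_sym.
Qed.

(** Half of this mean is the time derivative of E [geoW u] along the heat flow. By [sum_lapij] it
    splits over ordered pairs, and joining (i, j) with (j, i) gives the terms of [pair_ge0]. *)
Lemma dissipation_ge0 (u : 'I_n -> {poly R}) a : 0 < a -> ge_ball u a ->
  0 <= ES (fun x => geoW u x * \sum_(i < n) (zlap m (u i)).[tnth x i] / (u i).[tnth x i]).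
Proof.
move=> a0 ua; have bW := sbd_geoW u.
pose Q i j x := lapij (u i) i j x / (u i).[tnth x i].
have bQ i j : sbd (Q i j).
  exact: (@sbd_quot (u i) a i _ a0 (ua i) (sbd_lapij (u i) i j)).
pose G i j x := if j != i then geoW u x * (Q i j x + Q j i x) else 0.
have bG i j : sbd (G i j).
  rewrite /G; case: (j != i); last exact: sbd_cst.
  by apply: sbdM => //; exact: sbdD.
have -> : ES (fun x => geoW u x * \sum_(i < n) (zlap m (u i)).[tnth x i] / (u i).[tnth x i]) =
    ES (fun x => 2^-1 * \sum_(i < n) \sum_(j < n) G i j x).
  apply: ES_eq.
  - apply: sbdM => //; apply: sbd_sum => i.
    exact: (@sbd_quot (u i) a i _ a0 (ua i) (sbd_zlap (u i) i)).
  - by apply: sbdM; [exact: sbd_cst|do 2 (apply: sbd_sum => ?)].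
  move=> x x1.
  have -> : \sum_(i < n) (zlap m (u i)).[tnth x i] / (u i).[tnth x i] =
      \sum_(i < n) \sum_(j < n | j != i) Q i j x.
    by apply: eq_bigr => i _; rewrite -sum_lapij// mulr_suml.
  have -> : \sum_(i < n) \sum_(j < n) G i j x =
      \sum_(i < n) \sum_(j < n | j != i) geoW u x * Q i j x +
      \sum_(i < n) \sum_(j < n | j != i) geoW u x * Q j i x.
    rewrite -big_split; apply: eq_bigr => i _ /=.
    rewrite -big_split [RHS]big_mkcond; apply: eq_bigr => j _ /=.
    by rewrite /G mulrDr.
  have -> : \sum_(i < n) \sum_(j < n | j != i) geoW u x * Q j i x =
      \sum_(i < n) \sum_(j < n | j != i) geoW u x * Q i j x.
    rewrite (exchange_big_dep xpredT)//=; apply: eq_bigr => i _.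
    by apply: eq_bigl => j; rewrite eq_sym.
  have -> : \sum_(i < n) \sum_(j < n | j != i) geoW u x * Q i j x =
      geoW u x * \sum_(i < n) \sum_(j < n | j != i) Q i j x.
    by rewrite mulr_sumr; apply: eq_bigr => i _; rewrite mulr_sumr.
  by field.
rewrite ESZ; last by do 2 (apply: sbd_sum => ?).
rewrite mulr_ge0// ES_sum; last by move=> i; apply: sbd_sum.
apply: sumr_ge0 => i _; rewrite ES_sum//; apply: sumr_ge0 => j _.
rewrite /G; have [_|ji] := eqVneq j i; first by rewrite ES_cst.
by apply: (pair_ge0 a0 ua); rewrite eq_sym.
Qed.

End Infinitesimal.

(** * Euler steps of the heat flow *)

Section DiscreteFlow.
Context {R : realType}.
Variable m : nat.
Hypothesis m_gt0 : (0 < m)%N.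
Local Notation n := m.+1.
Implicit Types (u : 'I_n -> {poly R}) (x : n.-tuple R) (p : {poly R}).

Lemma zlap_horner p t : (zlap m p).[t] =
  (1 - t ^+ 2) * p^`()^`().[t] - m%:R * (t * p^`().[t]).
Proof.
rewrite /zlap hornerD hornerN hornerZ !hornerM hornerD hornerN hornerXn hornerX.
by rewrite -polyC1 hornerC.
Qed.

Let m0 : 0 < m%:R :> R. Proof. by rewrite ltr0n. Qed.

(* Up to O(e^3) an Euler step of the heat flow is an average of two point values,
   so it nearly preserves lower bounds. *)
Lemma zlap_lower_step p (K a e t : R) : two_point p K ->
  (forall s, `|s| <= 1 -> a <= p.[s]) -> 0 <= e <= 1 -> `|t| <= 1 ->
  a - K * e ^+ 3 <= (p + (e ^+ 2 / (2 * m%:R)) *: zlap m p).[t].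
Proof.
move=> pK pa /andP[e0 e1] t1.
have t2 : 0 <= 1 - t ^+ 2.
  by rewrite subr_ge0 -(expr1n _ 2) -real_normK ?num_real// lerXn2r ?nnegrE.
have m1 : 1 <= m%:R :> R by rewrite ler1n.
(* With m y^2 = 1 - t^2 the second-order term of [two_point] becomes the Euler increment; since t^2
   + y^2 <= 1, both points stay in [-1, 1]. *)
pose y := Num.sqrt ((1 - t ^+ 2) / m%:R).
have y2 : y ^+ 2 = (1 - t ^+ 2) / m%:R by rewrite sqr_sqrtr// divr_ge0.
have y2le : y ^+ 2 <= 1 - t ^+ 2.
  by rewrite y2 ler_pdivrMr// ler_peMr.
have y0 : 0 <= y by exact: sqrtr_ge0.
have ty1 : t ^+ 2 + y ^+ 2 <= 1 by lra.
have y1 : `|y| <= 1.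
  rewrite ger0_norm// -(@ler_pXn2r _ 2)// ?nnegrE// expr1n.
  by have := sqr_ge0 t; lra.
pose c := Num.sqrt (1 - e ^+ 2).
have ce : c ^+ 2 + e ^+ 2 = 1.
  by rewrite sqr_sqrtr ?subrK// subr_ge0 expr_le1.
have e01 : 0 <= e <= 1 by rewrite e0.
have := pK t y c e t1 y1 (sqrtr_ge0 _) e01 ce.
have inball (s : R) : s ^+ 2 = e ^+ 2 -> `|c * t + s * y| <= 1.
  move=> se; rewrite -(@ler_pXn2r _ 2)// ?nnegrE// expr1n real_normK ?num_real//.
  apply: le_trans (_ : (c ^+ 2 + s ^+ 2) * (t ^+ 2 + y ^+ 2) <= 1).
    by have := sqr_ge0 (c * y - s * t); lra.
  by rewrite se ce mul1r.
have h1 : a <= p.[c * t + e * y] by apply: pa; exact: inball.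
have h2 : a <= p.[c * t - e * y].
  by apply: pa; rewrite -mulNr; apply: inball; rewrite sqrrN.
rewrite hornerD hornerZ zlap_horner => /(le_trans (ler_norm _)).
rewrite y2 (_ : e ^+ 2 / 2 * (p^`()^`().[t] * ((1 - t ^+ 2) / m%:R) - p^`().[t] * t) =
  e ^+ 2 / (2 * m%:R) * ((1 - t ^+ 2) * p^`()^`().[t] - m%:R * (t * p^`().[t]))).
  by lra.
by field; rewrite gt_eqF.
Qed.

(** The exponential form multiplies well. After squaring, exp w <= 1 / (1 - w) is used at w = z - 2
    z^2, where (1 + z) (1 - w) = 1 + z^2 (1 + 2 z). *)
Lemma sqrt1D_lower (z : R) : `|z| <= 2^-1 -> expR (z / 2 - z ^+ 2) <= Num.sqrt (1 + z).
Proof.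
rewrite ler_norml => /andP[z1 z2].
have z3 : 0 < 1 + z by lra.
rewrite -(@ler_pXn2r _ 2)// ?nnegrE ?expR_ge0 ?sqrtr_ge0// (sqr_sqrtr (ltW z3)).
rewrite -expRM_natl; set w := _ * _.
have wE : w = z - 2 * z ^+ 2 by rewrite /w; field.
have z20 : 0 <= z ^+ 2 by exact: sqr_ge0.
have z22 : z ^+ 2 <= 2^-1 * 2^-1.
  by rewrite -real_normK ?num_real// -expr2 lerXn2r ?nnegrE// ler_norml z1.
have w1 : 0 < 1 - w by rewrite wE; lra.
have -> : expR w = (expR (- w))^-1 by rewrite expRN invrK.
apply: (@le_trans _ _ (1 - w)^-1).
  by rewrite lef_pV2 ?posrE ?expR_gt0// expR_ge1Dx.
rewrite -[leLHS]mul1r ler_pdivrMr// wE.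
have : 0 <= z ^+ 2 * (1 + 2 * z) by rewrite mulr_ge0//; lra.
lra.
Qed.

Lemma prod_sqrt1D_lower (I : Type) (r : seq I) (z : I -> R) : (forall i, `|z i| <= 2^-1) ->
  1 + 2^-1 * \sum_(i <- r) z i - \sum_(i <- r) z i ^+ 2 <=
  \prod_(i <- r) Num.sqrt (1 + z i).
Proof.
move=> z1; apply: (@le_trans _ _ (expR (\sum_(i <- r) (z i / 2 - z i ^+ 2)))).
  rewrite sumrB -mulr_suml -addrA [2^-1 * _]mulrC; exact: expR_ge1Dx.
elim: r => [|i r IH]; first by rewrite !big_nil expR0.
by rewrite !big_cons expRD ler_pM ?expR_ge0// sqrt1D_lower.
Qed.

(** The step multiplies [geoW u] by a product of factors sqrt (1 + z_i). The part linear in z has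
    nonnegative mean by [dissipation_ge0]; the quadratic part is the loss of order h^2. *)
Lemma energy_step u (a B h : R) : 0 < a -> ge_ball u a -> 1 <= B -> 0 <= h ->
  h * B <= a / 2 ->
  (forall i, bd1 (u i) B) -> (forall i, bd1 (zlap m (u i)) B) ->
  ES (geoW u) - h ^+ 2 * (B ^+ n * (n%:R * (B / a) ^+ 2)) <=
  ES (geoW (fun i => u i + h *: zlap m (u i))).
Proof.
move=> a0 ua B1 h0 hB uB LB.
have B0 : 0 <= B by lra.
pose z i x := h * ((zlap m (u i)).[tnth x i] / (u i).[tnth x i]).
have bq i : sbd (fun x => (zlap m (u i)).[tnth x i] / (u i).[tnth x i]).
  exact: (@sbd_quot _ _ (u i) a i _ a0 (ua i) (sbd_zlap (u i) i)).
have bW := sbd_geoW u.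
pose S x := \sum_(i < n) (zlap m (u i)).[tnth x i] / (u i).[tnth x i].
have bS : sbd S by exact: sbd_sum.
pose C := B ^+ n * (n%:R * (B / a) ^+ 2).
have bl : sbd (fun x => geoW u x + (h / 2 * (geoW u x * S x) + - (h ^+ 2 * C))).
  apply: sbdD => //; apply: sbdD; last exact: sbd_cst.
  by apply: sbdM; [exact: sbd_cst|exact: sbdM].
apply: (@le_trans _ _ (ES (fun x =>
    geoW u x + (h / 2 * (geoW u x * S x) + - (h ^+ 2 * C))))).
  rewrite ESD// ?ESD ?ESZ ?ES_cst//; do ?[exact: sbd_cst|exact: sbdM|
    apply: sbdD|apply: sbdM].
  rewrite lerD2l lerDr mulr_ge0 ?divr_ge0//.
  exact: (dissipation_ge0 a0 ua).
apply: ES_le => //; first exact: sbd_geoW.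
move=> x x1; have xi i := coord_le1 i x1.
have upos i : a <= (u i).[tnth x i] by exact: ua.
have ugt i : 0 < (u i).[tnth x i] by exact: lt_le_trans (upos i).
have zle i : `|z i x| <= h * (B / a).
  rewrite /z normrM (ger0_norm h0) ler_wpM2l// normrM ler_pM//; first exact: LB.
  rewrite normrV ?unitfE ?gt_eqF// lef_pV2 ?posrE ?normr_gt0 ?gt_eqF//.
  by rewrite (le_trans (upos i))// ler_norm.
have hBa : h * (B / a) <= 2^-1.
  by rewrite mulrA ler_pdivrMr// [leRHS]mulrC.
have -> : geoW (fun i => u i + h *: zlap m (u i)) x =
    geoW u x * \prod_(i < n) Num.sqrt (1 + z i x).
  rewrite /geoW -big_split; apply: eq_bigr => i _ /=.
  rewrite -sqrtrM ?ltW//; congr Num.sqrt.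
  by rewrite hornerD hornerZ /z; field; rewrite gt_eqF.
apply: (@le_trans _ _ (geoW u x * (1 + 2^-1 * \sum_(i < n) z i x -
    \sum_(i < n) z i x ^+ 2))); last first.
  by rewrite ler_wpM2l ?geoW_ge0// prod_sqrt1D_lower// => i; exact: le_trans (zle i) hBa.
have SE : \sum_(i < n) z i x = h * S x by rewrite mulr_sumr.
have WB : geoW u x <= B ^+ n.
  rewrite -[in leRHS](card_ord n) -prodr_const; apply: ler_prod => i _.
  rewrite sqrtr_ge0 /=; apply: (@le_trans _ _ (Num.sqrt (B ^+ 2))).
    rewrite ler_sqrt ?sqr_ge0// (le_trans (ler_norm _))//.
    by rewrite (le_trans (uB i _ (xi i)))// expr2 ler_peMr.
  by rewrite sqrtr_sqr ger0_norm.
have Z2 : \sum_(i < n) z i x ^+ 2 <= n%:R * (h * (B / a)) ^+ 2.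
  apply: (@le_trans _ _ (\sum_(i < n) (h * (B / a)) ^+ 2)).
    apply: ler_sum => i _; rewrite -real_normK ?num_real// lerXn2r ?nnegrE//.
    by rewrite mulr_ge0// divr_ge0// ltW.
  by rewrite sumr_const card_ord mulr_natl.
have WZ : geoW u x * \sum_(i < n) z i x ^+ 2 <= h ^+ 2 * C.
  apply: (@le_trans _ _ (B ^+ n * (n%:R * (h * (B / a)) ^+ 2))).
    rewrite ler_pM ?geoW_ge0//; apply: sumr_ge0 => i _; exact: sqr_ge0.
  by rewrite /C le_eqVlt; apply/orP; left; apply/eqP; ring.
rewrite SE; move: WZ; set Z := \sum_(i < n) _ ^+ 2.
by rewrite mulrBr mulrDr mulr1; lra.
Qed.

(** One constant serves the whole flow, whose coefficients on the eigenpolynomials stay in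
    [-1, 1]. *)
Lemma comb_bounds (Q : nat -> {poly R}) (N : nat) : exists2 K : R, 0 <= K &
  forall cf : nat -> R, (forall k, (k < N)%N -> `|cf k| <= 1) ->
  [/\ two_point (\sum_(k < N) cf k *: Q k) K, bd1 (\sum_(k < N) cf k *: Q k) K &
      bd1 (zlap m (\sum_(k < N) cf k *: Q k)) K].
Proof.
elim: N => [|N [K K0 IH]].
  have [K1 K10 h1] := two_point_exists (0 : {poly R}).
  exists K1 => // cf _; rewrite big_ord0; split => //.
    by move=> t _; rewrite horner0 normr0.
  move=> t _; rewrite zlap_horner !deriv0 !horner0 !mulr0 subr0 normr0//.
have [K1 K10 h1] := two_point_exists (Q N).
have [K2 K20 h2] := bd1_exists (Q N).
have [K3 K30 h3] := bd1_exists (zlap m (Q N)).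
have mono2 (p : {poly R}) (k k' : R) : k <= k' -> two_point p k -> two_point p k'.
  move=> kk pk t y c e t1 y1 c0 e01 ce; apply: (le_trans (pk t y c e t1 y1 c0 e01 ce)).
  by rewrite ler_wpM2r// exprn_ge0//; case/andP: e01.
have mono1 (p : {poly R}) (k k' : R) : k <= k' -> bd1 p k -> bd1 p k'.
  by move=> kk pk t t1; exact: le_trans (pk t t1) kk.
exists (K + (K1 + K2 + K3)) => [|cf cf1]; first lra.
have [|i1 i2 i3] := IH cf; first by move=> k kN; apply: cf1; exact: leqW.
have cN := cf1 N (ltnSn N).
rewrite big_ord_recr /=; split.
- apply: mono2 (two_pointD i1 (two_pointZ cN h1)); lra.
- apply: mono1 (bd1D i2 (bd1Z cN h2)); lra.
- rewrite zlapD zlapZ; apply: mono1 (bd1D i3 (bd1Z cN h3)); lra.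
Qed.

(** A polynomial decay rate, enough to make the nonconstant modes O(1 / T) after time T. *)
Lemma one_sub_pow_le (y : R) (s : nat) : 0 <= y <= 1 ->
  (1 - y) ^+ s * (1 + s%:R * y) <= 1.
Proof.
move=> /andP[y0 y1]; elim: s => [|s IH]; first by rewrite mul0r addr0 mulr1.
apply: le_trans IH; rewrite exprSr -mulrA ler_wpM2l ?exprn_ge0 ?subr_ge0//.
rewrite -natr1; have : 0 <= (s%:R + 1) * y ^+ 2 by rewrite mulr_ge0 ?sqr_ge0// addr_ge0.
lra.
Qed.

End DiscreteFlow.

Section ProdSqrt.
Context {R : realType}.

Lemma pow1D_le (y : R) (k : nat) : 0 <= y -> exists2 C : R, 0 <= C &
  forall e, 0 <= e <= 1 -> (1 + e * y) ^+ k <= 1 + e * C.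
Proof.
move=> y0; elim: k => [|k [C C0 IH]]; first by exists 0 => // e _; rewrite mulr0 addr0.
exists (y + C + C * y) => [|e /andP[e0 e1]].
  by rewrite !addr_ge0// mulr_ge0.
rewrite exprS; apply: (@le_trans _ _ ((1 + e * y) * (1 + e * C))).
  by rewrite ler_wpM2l ?addr_ge0 ?mulr_ge0// IH ?e0.
have h : e * e * (C * y) <= e * (C * y).
  by rewrite ler_wpM2r ?mulr_ge0// ler_piMl.
lra.
Qed.

(** Factor by factor, sqrt (c + eta) <= sqrt c (1 + eta / a) because c >= a. *)
Lemma prod_sqrtD_le n (c : 'I_n -> R) (a : R) : 0 < a -> (forall i, a <= c i) ->
  exists2 C : R, 0 <= C & forall eta, 0 <= eta <= 1 ->
  \prod_(i < n) Num.sqrt (c i + eta) <= \prod_(i < n) Num.sqrt (c i) * (1 + eta * C).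
Proof.
move=> a0 ac; have a1 : 0 <= a^-1 by rewrite invr_ge0 ltW.
have [C C0 powC] := pow1D_le n a1; exists C => // eta /andP[eta0 eta1].
have c0 i : 0 < c i by exact: lt_le_trans (ac i).
set P := \prod_(i < n) Num.sqrt (c i).
have P0 : 0 <= P by apply: prodr_ge0 => i _; exact: sqrtr_ge0.
apply: (@le_trans _ _ (P * (1 + eta * a^-1) ^+ n)); last first.
  by rewrite ler_wpM2l// powC// eta1 eta0.
rewrite -[in leRHS](card_ord n) -prodr_const -big_split.
apply: ler_prod => i _; rewrite sqrtr_ge0/=.
have y0 : 0 <= 1 + eta * a^-1 by rewrite addr_ge0// mulr_ge0.
rewrite -[X in _ <= _ * X](ger0_norm y0) -sqrtr_sqr -sqrtrM ?(ltW (c0 i))//.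
apply: ler_wsqrtr; have ea : eta <= c i * (eta * a^-1).
  rewrite mulrCA -[leLHS]mulr1 ler_wpM2l//.
  by rewrite ler_pdivlMr// mul1r.
have : 0 <= c i * (eta * a^-1) ^+ 2 by rewrite mulr_ge0 ?sqr_ge0// ltW.
by move: ea eta0; move: (eta * _) => z; lra.
Qed.

End ProdSqrt.

(** * Carlen-Lieb-Loss for polynomials *)

Section CLLPoly.
Context {R : realType}.
Variable m : nat.
Hypothesis m_gt0 : (0 < m)%N.
Local Notation n := m.+1.
Implicit Types (u : 'I_n -> {poly R}) (x : n.-tuple R).

(* The heat flow increases E prod sqrt u_i, by [dissipation_ge0], and drives each
   u_i to its mean. *)
Lemma cll_poly u (a : R) : 0 < a -> ge_ball u a ->
  ES (geoW u) <= \prod_(i < n) Num.sqrt (ES (fun x => (u i).[tnth x i])).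
Proof.
move=> a0 ua.
have [N1 sN0] : exists N1, forall i, (size (u i) <= N1.+1)%N.
  exists (\max_(i < n) size (u i)) => i.
  by rewrite leqW// (leq_bigmax (F := fun i => size (u i)) i).
have [Q QP] := fin_all_exists (fun i => eigen_decomposition m_gt0 (sN0 i)).
have uE i : u i = \sum_(k < N1.+1) Q i k by have [] := QP i.
have QL i k : (k < N1.+1)%N -> zlap m (Q i k) = - @eigv R m k *: Q i k.
  by move=> kN; have [_ /(_ k kN)[]] := QP i.
have Q0 i : (size (Q i 0%N) <= 1)%N by have [_ /(_ 0%N isT)[]] := QP i.
have [K K0 QK] : exists2 K : R, 0 <= K & forall i (cf : nat -> R),
    (forall k, (k < N1.+1)%N -> `|cf k| <= 1) ->
    [/\ two_point (\sum_(k < N1.+1) cf k *: Q i k) K, bd1 (\sum_(k < N1.+1) cf k *: Q i k) K &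
      bd1 (zlap m (\sum_(k < N1.+1) cf k *: Q i k)) K].
  have cb i : exists K : R, 0 <= K /\ forall (cf : nat -> R),
    (forall k, (k < N1.+1)%N -> `|cf k| <= 1) ->
    [/\ two_point (\sum_(k < N1.+1) cf k *: Q i k) K, bd1 (\sum_(k < N1.+1) cf k *: Q i k) K &
      bd1 (zlap m (\sum_(k < N1.+1) cf k *: Q i k)) K].
    by have [K K0 h] := comb_bounds m (Q i) N1.+1; exists K.
  have [K KP] := fin_all_exists cb.
  exists (\sum_i K i); first by apply: sumr_ge0 => i _; have [] := KP i.
  move=> i cf cf1; have [_ /(_ cf cf1)[h1 h2 h3]] := KP i.
  have Kle : K i <= \sum_i K i.
    by rewrite (bigD1 i)//= lerDl; apply: sumr_ge0 => j _; have [] := KP j.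
  split.
  - move=> t y c e t1 y1 c0 e01 ce; apply: (le_trans (h1 t y c e t1 y1 c0 e01 ce)).
    by rewrite ler_wpM2r// exprn_ge0//; case/andP: e01.
  - by move=> t t1; exact: le_trans (h2 t t1) Kle.
  - by move=> t t1; exact: le_trans (h3 t t1) Kle.
pose c i := (Q i 0%N)`_0.
have cE i t : (Q i 0%N).[t] = c i by rewrite /c [in LHS](size1_polyC (Q0 i)) hornerC.
(* The nonconstant modes have mean 0: [zlap] multiplies them by a nonzero number and its values have
   mean 0. *)
have ESQ i : ES (fun x => (u i).[tnth x i]) = c i.
  transitivity (ES (fun x => \sum_(k < N1.+1) (Q i k).[tnth x i])).
    by congr ES; apply/funext => x; rewrite uE horner_sum.
  rewrite ES_sum => [|k]; last exact: sbd_poly.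
  rewrite big_ord_recl big1 ?addr0 => [|k _].
    by rewrite -[RHS](@ES_cst _ n); congr ES; apply/funext => x; rewrite cE.
  have kN : (lift ord0 k < N1.+1)%N by [].
  have l0 : @eigv R m (lift ord0 k) != 0.
    by rewrite gt_eqF// (lt_le_trans ltr01)// eigv_ge1.
  apply: (mulfI l0); rewrite mulr0 -ESZ; last exact: sbd_poly.
  apply: oppr_inj; rewrite oppr0 -ESN; last by apply: sbdM; [exact: sbd_cst|exact: sbd_poly].
  rewrite -(ES_zlap0 (Q i (lift ord0 k)) i); congr ES; apply/funext => x.
  by rewrite QL// hornerZ mulNr.
have ca i : a <= c i.
  rewrite -ESQ -[leLHS](@ES_cst _ n); apply: ES_le => [||x x1]; first exact: sbd_cst.
    exact: sbd_poly.
  by apply: ua; exact: coord_le1.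
have c0 i : 0 < c i by exact: lt_le_trans (ca i).
under eq_bigr do rewrite ESQ.
pose B := Num.max 1 K.
have B1 : 1 <= B by rewrite le_max lexx.
have KB : K <= B by rewrite le_max lexx orbT.
pose lm := \sum_(k < N1.+1) @eigv R m k.
have lmk k : (k < N1.+1)%N -> @eigv R m k <= lm.
  move=> kN; rewrite /lm (bigD1 (Ordinal kN))//= lerDl.
  by apply: sumr_ge0 => j _; exact: eigv_ge0.
have lm0 : 0 <= lm by apply: sumr_ge0 => j _; exact: eigv_ge0.
have m0 : 0 < m%:R :> R by rewrite ltr0n.
(* The constant of [energy_step] for the lower bound [a / 2], which is kept during the whole
   flow. *)
pose C := B ^+ n * (n%:R * (B / (a / 2)) ^+ 2).
have B0 : 0 <= B by lra.
have C0 : 0 <= C.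
  by apply: mulr_ge0; [exact: exprn_ge0|apply: mulr_ge0 => //; exact: sqr_ge0].
have a2 : 0 < a / 2 by rewrite divr_gt0.
(* [T] is the total time, [s] the number of Euler steps. *)
have run (T : R) (s : nat) (h e : R) : 0 < h -> s%:R * h = T -> 0 < T ->
    h * lm <= 1 -> 0 <= e <= 1 -> e ^+ 2 = 2 * m%:R * h ->
    s%:R * (K * e ^+ 3) <= a / 2 -> h * B <= a / 2 / 2 ->
    ES (geoW u) <= \prod_(i < n) Num.sqrt (c i + K / T) + T * h * C.
  move=> h0 shT T0 hlm e01 e2 sK hB.
  (* An Euler step multiplies the k-th mode by 1 - h [eigv k]. *)
  pose cf r k := (1 - h * @eigv R m k) ^+ r.
  have hl k : (k < N1.+1)%N -> 0 <= h * @eigv R m k <= 1.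
    move=> kN; rewrite mulr_ge0 ?(ltW h0) ?eigv_ge0//=.
    by apply: le_trans hlm; rewrite ler_wpM2l ?lmk// ltW.
  have cf1 r k : (k < N1.+1)%N -> `|cf r k| <= 1.
    move=> kN; have /andP[l0 l1] := hl k kN.
    by rewrite normrX exprn_ile1// ger0_norm; lra.
  pose fl r i := \sum_(k < N1.+1) cf r k *: Q i k.
  have flS r i : fl r.+1 i = fl r i + h *: zlap m (fl r i).
    rewrite /fl zlap_sum scaler_sumr -big_split; apply: eq_bigr => k _ /=.
    rewrite zlapZ QL// !scalerA -scalerDl; congr (_ *: _).
    by rewrite /cf exprS; ring.
  have fl0 i : fl 0%N i = u i.
    by rewrite uE; apply: eq_bigr => k _; rewrite /cf expr0 scale1r.
  have e0 : 0 <= e by case/andP: e01.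
  have Ke0 : 0 <= K * e ^+ 3 by rewrite mulr_ge0// exprn_ge0.
  have pos r : ge_ball (fl r) (a - r%:R * (K * e ^+ 3)).
    elim: r => [|r IH] i t t1; first by rewrite mul0r subr0 fl0 ua.
    rewrite flS (_ : h = e ^+ 2 / (2 * m%:R)); last first.
      by rewrite e2; field; rewrite gt_eqF.
    have [tp _ _] := QK i (cf r) (cf1 r).
    rewrite (le_trans _ (zlap_lower_step m_gt0 tp (IH i) e01 t1))//.
    by rewrite -natr1 mulrDl mul1r; lra.
  have pos2 r : (r <= s)%N -> ge_ball (fl r) (a / 2).
    move=> rs i t t1; apply: le_trans (pos r i t t1).
    have : r%:R * (K * e ^+ 3) <= s%:R * (K * e ^+ 3).
      by rewrite ler_wpM2r// ler_nat.
    lra.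
  have en r : (r <= s)%N -> ES (geoW u) <= ES (geoW (fl r)) + r%:R * (h ^+ 2 * C).
    elim: r => [_|r IH rs].
      rewrite mul0r addr0 le_eqVlt; apply/orP; left; apply/eqP; congr ES.
      by apply/funext => x; apply: eq_bigr => i _; rewrite fl0.
    have bnd i : bd1 (fl r i) B /\ bd1 (zlap m (fl r i)) B.
      have [_ h1 h2] := QK i (cf r) (cf1 r).
      by split=> t t1; [exact: le_trans (h1 t t1) KB|exact: le_trans (h2 t t1) KB].
    have := energy_step a2 (pos2 r (ltnW rs)) B1 (ltW h0) hB
      (fun i => (bnd i).1) (fun i => (bnd i).2).
    rewrite -/C; have -> : geoW (fun i => fl r i + h *: zlap m (fl r i)) = geoW (fl r.+1).
      by apply/funext => x; apply: eq_bigr => i _; rewrite flS.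
    by have := IH (ltnW rs); rewrite -natr1 mulrDl mul1r; lra.
  apply: (le_trans (en s (leqnn s))).
  have -> : s%:R * (h ^+ 2 * C) = T * h * C by rewrite -shT; ring.
  rewrite lerD2r.
  have up i t : `|t| <= 1 -> (fl s i).[t] <= c i + K / T.
    move=> t1; rewrite -(cE i t) /fl big_ord_recl hornerD hornerZ.
    rewrite {1}/cf (_ : @eigv R m (ord0 : 'I_N1.+1) = 0) ?mulr0 ?subr0 ?expr1n ?mul1r; last first.
      by rewrite /eigv mul0r.
    rewrite lerD2l.
    (* T times a remaining coefficient is still at most 1, because T = s h <= s h [eigv k] for k >=
       1; so [QK] bounds T ([fl s i] - [c i]) by K. The constant mode is removed by the coefficient
       0. *)
    pose cg (k : nat) : R := if k is 0%N then 0 else T * cf s k.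
    have cg1 k : (k < N1.+1)%N -> `|cg k| <= 1.
      case: k => [|k] kN; first by rewrite normr0.
      have /andP[l0 l1] := hl _ kN.
      have := one_sub_pow_le s (hl _ kN); rewrite -/(cf s k.+1) => hc.
      have cf0 : 0 <= cf s k.+1 by rewrite exprn_ge0// subr_ge0.
      rewrite /cg ger0_norm ?mulr_ge0 ?(ltW T0)//; apply: le_trans hc.
      rewrite mulrC ler_wpM2l// -shT mulrA ler_wpDl// ler_peMr ?mulr_ge0 ?(ltW h0)//.
      exact: eigv_ge1.
    have [_ cgK _] := QK i cg cg1.
    have := cgK t t1; rewrite big_ord_recl /= scale0r add0r.
    rewrite ler_pdivlMr// => /(le_trans (ler_norm _)) h1.
    rewrite (le_trans _ h1)// le_eqVlt; apply/orP; left; apply/eqP.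
    rewrite !horner_sum mulr_suml; apply: eq_bigr => k _.
    by rewrite !hornerZ /=; ring.
  rewrite -[leRHS](@ES_cst _ n); apply: ES_le; [exact: sbd_geoW|exact: sbd_cst|].
  move=> x x1; apply: ler_prod => i _; rewrite sqrtr_ge0/=.
  by rewrite ler_wsqrtr// up// coord_le1.
set P := \prod_(i < n) Num.sqrt (c i).
have P0 : 0 <= P by apply: prodr_ge0 => i _; exact: sqrtr_ge0.
have [C' C'0 prodC] := prod_sqrtD_le a0 ca.
rewrite -subr_ge0; apply: (@le_small _ _ (P * C' + 1)) => [|eta /andP[eta0 eta1]].
  by rewrite addr_ge0// mulr_ge0.
pose T := K / eta + 1.
have T0 : 0 < T by apply: ltr_wpDl => //; exact: divr_ge0 K0 (ltW eta0).
have KT : K / T <= eta.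
  by rewrite ler_pdivrMr// /T mulrDr mulr1 mulrCA divff ?gt_eqF// mulr1 lerDl ltW.
(* The total loss of the lower bound is s K e^3 = 2 m T K e, hence at most a / 2 as soon as e <=
   w. *)
pose w := a / 2 / (2 * m%:R * T * K + 1).
have T0' := ltW T0.
have mTK : 0 <= 2 * m%:R * T * K by rewrite !mulr_ge0.
have w0 : 0 < w by rewrite divr_gt0// ltr_wpDl.
have a4 : 0 < a / 2 / 2 by rewrite divr_gt0.
have w2 : 0 < w ^+ 2 by rewrite exprn_gt0.
have q1 : 0 <= T * lm / 1 by rewrite divr_ge0// mulr_ge0.
have q2 : 0 <= T * (2 * m%:R) / 1 by rewrite divr_ge0// !mulr_ge0.
have q3 : 0 <= T * (2 * m%:R) / w ^+ 2.
  by rewrite divr_ge0 ?sqr_ge0// !mulr_ge0.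
have q4 : 0 <= T * B / (a / 2 / 2) by rewrite divr_ge0 ?(ltW a4)// mulr_ge0.
have q5 : 0 <= T * (T * C) / eta.
  by apply: (divr_ge0 _ (ltW eta0)); exact: mulr_ge0 T0' (mulr_ge0 T0' C0).
(* A bound T Y / z <= S becomes h Y <= z once there are more than S steps. In order, the five bounds
   give [h * lm <= 1], [e <= 1], [e <= w], [h * B <= a / 2 / 2] and [T * h * C <= eta]. *)
have [S [S0 [S1 S2] [S3 S4 S5]]] : exists S, [/\ 0 <= S, T * lm / 1 <= S /\ T * (2 * m%:R) / 1 <= S &
    [/\ T * (2 * m%:R) / w ^+ 2 <= S, T * B / (a / 2 / 2) <= S & T * (T * C) / eta <= S]].
  move: q1 q2 q3 q4 q5; move: (_ / 1) (_ / 1) (_ / w ^+ 2) (_ / (a / 2 / 2)) (_ / eta).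
  move=> z1 z2 z3 z4 z5 h1 h2 h3 h4 h5; exists (z1 + z2 + z3 + z4 + z5).
  clear -h1 h2 h3 h4 h5.
  by split; [|split|split]; lra.
have sS := archi_boundP S0; set s := Num.bound S in sS.
have s0 : 0 < s%:R :> R by exact: le_lt_trans sS.
pose h := T / s%:R.
have h0 : 0 < h by rewrite divr_gt0.
have hle Y z : 0 < z -> T * Y / z <= S -> h * Y <= z.
  move=> z0 YS; rewrite /h mulrAC ler_pdivrMr// [leRHS]mulrC -ler_pdivrMr//.
  exact: le_trans YS (ltW sS).
have h20 : 0 <= 2 * m%:R * h by rewrite !mulr_ge0 ?(ltW h0).
pose e := Num.sqrt (2 * m%:R * h).
have e2 : e ^+ 2 = 2 * m%:R * h by rewrite sqr_sqrtr.
have e0 : 0 <= e by exact: sqrtr_ge0.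
have le_e z : 0 < z -> T * (2 * m%:R) / z ^+ 2 <= S -> e <= z.
  move=> z0 zS; rewrite -(@ler_pXn2r _ 2)// ?nnegrE ?(ltW z0)// e2 mulrC.
  by apply: hle => //; rewrite exprn_gt0.
have e1 : e <= 1 by apply: le_e => //; rewrite expr1n.
have ew : e <= w by exact: le_e.
have shT : s%:R * h = T by rewrite /h mulrC divfK// gt_eqF.
have := run T s h e h0 shT T0 _ _ e2 _ _.
have -> : h * lm <= 1 by exact: hle.
have -> : h * B <= a / 2 / 2 by exact: hle.
rewrite e0 e1.
have -> : s%:R * (K * e ^+ 3) <= a / 2.
  have -> : s%:R * (K * e ^+ 3) = 2 * m%:R * T * K * e.
    by rewrite exprSr e2 -shT; ring.
  apply: (@le_trans _ _ ((2 * m%:R * T * K + 1) * w)).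
    by rewrite ler_pM// lerDl.
  by rewrite /w mulrC divfK// gt_eqF// ltr_wpDl.
move=> /(_ isT isT isT isT) run1.
have hC : T * h * C <= eta.
  rewrite (_ : T * h * C = h * (T * C)); last by ring.
  exact: hle.
have prodle : \prod_(i < n) Num.sqrt (c i + K / T) <= P * (1 + eta * C').
  apply: le_trans (prodC eta _); last by rewrite eta1 ltW.
  by apply: ler_prod => i _; rewrite sqrtr_ge0 ler_wsqrtr// lerD2l.
by move: run1 hC prodle; lra.
Qed.
End CLLPoly.

(** * Uniform approximation by Bernstein polynomials *)

Section Bernstein.
Context {R : realType}.

(* The Bernstein polynomial of degree [n] on [-1, 1] with nodal values [f]: the
   expectation of [f] at a binomial variable with success probability (1 + X) / 2. *)
Fixpoint bern (n : nat) (f : nat -> R) : {poly R} :=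
  if n is n'.+1 then (2^-1)%:P * (1 + 'X) * bern n' (fun k => f k.+1) +
    (2^-1)%:P * (1 - 'X) * bern n' f
  else (f 0%N)%:P.

Lemma hornerBernS n f t : (bern n.+1 f).[t] =
  2^-1 * (1 + t) * (bern n (fun k => f k.+1)).[t] + 2^-1 * (1 - t) * (bern n f).[t].
Proof. by rewrite /= !hornerE. Qed.

Lemma bern_le n f g t : `|t| <= 1 -> (forall k, (k <= n)%N -> f k <= g k) ->
  (bern n f).[t] <= (bern n g).[t].
Proof.
rewrite ler_norml => /andP[t0 t1].
elim: n f g => [|n IH] f g fg; first by rewrite /= !hornerC; exact: fg.
rewrite !hornerBernS; apply: lerD; apply: ler_wpM2l; do ?lra; apply: IH => k kn; apply: fg => //.
exact: leqW.
Qed.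

Lemma bern_affine n f g (a b c : R) t :
  (bern n (fun k => a + b * f k + c * g k)).[t] = a + b * (bern n f).[t] + c * (bern n g).[t].
Proof.
elim: n f g => [|n IH] f g; first by rewrite /= !hornerC.
by rewrite !hornerBernS !IH; field.
Qed.

(** The second moment about z of a binomial variable: its variance plus the squared bias. *)
Lemma bern_variance n (z t : R) : (bern n (fun k => (k%:R - z) ^+ 2)).[t] =
  n%:R * (1 - t ^+ 2) / 4 + (n%:R * (1 + t) / 2 - z) ^+ 2.
Proof.
elim: n z => [|n IH] z; first by rewrite /= hornerC; field.
rewrite hornerBernS IH; have -> : (fun k => (k.+1%:R - z) ^+ 2) = fun k => (k%:R - (z - 1)) ^+ 2.
  by apply/funext => k; rewrite -natr1; congr (_ ^+ 2); ring.
by rewrite IH -natr1; field.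
Qed.

Lemma lipschitz_poly (h : R -> R) (L e : R) : 0 <= L -> 0 < e ->
  (forall s t, `|s| <= 1 -> `|t| <= 1 -> `|h s - h t| <= L * `|s - t|) ->
  exists p : {poly R}, forall t, `|t| <= 1 -> `|p.[t] - h t| <= e.
Proof.
move=> L0 e0 hL.
(* With N > 1 / w^2 the final error is at most 2 L w, which is below e. *)
pose w := e / (2 * (L + 1)).
have L1 : 0 < L + 1 by lra.
have L1' : 0 < 2 * (L + 1) by lra.
have w0 : 0 < w by exact: divr_gt0.
have b0 : 0 <= (w ^+ 2)^-1 by rewrite invr_ge0 sqr_ge0.
have := archi_boundP b0; set N := Num.bound _ => hN.
have N0 : 0 < N%:R :> R by exact: le_lt_trans hN.
pose node k : R := 2 * k%:R / N%:R - 1.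
exists (bern N (fun k => h (node k))) => t t1.
pose var (k : nat) : R := (k%:R - N%:R * (1 + t) / 2) ^+ 2.
pose A := L * (4 / N%:R ^+ 2 / w).
(* The inequality |y| <= w + y^2 / w replaces the Lipschitz bound by a quadratic one, whose
   Bernstein average is a variance. *)
have bnd k : (k <= N)%N -> `|h (node k) - h t| <= L * w + A * var k.
  move=> kN; have k1 : `|node k| <= 1.
    have h0 : 0 <= 2 * k%:R / N%:R :> R by rewrite divr_ge0// mulr_ge0.
    have h2 : 2 * k%:R / N%:R <= 2 :> R by rewrite ler_pdivrMr// ler_pM2l// ler_nat.
    by rewrite ler_norml /node; move: h0 h2; move: (_ / _) => y; lra.
  apply: le_trans (hL _ _ k1 t1) _.
  rewrite (_ : L * w + A * var k = L * (w + (node k - t) ^+ 2 / w)); last first.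
    by rewrite /A /var /node; field; rewrite !gt_eqF.
  rewrite ler_wpM2l// -[(node k - t) ^+ 2]real_normK ?num_real//.
  move: (normr_ge0 (node k - t)); move: `|_| => y y0.
  have [yw|wy] := leP y w; first by rewrite ler_wpDr// divr_ge0 ?sqr_ge0// ltW.
  rewrite ler_wpDl ?(ltW w0)// ler_pdivlMr// expr2.
  by apply: ler_wpM2l => //; exact: ltW.
have step : `|(bern N (fun k => h (node k))).[t] - h t| <= L * w + A * (bern N var).[t].
  rewrite ler_norml; apply/andP; split.
  - have := @bern_le N (fun k => (h t - L * w) + (- A) * var k + 0 * var k) (fun k => h (node k)) t t1.
    rewrite bern_affine => hh.
    have /hh : forall k, (k <= N)%N -> h t - L * w + - A * var k + 0 * var k <= h (node k).
      by move=> i /bnd; rewrite ler_norml => /andP[]; lra.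
    by rewrite mul0r addr0; lra.
  - have := @bern_le N (fun k => h (node k)) (fun k => (h t + L * w) + A * var k + 0 * var k) t t1.
    rewrite bern_affine => hh.
    have /hh : forall k, (k <= N)%N -> h (node k) <= h t + L * w + A * var k + 0 * var k.
      by move=> i /bnd; rewrite ler_norml => /andP[_]; lra.
    by rewrite mul0r addr0; lra.
apply: le_trans step _; rewrite bern_variance subrr expr0n addr0.
have -> : A * (N%:R * (1 - t ^+ 2) / 4) = L * ((1 - t ^+ 2) / (N%:R * w)).
  by rewrite /A; field; rewrite !gt_eqF.
have hw : (1 - t ^+ 2) / (N%:R * w) <= w.
  rewrite (ler_pdivrMr _ _ (mulr_gt0 N0 w0)).
  apply: (@le_trans _ _ (1 : R)).
    by have := sqr_ge0 t; lra.
  have -> : w * (N%:R * w) = N%:R * w ^+ 2 by ring.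
  by rewrite -ler_pdivrMr ?exprn_gt0// mul1r ltW.
have : L * ((1 - t ^+ 2) / (N%:R * w)) <= L * w by rewrite ler_wpM2l.
have : w * (2 * (L + 1)) = e by rewrite /w divfK// gt_eqF// mulr_gt0.
by move: w0; move: (_ / (_ * w)) => z; lra.
Qed.

End Bernstein.

(** * Carlen-Lieb-Loss for Lipschitz functions *)

Section CLLLipschitz.
Context {R : realType}.
Variable m : nat.
Hypothesis m_gt0 : (0 < m)%N.
Local Notation n := m.+1.
Implicit Types (h : 'I_n -> R -> R) (x : n.-tuple R).

Definition geoH h x := \prod_(i < n) Num.sqrt (h i (tnth x i)).

Lemma sbd_coord_fun (g : R -> R) (i : 'I_n) M : measurable_fun setT g ->
  (forall t, `|t| <= 1 -> `|g t| <= M) -> sbd (fun x => g (tnth x i)).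
Proof.
move=> mg gM; split; first exact: (measurableT_comp mg (measurable_tnth i)).
by exists M => x x1; apply: gM; exact: coord_le1.
Qed.

Lemma sbd_geoH h M : (forall i, measurable_fun setT (h i)) ->
  (forall i t, `|t| <= 1 -> `|h i t| <= M) -> sbd (geoH h).
Proof.
move=> mh hM; apply: sbd_prod => i; apply: sbd_sqrt.
exact: (sbd_coord_fun i (mh i) (hM i)).
Qed.

Lemma cll_lipschitz h (a M L : R) : 0 < a -> 0 <= L ->
  (forall i, measurable_fun setT (h i)) ->
  (forall i t, `|t| <= 1 -> a <= h i t <= M) ->
  (forall i s t, `|s| <= 1 -> `|t| <= 1 -> `|h i s - h i t| <= L * `|s - t|) ->
  ES (geoH h) <= \prod_(i < n) Num.sqrt (ES (fun x => h i (tnth x i))).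
Proof.
move=> a0 L0 mh hb hL.
have hM i t : `|t| <= 1 -> `|h i t| <= M.
  by move=> /(hb i)/andP[h1 h2]; rewrite ger0_norm// (le_trans (ltW a0)).
have bh i : sbd (fun x => h i (tnth x i)) by exact: sbd_coord_fun (mh i) (hM i).
have bH := sbd_geoH mh hM.
have ca i : a <= ES (fun x => h i (tnth x i)).
  rewrite -[leLHS](@ES_cst _ n); apply: ES_le => //; first exact: sbd_cst.
  by move=> x x1; have /andP[] := hb i _ (coord_le1 i x1).
have [C C0 hC] := prod_sqrtD_le a0 ca.
set P := \prod_(i < n) _ in hC *.
have P0 : 0 <= P by apply: prodr_ge0 => i _; exact: sqrtr_ge0.
rewrite -subr_ge0; apply: (@le_small _ _ (P * C)) => [|e /andP[e0 e1]]; first exact: mulr_ge0.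
have e20 : 0 < e / 2 by rewrite divr_gt0.
have [p pP] := fin_all_exists (fun i => lipschitz_poly L0 e20 (hL i)).
(* The shift puts the polynomial between h and h + e, so it inherits the lower bound [a]. *)
pose u i := p i + (e / 2)%:P.
have ub i t : `|t| <= 1 -> h i t <= (u i).[t] <= h i t + e.
  by move=> /(pP i); rewrite ler_norml hornerD hornerC; lra.
have ua : ge_ball u a.
  by move=> i t t1; have /andP[+ _] := ub i t t1; have /andP[] := hb i t t1; lra.
have c1 : ES (geoH h) <= ES (geoW u).
  apply: ES_le => //; first exact: sbd_geoW.
  move=> x x1; apply: ler_prod => i _; rewrite sqrtr_ge0 ler_wsqrtr//.
  by have /andP[] := ub i _ (coord_le1 i x1).
have c2 := cll_poly m_gt0 a0 ua.
have c3 : \prod_(i < n) Num.sqrt (ES (fun x => (u i).[tnth x i])) <= P * (1 + e * C).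
  apply: le_trans (hC e _); last by rewrite e1 ltW.
  apply: ler_prod => i _; rewrite sqrtr_ge0 ler_wsqrtr//.
  rewrite -[in leRHS](@ES_cst _ n e) -ESD//; last exact: sbd_cst.
  apply: ES_le; [exact: sbd_poly|apply: sbdD => //; exact: sbd_cst|].
  by move=> x x1; have /andP[] := ub i _ (coord_le1 i x1).
by move: c1 c2 c3; lra.
Qed.

End CLLLipschitz.

(** * Lipschitz approximation almost everywhere *)

Section LipschitzApprox.
Context {R : realType}.
Local Notation mu := (@lebesgue_measure R).

Let near_le3 (t s z : R) : t < s -> s <= z + t -> z <= 1 -> -1 <= t -> t <= 1 ->
  -3 <= s <= 3.
Proof. by move=> *; apply/andP; split; lra. Qed.

(* Difference quotients of a primitive of [g]. *)
Lemma lipschitz_ae_approx (g : R -> R) (a M : R) : 0 <= a -> measurable_fun setT g ->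
  (forall t, a <= g t <= M) ->
  exists h : nat -> R -> R, [/\ forall k, measurable_fun setT (h k),
    forall k t, `|t| <= 1 -> a <= h k t <= M,
    forall k, exists2 L : R, 0 <= L &
      forall s t, `|s| <= 1 -> `|t| <= 1 -> `|h k s - h k t| <= L * `|s - t| &
    {ae mu, forall t, `|t| <= 1 -> h k t @[k --> \oo] --> g t}].
Proof.
move=> a0 mg gb; have M0 : 0 <= M by have /andP[h1 h2] := gb 0; lra.
(* The cut-off makes [g] integrable; difference quotients at points of [-1, 1] only see values up to
   2. *)
pose D : set R := `[-3, 3]%classic.
have mD : measurable D by exact: measurable_itv.
pose f := g \_ D.
have muD : (mu D < +oo)%E by rewrite /D lebesgue_measure_itv/=; case: ifP => // _; exact: ltry.
have fi : mu.-integrable setT (EFin \o f).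
  suff : mu.-integrable D (EFin \o g) by rewrite integrable_mkcond// restrict_EFin.
  apply: measurable_bounded_integrable => //; first exact: measurable_funTS.
  exists M; split; first exact: num_real.
  move=> z Mz t _ /=; have /andP[h1 h2] := gb t.
  by rewrite ger0_norm ?(le_trans a0)// (le_trans h2)// ltW.
have fiA (A : set R) : measurable A -> mu.-integrable A (EFin \o f).
  by move=> mA; exact: integrableS fi.
pose F x := (\int[mu]_(t in `]-oo, x]%classic) f t)%R.
have FB x y : x <= y -> F y - F x = \int[mu]_(t in `]x, y]%classic) f t.
  move=> xy; apply: (Rintegral_itvB (fiA _ (measurable_itv `]-oo, y])));
  by rewrite // bnd_simp.
have f0 t : 0 <= f t <= M.
  rewrite /f patchE; case: ifP => _; last by rewrite lexx M0.
  by have /andP[h1 h2] := gb t; rewrite h2 andbT (le_trans a0).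
have cst_int x y (c : R) : x <= y -> \int[mu]_(t in `]x, y]%classic) c = c * (y - x).
  move=> xy; rewrite Rintegral_cst//; congr (_ * _).
  apply: (etrans (congr1 fine (lebesgue_measure_itv `]x, y]))).
  by rewrite /= lte_fin; case: ltgtP xy => // ->; rewrite subrr.
have cst_i x y (c : R) : mu.-integrable `]x, y]%classic (EFin \o (fun=> c)).
  apply: measurable_bounded_integrable => //.
    suff h : (mu `]x, y]%classic < +oo)%E by exact: h.
    by rewrite lebesgue_measure_itv/=; case: ifP => // _; exact: ltry.
  by exists `|c|; split; [exact: num_real|move=> z cz t _ /=; exact: ltW].
have Fub x y : x <= y -> 0 <= F y - F x <= M * (y - x).
  move=> xy; rewrite FB//; apply/andP; split.
    by apply: Rintegral_ge0 => t _; have /andP[] := f0 t.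
  rewrite -cst_int//; apply: le_Rintegral => //; first exact: fiA.
  by move=> t _; have /andP[] := f0 t.
have Flip x y : `|F x - F y| <= M * `|x - y|.
  wlog xy : x y / x <= y.
    move=> H; have [|/ltW] := leP x y; first exact: H.
    by move=> /H; rewrite distrC [in X in _ <= X -> _]distrC.
  have /andP[h1 h2] := Fub x y xy.
  by rewrite distrC (distrC x) (ger0_norm h1) ger0_norm ?subr_ge0.
have mF : measurable_fun setT F.
  apply: nondecreasing_measurable => // x y xy.
  by have /andP[h1 _] := Fub x y xy; rewrite -subr_ge0; exact: h1.
pose h (k : nat) t := k.+1%:R * (F (k.+1%:R^-1 + t) - F t).
exists h; split.
- move=> k; apply: measurable_funM => //; apply: measurable_funB => //.
  by apply: (measurableT_comp mF); exact: measurable_funD.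
- move=> k t t1; have k0 : 0 < k.+1%:R :> R by [].
  have ki : k.+1%:R^-1 <= 1 :> R by rewrite invf_le1// ler1n.
  have ki0 : 0 < k.+1%:R^-1 :> R by rewrite invr_gt0.
  have tt : t <= k.+1%:R^-1 + t by rewrite lerDr ltW.
  have E (c : R) : c = k.+1%:R * (c * (k.+1%:R^-1 + t - t)).
    by rewrite addrK mulrCA divff// mulr1.
  apply/andP; split; last first.
    rewrite [leRHS]E ler_wpM2l ?(ltW k0)//.
    by have /andP[] := Fub _ _ tt.
  rewrite [leLHS]E ler_wpM2l ?(ltW k0)// FB// -cst_int//.
  apply: le_Rintegral => //; first exact: fiA.
  move=> s; rewrite /= in_itv/= => /andP[s1 s2].
  rewrite /f patchE mem_set; first by have /andP[] := gb s.
  move: t1; rewrite ler_norml /D /= in_itv/= => /andP[t1 t2].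
  exact: (@near_le3 t s _ s1 s2 ki t1 t2).
- move=> k; exists (k.+1%:R * (M + M)); first by rewrite mulr_ge0// addr_ge0.
  move=> s t _ _; rewrite /h -mulrBr normrM ger0_norm// -mulrA ler_wpM2l//.
  have -> : F (k.+1%:R^-1 + s) - F s - (F (k.+1%:R^-1 + t) - F t) =
    (F (k.+1%:R^-1 + s) - F (k.+1%:R^-1 + t)) - (F s - F t) by ring.
  rewrite (le_trans (ler_normB _ _))// mulrDl lerD//.
  by apply: le_trans (Flip _ _) _; rewrite opprD addrACA subrr add0r.
have locf : locally_integrable setT f by apply: open_integrable_locally => //; exact: openT.
have := FTC1Ny (fun y => fiA _ (measurable_itv `]-oo, y])) locf.
apply: filterS; first exact: (ae_filter_ringOfSetsType mu).
move=> t [dF Ft] t1.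
have -> : g t = f t.
  rewrite /f patchE mem_set//; move: t1; rewrite ler_norml /D /= in_itv/=.
  by move=> /andP[t1 t2]; lra.
rewrite -Ft derive1E.
have : h^-1 *: ((F \o shift t) (h *: (1 : R)) - F t) @[h --> 0^'] --> 'D_1 F t by exact: dF.
move=> /cvgr_dnbhsP dq.
have := dq (fun k => k.+1%:R^-1); move: dq => _ dq.
have /dq : (forall k : nat, k.+1%:R^-1 != 0 :> R) /\ k.+1%:R^-1 @[k --> \oo] --> (0:R).
  by split; [move=> k; rewrite invr_eq0|exact: cvg_harmonic].
apply: cvg_trans; apply: near_eq_cvg; apply: nearW => k.
by rewrite /h /= [_%:A]mulr1 invrK.
Qed.

End LipschitzApprox.

(** * Law of a coordinate, and Carlen-Lieb-Loss for measurable functions *)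

Section CoordinateLaw.
Context {R : realType}.
Local Notation mu := (@lebesgue_measure R).

Lemma cvg_prodr n (u : 'I_n -> nat -> R) (l : 'I_n -> R) :
  (forall i, u i k @[k --> \oo] --> l i) ->
  \prod_(i < n) u i k @[k --> \oo] --> \prod_(i < n) l i.
Proof.
by move=> ul; apply: cvg_big => // -[x y]; exact: (@mul_continuous R (x, y)).
Qed.

(** A quarter-turn moves one coordinate onto another; the transposition would not be a plane
    rotation. *)
Lemma coord_swap n (i j : 'I_n) :
  exists2 O : n.-tuple R -> n.-tuple R, gauss_isom O & forall x, tnth (O x) i = tnth x j.
Proof.
have [->|ij] := eqVneq i j; first by exists id => //; exact: gauss_isom_id.
exists (giv i j 0 (-1)).
  by apply: gauss_isom_giv => //; rewrite expr0n add0r sqrrN expr1n.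
by move=> x; rewrite tnth_mktuple eqxx mul0r mulN1r sub0r opprK.
Qed.

(** A rotation brings the coordinate to the first place, where disintegration exhibits a density for
    its law. *)
Lemma coord_null n (i : 'I_n.+2) (N : set R) : measurable N -> mu N = 0%E ->
  (\int[sphM n.+2]_x (\1_N (tnth x i))%:E = 0)%E.
Proof.
move=> mN N0; have mI : measurable_fun setT (\1_N : R -> R) by exact: measurable_indic.
have [S gS Si] := coord_swap ord0 i.
pose h0 (x : n.+2.-tuple R) := (\1_N (tnth x ord0) : R)%:E.
have mh0 : measurable_fun setT h0.
  by apply/measurable_EFinP; exact: (measurableT_comp mI (measurable_tnth ord0)).
have h00 x : (0 <= h0 x)%E by rewrite lee_fin indicE.
transitivity (\int[sphM n.+2]_x h0 (S x))%E.
  by apply: eq_integral => x _; rewrite /h0 Si.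
apply: (etrans (integral_sphM_isom gS mh0 h00)).
apply: (etrans (disintegration mh0 h00)).
rewrite /nu_int; set c := nu_const R n.+2.
have c0 : 0 <= c.
  rewrite /c /nu_const invr_ge0; apply: fine_ge0; apply: integral_ge0 => t _.
  by rewrite lee_fin nu_weight_ge0.
transitivity (\int[mu]_(t in @I11 R) ((c * nu_weight n.+2 t) * \1_N t)%:E)%E.
  apply: eq_integral => t _.
  rewrite [RHS]EFinM; congr (_ * _)%E.
  transitivity (\int[sphM n.+1]_th (\1_N t : R)%:E)%E.
    by apply: eq_integral => th _; rewrite /h0 /slice tnth_consp0.
  by rewrite integral_cst//= probability_setT mule1.
have mw : measurable_fun setT (fun t : R => (c * nu_weight n.+2 t * \1_N t)%:E).
  apply/measurable_EFinP; apply: measurable_funM => //.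
  by apply: measurable_funM => //; exact: measurable_nu_weight.
transitivity (\int[mu]_(t in @I11 R) (cst 0%E t))%E; last by rewrite integral0.
apply: ge0_ae_eq_integral => //.
- exact: measurable_itv.
- exact: measurable_funTS mw.
- by move=> t _; rewrite lee_fin !mulr_ge0// nu_weight_ge0.
exists N; split => // t /= /not_implyP[_ h]; apply: contrapT => Nt; apply: h.
by rewrite indicE memNset// mulr0.
Qed.

Lemma ae_coord n (i : 'I_n.+2) (P : set R) : {ae mu, forall t, P t} ->
  {ae gaussM n.+2, forall x, P (tnth (normalize x) i)}.
Proof.
move=> [N [mN N0 PN]]; pose A := (fun x : n.+2.-tuple R => tnth (normalize x) i) @^-1` N.
have mg : measurable_fun setT (fun x : n.+2.-tuple R => tnth (normalize x) i).
  exact: measurable_tnth_comp (@measurable_normalize _ _ _ _ idfun (@measurable_id _ _ _)).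
have mA : measurable A by rewrite -[A]setTI; exact: mg.
exists A; split => //; last by move=> x /= Px; exact: PN.
have := coord_null i mN N0; rewrite integral_sphM; last 2 first.
- by apply/measurable_EFinP; exact: (measurableT_comp (measurable_indic mN) (measurable_tnth i)).
- by move=> x; rewrite lee_fin indicE.
by rewrite -[A]setIT -(integral_indic _ measurableT mA) => h; exact: h.
Qed.

Lemma ES_dct n (f_ : nat -> n.-tuple R -> R) f M : (forall k, sbd (f_ k)) -> sbd f ->
  (forall k x, dotp x x <= 1 -> `|f_ k x| <= M) ->
  {ae gaussM n, forall x, f_ k (normalize x) @[k --> \oo] --> f (normalize x)} ->
  ES (f_ k) @[k --> \oo] --> ES f.
Proof.
move=> bf_ bf fM cf.
have mf_ k : measurable_fun setT (fun x => (f_ k (normalize x))%:E).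
  by have /integrableP[] := sbd_integrable (bf_ k).
have mf : measurable_fun setT (fun x => (f (normalize x))%:E).
  by have /integrableP[] := sbd_integrable bf.
have cf' : {ae gaussM n, forall x, [set: n.-tuple R] x ->
    (f_ k (normalize x))%:E @[k --> \oo] --> (f (normalize x))%:E}.
  apply: filterS cf => x cx _; apply/fine_cvgP; split; last exact: cx.
  by apply: nearW.
have iM : (gaussM n).-integrable setT (fun=> M%:E) by exact: (sbd_integrable (sbd_cst n M)).
have dom : {ae gaussM n, forall x, forall k : nat, [set: n.-tuple R] x ->
    (`|(f_ k (normalize x))%:E| <= M%:E)%E}.
  by apply: aeW => x k _; rewrite lee_fin fM// normalize_le1.
have [_ _] := dominated_convergence measurableT mf_ mf cf' iM dom.
move=> h; have := h; rewrite -(EFin_ES bf) => /fine_cvg; exact.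
Qed.

Lemma cll_measurable m (g : 'I_m.+2 -> R -> R) (a M : R) : 0 < a ->
  (forall i, measurable_fun setT (g i)) -> (forall i t, a <= g i t <= M) ->
  ES (geoH g) <= \prod_(i < m.+2) Num.sqrt (ES (fun x => g i (tnth x i))).
Proof.
move=> a0 mg gb.
have [h hP] := fin_all_exists (fun i => lipschitz_ae_approx (ltW a0) (mg i) (gb i)).
have mh i k : measurable_fun setT (h i k) by have [] := hP i.
have hb i k t : `|t| <= 1 -> a <= h i k t <= M by move=> t1; have [_ ->] := hP i.
have habs i k t : `|t| <= 1 -> `|h i k t| <= M.
  by move=> /(hb i k)/andP[h1 h2]; rewrite (ger0_norm (le_trans (ltW a0) h1)).
have gabs i t : `|t| <= 1 -> `|g i t| <= M.
  by have /andP[h1 h2] := gb i t; rewrite (ger0_norm (le_trans (ltW a0) h1)).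
have hc i : {ae gaussM m.+2, forall x,
    h i k (tnth (normalize x) i) @[k --> \oo] --> g i (tnth (normalize x) i)}.
  have [_ _ _ /(ae_coord i)] := hP i; apply: filterS => x; apply.
  exact: coord_le1 (normalize_le1 x).
pose hk k i := h i k.
have cll k : ES (geoH (hk k)) <= \prod_(i < m.+2) Num.sqrt (ES (fun x => h i k (tnth x i))).
  have cb i : exists L : R, 0 <= L /\
      forall s t, `|s| <= 1 -> `|t| <= 1 -> `|h i k s - h i k t| <= L * `|s - t|.
    by have [_ _ /(_ k)[L L0 hL] _] := hP i; exists L.
  have [L LP] := fin_all_exists cb.
  apply: (@cll_lipschitz _ m.+1 isT (hk k) a M (\sum_i L i)) => //.
  - by apply: sumr_ge0 => i _; have [] := LP i.
  - by move=> i; exact: mh.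
  - by move=> i; exact: hb.
  - move=> i s t s1 t1; have [_ hL] := LP i; rewrite (le_trans (hL s t s1 t1))// ler_wpM2r//.
    by rewrite (bigD1 i)//= lerDl; apply: sumr_ge0 => j _; have [] := LP j.
have c1 : ES (geoH (hk k)) @[k --> \oo] --> ES (geoH g).
  apply: (@ES_dct _ _ _ (\prod_(i < m.+2) Num.sqrt M)).
  - by move=> k; apply: (@sbd_geoH _ _ _ M) => *; [exact: mh|exact: habs].
  - by apply: (@sbd_geoH _ _ _ M) => *; [exact: mg|exact: gabs].
  - move=> k x x1; rewrite /geoH normr_prod; apply: ler_prod => i _; rewrite normr_ge0/=.
    rewrite ger0_norm ?sqrtr_ge0// ler_wsqrtr//.
    by have /andP[] := hb i k _ (coord_le1 i x1).
  (* The finitely many exceptional sets are united as a family indexed by the naturals. *)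
  - have all_c : {ae gaussM m.+2, forall x, forall j : nat, forall i : 'I_m.+2, i = j :> nat ->
        h i k (tnth (normalize x) i) @[k --> \oo] --> g i (tnth (normalize x) i)}.
      apply: ae_foralln => j; have [jm|jm] := ltnP j m.+2.
        apply: filterS (hc (Ordinal jm)) => x hx i ij.
        by rewrite (_ : i = Ordinal jm)//; exact: val_inj.
      by apply: aeW => x i ij; move: jm; rewrite -ij leqNgt ltn_ord.
    apply: filterS all_c => x hx; rewrite /geoH.
    apply: cvg_prodr => i; apply: continuous_cvg; first exact: sqrt_continuous.
    exact: (hx i i erefl).
have c2 : \prod_(i < m.+2) Num.sqrt (ES (fun x => h i k (tnth x i))) @[k --> \oo] -->
    \prod_(i < m.+2) Num.sqrt (ES (fun x => g i (tnth x i))).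
  apply: cvg_prodr => i; apply: continuous_cvg; first exact: sqrt_continuous.
  apply: (@ES_dct _ _ _ M).
  - by move=> k; exact: sbd_coord_fun (mh i k) (habs i k).
  - exact: sbd_coord_fun (mg i) (gabs i).
  - by move=> k x x1; rewrite habs// coord_le1.
  - exact: hc.
by apply: (ler_cvg_to c1 c2); exact: nearW.
Qed.

End CoordinateLaw.

(** * The spherical slice transform *)

Section Radon.
Context {R : realType}.
Local Open Scope ereal_scope.

Lemma perp_unitE n (w y : n.-tuple R) :
  perp_unit w y = normalize (comb 1 y (- dotp y w)%R w).
Proof.
congr normalize; apply: eq_from_tnth => i.
by rewrite tnth_mktuple tnth_comb mul1r mulNr.
Qed.

Lemma radonE n (f : n.-tuple R -> \bar R) (w : n.-tuple R) (t : R) :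
  radon f w t = sph_int (fun y => f (comb t w (Num.sqrt (1 - t ^+ 2)) (perp_unit w y))).
Proof. by []. Qed.

Lemma perp_unit_e0 n (y : n.+1.-tuple R) :
  perp_unit (e0 n) y = consp (0%R, normalize [tuple of behead y]).
Proof.
set z := [tuple of behead y].
rewrite perp_unitE (_ : comb _ _ _ _ = consp (0%R, z)); last first.
  rewrite dotp_e0 [in LHS](consp_eta y) -/z.
  apply: eq_from_tnth => i; rewrite tnth_comb; case: (unliftP ord0 i) => [j ->|->].
    rewrite !tnth_consS.
    have -> : tnth (e0 n) (lift ord0 j) = 0%R :> R by rewrite tnth_mktuple.
    by ring.
  rewrite !tnth_consp0.
  have -> : tnth (e0 n) ord0 = 1%R :> R by rewrite tnth_mktuple.
  by ring.
have En : enorm (consp (0%R, z)) = enorm z by rewrite /enorm dotp_cons mul0r add0r.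
apply: eq_from_tnth => i; rewrite tnth_normalize En; case: (unliftP ord0 i) => [j ->|->].
  by rewrite !tnth_consS tnth_normalize.
by rewrite !tnth_consp0 mul0r.
Qed.

Lemma perp_unit_isom n (S : n.-tuple R -> n.-tuple R) w y : gauss_isom S ->
  perp_unit (S w) (S y) = S (perp_unit w y).
Proof.
move=> gS; have [_ lS dS _] := gS.
by rewrite !perp_unitE gauss_isom_normalize// lS dS.
Qed.

Lemma normalize_behead n (x : n.+1.-tuple R) :
  normalize [tuple of behead (normalize x)] = normalize [tuple of behead x].
Proof.
have E : [tuple of behead (normalize x)] =
    comb (enorm x)^-1 [tuple of behead x] 0 [tuple of behead x].
  apply: eq_from_tnth => i; rewrite tnth_comb mul0r addr0.
  have tb (y : n.+1.-tuple R) : tnth [tuple of behead y] i = tnth y (lift ord0 i).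
    by rewrite [in RHS](consp_eta y) tnth_consS.
  by rewrite !tb tnth_normalize mulrC.
rewrite E; have [x0|x0] := eqVneq (enorm x) 0%R; last first.
  by rewrite normalize_comb0// invr_gt0 lt_def x0 enorm_ge0.
congr normalize; apply: eq_from_tnth => i; rewrite tnth_comb mul0r addr0 x0 invr0 mul0r.
have := enorm_eq0 x0 (lift ord0 i).
by rewrite [in X in X -> _](consp_eta x) tnth_consS.
Qed.

Lemma measurable_perp_arg n d (T : measurableType d) (a : T -> R) (w y : T -> n.-tuple R) :
  measurable_fun setT a -> measurable_fun setT w -> measurable_fun setT y ->
  measurable_fun setT (fun p => comb (a p) (w p) (Num.sqrt (1 - a p ^+ 2)) (perp_unit (w p) (y p))).
Proof.
move=> ma mw my.
rewrite (_ : (fun p => _) = fun p => comb (a p) (w p) (Num.sqrt (1 + - (a p ^+ 2)))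
  (normalize (comb 1 (y p) (- dotp (y p) (w p))%R (w p)))); first by mfun.
by apply/funext => p; rewrite perp_unitE.
Qed.

Lemma radon_sphM n (f : n.-tuple R -> \bar R) w t :
  measurable_fun setT f -> (forall x, 0 <= f x) ->
  radon f w t = \int[sphM n]_y f (comb t w (Num.sqrt (1 - t ^+ 2)) (perp_unit w y)).
Proof.
move=> mf f0; rewrite radonE sph_intE//.
by apply: (measurableT_comp mf); apply: measurable_perp_arg; mfun.
Qed.

Lemma measurable_radon n (f : n.-tuple R -> \bar R) :
  measurable_fun setT f -> (forall x, 0 <= f x) ->
  measurable_fun setT (fun p : n.-tuple R * R => radon f p.1 p.2).
Proof.
move=> mf f0.
rewrite (_ : (fun p => _) = fun p : n.-tuple R * R =>
   \int[sphM n]_y f (comb p.2 p.1 (Num.sqrt (1 - p.2 ^+ 2)) (perp_unit p.1 y))).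
  apply: (measurable_integral_param (sphM n)
    (f := fun (p : n.-tuple R * R) y => f (comb p.2 p.1 (Num.sqrt (1 - p.2 ^+ 2)) (perp_unit p.1 y)))) => //.
  apply: (measurableT_comp mf); apply: measurable_perp_arg.
  - exact: (measurableT_comp measurable_snd measurable_fst).
  - exact: (measurableT_comp measurable_fst measurable_fst).
  - exact: measurable_snd.
by apply/funext => p; rewrite radon_sphM.
Qed.

Lemma radon_ge0 n (f : n.-tuple R -> \bar R) w t :
  measurable_fun setT f -> (forall x, 0 <= f x) -> 0 <= radon f w t.
Proof. by move=> mf f0; rewrite radon_sphM// integral_ge0. Qed.

(** After rotating back, the component of [y] orthogonal to [e0] is its tail. The tail of a Gaussian
    vector is Gaussian, so its direction is uniform on the smaller sphere. *)
Lemma radon_isom n (S : n.+2.-tuple R -> n.+2.-tuple R) (f : n.+2.-tuple R -> \bar R) t :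
  gauss_isom S -> measurable_fun setT f -> (forall x, 0 <= f x) ->
  radon f (S (e0 n.+1)) t = \int[sphM n.+1]_th f (S (slice t th)).
Proof.
move=> gS mf f0; have [mS lS _ _] := gS.
rewrite radon_sphM//.
pose F (z : n.+1.-tuple R) := f (S (slice t (normalize z))).
have mF : measurable_fun setT F.
  apply: (measurableT_comp mf); apply: (measurableT_comp mS); apply: measurable_slice; mfun.
have F0 z : 0 <= F z by exact: f0.
pose h y := f (comb t (S (e0 n.+1)) (Num.sqrt (1 - t ^+ 2)) (perp_unit (S (e0 n.+1)) y)).
have mh : measurable_fun setT h.
  by apply: (measurableT_comp mf); apply: measurable_perp_arg; mfun.
have mb : measurable_fun setT (fun y : n.+2.-tuple R => [tuple of behead y]).
  exact: measurable_behead.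
apply: (etrans (esym (integral_sphM_isom gS mh (fun _ => f0 _)))).
transitivity (\int[sphM n.+2]_y F [tuple of behead y]).
  apply: eq_integral => y _; rewrite /h perp_unit_isom// -lS perp_unit_e0 /F.
  congr (f (S _)); rewrite /slice; apply: eq_from_tnth => i; rewrite tnth_comb.
  case: (unliftP ord0 i) => [j ->|->].
    rewrite !tnth_consS tnth_comb mul0r addr0.
    have -> : tnth (e0 n.+1) (lift ord0 j) = 0%R :> R by rewrite tnth_mktuple.
    by rewrite mulr0 add0r.
  rewrite !tnth_consp0.
  have -> : tnth (e0 n.+1) ord0 = 1%R :> R by rewrite tnth_mktuple.
  by rewrite mulr1 mulr0 addr0.
rewrite integral_sphM//; last exact: (measurableT_comp mF mb).
rewrite integral_sphM//; last first.
  by apply: (measurableT_comp mf); apply: (measurableT_comp mS); apply: measurable_slice; mfun.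
transitivity (\int[gaussM n.+2]_x F [tuple of behead x]).
  by apply: eq_integral => x _; rewrite /F normalize_behead.
apply: (etrans (integral_gaussMS (measurableT_comp mF mb) (fun _ => F0 _))).
transitivity (\int[gauss1]_a (\int[gaussM n.+1]_x F x)).
  apply: eq_integral => a _; apply: eq_integral => x _.
  by rewrite /= behead_consp.
by rewrite integral_cst//= probability_setT mule1.
Qed.

(** The duality between the slice transform in the direction [S (e0 n.+1)] and functions of the
    height in that direction. *)
Lemma radon_disint n (S : n.+2.-tuple R -> n.+2.-tuple R) (f : n.+2.-tuple R -> \bar R)
    (g : R -> \bar R) : gauss_isom S ->
  measurable_fun setT f -> (forall x, 0 <= f x) ->
  measurable_fun setT g -> (forall t, 0 <= g t) ->
  \int[sphM n.+2]_x (f (S x) * g (tnth x ord0)) =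
  nu_int n.+2 (fun t => radon f (S (e0 n.+1)) t * g t).
Proof.
move=> gS mf f0 mg g0; have [mS _ _ _] := gS.
have mh : measurable_fun setT (fun x : n.+2.-tuple R => f (S x) * g (tnth x ord0)).
  apply: emeasurable_funM; first exact: (measurableT_comp mf mS).
  exact: (measurableT_comp mg (measurable_tnth ord0)).
apply: (etrans (disintegration mh (fun x => mule_ge0 (f0 _) (g0 _)))).
apply: eq_integral => t _; congr (_ * _); rewrite radon_isom//.
rewrite -ge0_integralZr//.
- by apply: (measurableT_comp mf); apply: (measurableT_comp mS); apply: measurable_slice; mfun.
Qed.

End Radon.

(** * The inequality for one frame *)

Section AdjointBL.
Context {R : realType}.

(** Averages the tangent line of exp at the weighted mean. It serves as AM-GM and, with two points,
    as Young's inequality. *)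
Lemma expR_jensen n (w y : 'I_n -> R) : (forall i, 0 <= w i) -> \sum_i w i = 1 ->
  expR (\sum_i w i * y i) <= \sum_i w i * expR (y i).
Proof.
move=> w0 w1; set z := \sum_i w i * y i.
have -> : expR z = \sum_i w i * (expR z * (1 + (y i - z))).
  transitivity (expR z * (\sum_i w i + (\sum_i w i * y i - (\sum_i w i) * z))).
    by rewrite w1 -/z mul1r subrr addr0 mulr1.
  rewrite mulr_suml -sumrB -big_split mulr_sumr; apply: eq_bigr => i _ /=; ring.
apply: ler_sum => i _; rewrite ler_wpM2l//.
rewrite -[y i in leRHS](subrK z) expRD [leRHS]mulrC ler_wpM2l ?expR_ge0//.
exact: expR_ge1Dx.
Qed.

Lemma expR_young (p u v : R) : 0 <= p <= 1 ->
  expR (p * u + (1 - p) * v) <= p * expR u + (1 - p) * expR v.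
Proof.
move=> /andP[p0 p1].
have := @expR_jensen 2 (fun i => if i == ord0 then p else 1 - p)
  (fun i => if i == ord0 then u else v).
rewrite !big_ord_recl !big_ord0 /= !addr0; apply; last by rewrite addrC subrK.
by move=> i; case: ifP; rewrite ?subr_ge0.
Qed.

Lemma sbd_expR n (f : n.-tuple R -> R) : sbd f -> sbd (fun x => expR (f x)).
Proof.
move=> [mf [M fM]]; split; first exact: (measurableT_comp (@measurable_expR R)).
exists (expR M) => x x1; rewrite ger0_norm ?expR_ge0// ler_expR.
exact: le_trans (ler_norm _) (fM x x1).
Qed.

Lemma sbd_ln n (f : n.-tuple R -> R) (a M : R) : 0 < a -> measurable_fun setT f ->
  (forall x, a <= f x <= M) -> sbd (fun x => ln (f x)).
Proof.
move=> a0 mf fb; split; first exact: (measurableT_comp (@measurable_ln R)).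
exists (`|ln a| + `|ln M|) => x _; have /andP[h1 h2] := fb x.
have f0 : 0 < f x by exact: lt_le_trans h1.
have l1 : ln a <= ln (f x) by rewrite ler_ln.
have l2 : ln (f x) <= ln M by rewrite ler_ln ?posrE// (lt_le_trans f0).
have := ler_norm (ln M); have := ler_norm (- ln a); rewrite normrN => n1 n2.
have := normr_ge0 (ln M); have := normr_ge0 (ln a) => n3 n4.
by rewrite ler_norml; apply/andP; split; lra.
Qed.

(* In the proof u and v are the logarithms of U and V of the header, and
   al i = ln a_i. *)
Lemma adjoint_bl m (p q a M : R) (f : m.+2.-tuple R -> R) (F : 'I_m.+2 -> R -> R) :
  0 < a -> measurable_fun setT f -> (forall x, a <= f x <= M) ->
  (forall i, measurable_fun setT (F i)) -> (forall i t, a <= F i t <= M) ->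
  (forall i (g : R -> R), measurable_fun setT g -> (forall t, 0 <= g t) ->
    (exists K, forall t, g t <= K) ->
    ES (fun x => f x * g (tnth x i)) = ES (fun x => F i (tnth x i) * g (tnth x i))) ->
  0 < p <= 1 -> 0 < q <= 1 -> 1 / 2 * (1 - 1 / p) <= 1 / m.+2%:R * (1 - 1 / q) ->
  ES (fun x => f x `^ p) `^ (q / p) <=
    m.+2%:R^-1 * \sum_i ES (fun x => F i (tnth x i) `^ q).
Proof.
move=> a0 mf fb mF Fb FE /andP[p0 p1] /andP[q0 q1] pq.
set n := m.+2 in f mf fb F mF Fb FE pq *.
have n0 : 0 < n%:R :> R by [].
have fpos x : 0 < f x by have /andP[h _] := fb x; exact: lt_le_trans h.
have Fpos i t : 0 < F i t by have /andP[h _] := Fb i t; exact: lt_le_trans h.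
have powE (y c : R) : 0 < y -> y `^ c = expR (c * ln y) by move=> y0; rewrite /powR gt_eqF.
have mFi i : measurable_fun setT (fun x : n.-tuple R => F i (tnth x i)).
  exact: (measurableT_comp (mF i) (measurable_tnth i)).
have bl : sbd (fun x => ln (f x)) by exact: sbd_ln a0 mf fb.
have bL i : sbd (fun x => ln (F i (tnth x i))) by exact: (sbd_ln a0 (mFi i)).
have bZ c (h : n.-tuple R -> R) : sbd h -> sbd (fun x => c * h x).
  by move=> bh; apply: sbdM => //; exact: sbd_cst.
pose A i := ES (fun x => expR (q * ln (F i (tnth x i)))).
have bA i : sbd (fun x => expR (q * ln (F i (tnth x i)))) by apply: sbd_expR; exact: bZ.
have -> : \sum_i ES (fun x => F i (tnth x i) `^ q) = \sum_i A i.
  by apply: eq_bigr => i _; congr ES; apply/funext => x; rewrite powE.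
have A0 i : 0 < A i.
  apply: (@lt_le_trans _ _ (expR (q * ln a))); first exact: expR_gt0.
  rewrite -[leLHS](@ES_cst _ n); apply: ES_le => //; first exact: sbd_cst.
  move=> x _; rewrite ler_expR ler_wpM2l ?(ltW q0)// ler_ln ?posrE//.
  by have /andP[] := Fb i (tnth x i).
pose al i := ln (A i).
have alE i : expR (al i) = A i by rewrite /al lnK// posrE.
(* At p = 1 the formula for [r] divides by 0; there q = 1 and both sides are the mean of f. *)
have [p1E|p1'] := eqVneq p 1.
  have q1E : q = 1.
    apply/eqP; rewrite eq_le q1/=; move: pq.
    rewrite p1E divr1 subrr mulr0 pmulr_rge0 ?divr_gt0// subr_ge0.
    by rewrite ler_pdivrMr// mul1r.
  rewrite p1E q1E divr1 powRr1; last first.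
    rewrite -[leLHS](@ES_cst _ n); apply: ES_le; [exact: sbd_cst| |].
      rewrite (_ : (fun x => _) = fun x => expR (1 * ln (f x))); first by apply: sbd_expR; exact: bZ.
      by apply/funext => x; rewrite powE.
    by move=> x _; exact: powR_ge0.
  have E i : A i = ES (fun x => f x `^ 1).
    transitivity (ES (fun x => F i (tnth x i) * 1)).
      by rewrite /A q1E; congr ES; apply/funext => x; rewrite mul1r mulr1 lnK ?posrE.
    rewrite -(FE i (fun=> 1))//; last by exists 1.
    by congr ES; apply/funext => x; rewrite mulr1 powRr1// ltW.
  rewrite (eq_bigr _ (fun i _ => E i)) sumr_const card_ord -[X in _ * X]mulr_natl mulrA.
  by rewrite mulVf ?mul1r// gt_eqF.
have p1lt : 0 < 1 - p by rewrite subr_gt0 lt_def eq_sym p1'.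
pose u x := ln (f x) + \sum_i n%:R^-1 * ((q - 1) * ln (F i (tnth x i)) - al i).
(* The solution of p (q - 1) / n + (1 - p) r / 2 = 0, the exponent of F_i in U^p V^(1-p). *)
pose r := 2 * (1 - q) * p / (n%:R * (1 - p)).
have r0 : 0 <= r.
  by rewrite divr_ge0 ?mulr_ge0 ?subr_ge0// ltW.
pose s := r / q.
have s0 : 0 <= s by rewrite divr_ge0// ltW.
(* The hypothesis on the exponents enters here, in the form r <= q. *)
have s1 : s <= 1.
  rewrite /s ler_pdivrMr// mul1r /r ler_pdivrMr ?mulr_gt0//.
  move: pq; rewrite -(@ler_pM2l _ (2 * n%:R * p * q)) ?mulr_gt0//.
  rewrite [leLHS](_ : _ = n%:R * q * (p - 1)); last by field; rewrite gt_eqF.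
  rewrite [leRHS](_ : _ = 2 * p * (q - 1)); last by field; rewrite !gt_eqF.
  by lra.
have bq i : sbd (fun x => expR (q * ln (F i (tnth x i)) - al i)).
  by apply: sbd_expR; apply: sbdD; [exact: bZ|exact: sbd_cst].
have Eq i : ES (fun x => expR (q * ln (F i (tnth x i)) - al i)) = 1.
  transitivity (ES (fun x => (A i)^-1 * expR (q * ln (F i (tnth x i))))).
    by congr ES; apply/funext => x; rewrite expRD expRN alE mulrC.
  by rewrite ESZ// mulVf// gt_eqF.
have bUi i : sbd (fun x => expR (ln (f x) + ((q - 1) * ln (F i (tnth x i)) - al i))).
  apply: sbd_expR; apply: sbdD => //; apply: sbdD; [exact: bZ|exact: sbd_cst].
(* The duality [FE] replaces f by F_i, and F_i F_i^(q-1) / a_i has mean 1. *)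
have EUi i : ES (fun x => expR (ln (f x) + ((q - 1) * ln (F i (tnth x i)) - al i))) = 1.
  pose g t := expR ((q - 1) * ln (F i t) - al i).
  have mg : measurable_fun setT g.
    apply: (measurableT_comp (@measurable_expR R)); apply: measurable_funD => //.
    by apply: measurable_funM => //; exact: (measurableT_comp (@measurable_ln R)).
  transitivity (ES (fun x => f x * g (tnth x i))).
    by congr ES; apply/funext => x; rewrite expRD lnK ?posrE.
  rewrite FE//; last 2 first.
  - by move=> t; exact: expR_ge0.
  - exists (expR ((q - 1) * ln a - al i)) => t; rewrite ler_expR lerD2r.
    rewrite ler_wnM2l ?subr_le0// ler_ln ?posrE//.
    by have /andP[] := Fb i t.
  apply: etrans (Eq i); congr ES; apply/funext => x; rewrite /g.
  rewrite -{1}[F i (tnth x i)]lnK ?posrE// -expRD; congr expR.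
  by ring.
have wsum : \sum_(i < n) n%:R^-1 = 1 :> R.
  by rewrite sumr_const card_ord -[LHS]mulr_natl mulfV// gt_eqF.
have bu : sbd (fun x => expR (u x)).
  apply: sbd_expR; apply: sbdD => //; apply: sbd_sum => i; apply: (bZ).
  by apply: sbdD; [exact: bZ|exact: sbd_cst].
have EU : ES (fun x => expR (u x)) <= 1.
  apply: (@le_trans _ _ (ES (fun x => \sum_i n%:R^-1 *
      expR (ln (f x) + ((q - 1) * ln (F i (tnth x i)) - al i))))).
    apply: ES_le => //; first by apply: sbd_sum => i; exact: bZ.
    move=> x _; rewrite (_ : u x = \sum_i n%:R^-1 *
        (ln (f x) + ((q - 1) * ln (F i (tnth x i)) - al i))).
      by apply: expR_jensen => // i; rewrite invr_ge0 ltW.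
    have wl : ln (f x) = \sum_(i < n) n%:R^-1 * ln (f x) by rewrite -mulr_suml wsum mul1r.
    rewrite /u {1}wl -big_split.
    by apply: eq_bigr => i _ /=; rewrite [RHS]mulrDr.
  rewrite ES_sum => [|i]; last exact: bZ.
  rewrite (eq_bigr (fun=> n%:R^-1)) ?wsum// => i _.
  by rewrite ESZ// EUi mulr1.
pose g i t := expR (r * ln (F i t) - s * al i).
have mg i : measurable_fun setT (g i).
  apply: (measurableT_comp (@measurable_expR R)); apply: measurable_funD => //.
  by apply: measurable_funM => //; exact: (measurableT_comp (@measurable_ln R)).
have Eg i : 0 <= ES (fun x => g i (tnth x i)) <= 1.
  have bg : sbd (fun x : n.-tuple R => g i (tnth x i)).
    by apply: sbd_expR; apply: sbdD; [exact: bZ|exact: sbd_cst].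
  apply/andP; split.
    rewrite -[leLHS](@ES_cst _ n); apply: ES_le => //; first exact: sbd_cst.
    by move=> x _; exact: expR_ge0.
  (* Jensen for y^s in the tangent form y^s <= s y + 1 - s. *)
  apply: (@le_trans _ _ (ES (fun x => s * expR (q * ln (F i (tnth x i)) - al i) + (1 - s) * 1))).
    apply: ES_le => //; first by apply: sbdD; [exact: bZ|exact: sbd_cst].
    move=> x _; have := @expR_young s (q * ln (F i (tnth x i)) - al i) 0.
    rewrite s0 s1 expR0 => /(_ isT); apply: le_trans.
    rewrite ler_expR le_eqVlt; apply/orP; left; apply/eqP.
    by rewrite /s; field; rewrite gt_eqF.
  rewrite ESD; [|exact: bZ|exact: sbd_cst].
  by rewrite (ESZ s (bq i)) Eq ES_cst !mulr1 addrC subrK.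
have [b1 [b2 [b10 gb]]] : exists b1 b2 : R, 0 < b1 /\ forall i t, b1 <= g i t <= b2.
  pose c := \sum_i `|s * al i|.
  exists (expR (r * ln a - c)), (expR (r * ln M + c)); split; first exact: expR_gt0.
  move=> i t; rewrite !ler_expR; have /andP[h1 h2] := Fb i t; have Fi := Fpos i t.
  have M0 : 0 < M by exact: lt_le_trans h2.
  have l1 : r * ln a <= r * ln (F i t) by rewrite ler_wpM2l// ler_ln.
  have l2 : r * ln (F i t) <= r * ln M.
    by rewrite ler_wpM2l// ler_ln.
  have : `|s * al i| <= c by rewrite /c (bigD1 i)//= lerDl sumr_ge0.
  by rewrite ler_norml => /andP[c1 c2]; apply/andP; split; lra.
have EV : ES (geoH g) <= 1.
  apply: (le_trans (cll_measurable b10 mg gb)).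
  apply: (@le_trans _ _ (\prod_(i < n) (1 : R))); last by rewrite big1.
  apply: ler_prod => i _.
  rewrite sqrtr_ge0 -[leRHS]sqrtr1 ler_wsqrtr//.
  by have /andP[] := Eg i.
have bV : sbd (geoH g).
  by apply: sbd_prod => i; apply: sbd_sqrt; apply: sbd_expR; apply: sbdD; [exact: bZ|exact: sbd_cst].
have VE x : geoH g x = expR (\sum_i 2^-1 * (r * ln (F i (tnth x i)) - s * al i)).
  rewrite expR_sum; apply: eq_bigr => i _; rewrite /g.
  set y := r * _ - _; rewrite -[in LHS](_ : 2 * (2^-1 * y) = y); last by field.
  by rewrite expRM_natl sqrtr_sqr ger0_norm// expR_ge0.
(* Compensates the powers of a_i in U^p V^(1-p): p / n from U and p (1 - q) / (n q) from V add up to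
   p / (n q). *)
pose W := expR (p / (n%:R * q) * \sum_i al i).
have main x : f x `^ p <= W * (p * expR (u x) + (1 - p) * geoH g x).
  rewrite powE// VE.
  set v := \sum_i 2^-1 * _.
  apply: (@le_trans _ _ (W * expR (p * u x + (1 - p) * v))); last first.
    by rewrite ler_wpM2l ?expR_ge0// expR_young// p1 ltW.
  rewrite /W -expRD ler_expR le_eqVlt; apply/orP; left; apply/eqP.
  have -> : v = 2^-1 * (r * \sum_i ln (F i (tnth x i)) - s * \sum_i al i).
    by rewrite /v -mulr_sumr sumrB -!mulr_sumr.
  rewrite /u -mulr_sumr sumrB -!mulr_sumr.
  move: (\sum_i ln _) (\sum_i al i) => X Y.
  by rewrite /s /r; field; rewrite !gt_eqF.
have bfp : sbd (fun x => f x `^ p).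
  rewrite (_ : (fun x => _) = fun x => expR (p * ln (f x))); first by apply: sbd_expR; exact: bZ.
  by apply/funext => x; rewrite powE.
have EW : ES (fun x => f x `^ p) <= W.
  apply: (@le_trans _ _ (ES (fun x => W * (p * expR (u x) + (1 - p) * geoH g x)))).
    by apply: ES_le => // ; apply: (bZ); apply: sbdD; exact: bZ.
  rewrite ESZ; last by apply: sbdD; exact: bZ.
  rewrite ESD; [|exact: bZ|exact: bZ]; rewrite !ESZ//.
  rewrite -[leRHS]mulr1 ler_wpM2l ?expR_ge0//.
  have h1 : p * ES (fun x => expR (u x)) <= p * 1 by rewrite ler_wpM2l// ltW.
  have h2 : (1 - p) * ES (geoH g) <= (1 - p) * 1 by rewrite ler_wpM2l// ltW.
  by lra.
have E0 : 0 <= ES (fun x => f x `^ p).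
  rewrite -[leLHS](@ES_cst _ n); apply: ES_le => //; first exact: sbd_cst.
  by move=> x _; exact: powR_ge0.
apply: (@le_trans _ _ (W `^ (q / p))).
  by apply: ge0_ler_powR => //; rewrite ?nnegrE ?expR_ge0// divr_ge0// ltW.
rewrite powE ?expR_gt0// expRK.
have -> : q / p * (p / (n%:R * q) * \sum_i al i) = \sum_i n%:R^-1 * al i.
  by rewrite -mulr_sumr; field; rewrite !gt_eqF.
rewrite mulr_sumr -(eq_bigr _ (fun i _ => congr1 (fun z => n%:R^-1 * z) (alE i))).
by apply: expR_jensen => // i; rewrite invr_ge0 ltW.
Qed.

End AdjointBL.

(** * Averaging over random frames *)

Section Assembly.
Context {R : realType}.
Local Open Scope ereal_scope.

Lemma integral_prob_cst d (T : measurableType d) (P : probability T R) (c : \bar R) :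
  \int[P]_x c = c.
Proof.
by rewrite (integral_cst P measurableT c) /= probability_setT mule1.
Qed.

Lemma nu_intE n (g : R -> \bar R) : measurable_fun setT g -> (forall t, 0 <= g t) ->
  nu_int n.+2 g = \int[sphM n.+2]_x g (tnth x ord0).
Proof.
move=> mg g0.
have mh : measurable_fun setT (fun x : n.+2.-tuple R => g (tnth x ord0)).
  exact: (measurableT_comp mg (measurable_tnth ord0)).
apply/esym; apply: (etrans (disintegration mh (fun x => g0 _))).
apply: eq_integral => t _; congr (_ * _).
apply: (etrans _ (integral_prob_cst (sphM n.+1) (g t))).
by apply: eq_integral => th _; rewrite /slice tnth_consp0.
Qed.

Lemma coord_law n (i : 'I_n.+2) (g : R -> \bar R) : measurable_fun setT g ->
  (forall t, 0 <= g t) ->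
  \int[sphM n.+2]_x g (tnth x i) = \int[sphM n.+2]_x g (tnth x ord0).
Proof.
move=> mg g0; have [S gS Si] := @coord_swap R _ ord0 i.
have mh : measurable_fun setT (fun x : n.+2.-tuple R => g (tnth x ord0)).
  exact: (measurableT_comp mg (measurable_tnth ord0)).
rewrite -(integral_sphM_isom gS mh (fun x => g0 (tnth x ord0))).
by apply: eq_integral => x _; rewrite Si.
Qed.

Lemma measurable_radon1 n (f : n.-tuple R -> \bar R) w :
  measurable_fun setT f -> (forall x, 0 <= f x) -> measurable_fun setT (radon f w).
Proof.
move=> mf f0.
exact: (measurable_fun2_comp (measurable_radon mf f0) (measurable_cst w) (@measurable_id _ _ _)).
Qed.

Lemma radon_le n (f1 f2 : n.-tuple R -> \bar R) w t : measurable_fun setT f1 ->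
  measurable_fun setT f2 -> (forall x, 0 <= f1 x) -> (forall x, f1 x <= f2 x) ->
  radon f1 w t <= radon f2 w t.
Proof.
move=> mf1 mf2 f10 f12.
have f20 x : 0 <= f2 x by exact: le_trans (f12 x).
rewrite !radon_sphM//; apply: ge0_le_integral => //.
- by apply: (measurableT_comp mf1); apply: measurable_perp_arg; mfun.
- by apply: (measurableT_comp mf2); apply: measurable_perp_arg; mfun.
Qed.

Lemma radon_cst n (c : \bar R) (w : n.-tuple R) t : 0 <= c -> radon (cst c) w t = c.
Proof.
move=> c0; rewrite radon_sphM//; exact: integral_prob_cst.
Qed.

Lemma radonD_cst n (f : n.-tuple R -> \bar R) (c : \bar R) w t : measurable_fun setT f ->
  (forall x, 0 <= f x) -> 0 <= c -> radon (fun x => f x + c) w t = radon f w t + c.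
Proof.
move=> mf f0 c0; rewrite [LHS]radon_sphM; last 2 first.
- exact: emeasurable_funD.
- by move=> x; exact: adde_ge0.
rewrite ge0_integralD//; last first.
  by apply: (measurableT_comp mf); apply: measurable_perp_arg; mfun.
congr (_ + _); first by rewrite radon_sphM.
exact: integral_prob_cst.
Qed.

Lemma lee_poweR (x y : \bar R) (r : R) : (0 <= r)%R -> 0 <= x -> x <= y -> x `^ r <= y `^ r.
Proof.
move=> r0 x0 xy; apply: gt0_ler_poweR => //; rewrite in_itv/= ?leey ?andbT//.
exact: le_trans xy.
Qed.

(* The [q]-th power of the left-hand norm; [nu] is the law of the first coordinate. *)
Definition radon_int n (q : R) (f : n.+2.-tuple R -> \bar R) (w : n.+2.-tuple R) :=
  \int[sphM n.+2]_x (radon f w (tnth x ord0) `^ q).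

Lemma measurable_radon_int n q (f : n.+2.-tuple R -> \bar R) :
  measurable_fun setT f -> (forall x, 0 <= f x) -> measurable_fun setT (radon_int q f).
Proof.
move=> mf f0.
apply: (measurable_integral_param (sphM n.+2)
  (f := fun w x => radon f w (tnth x ord0) `^ q)) => [|w x]; last exact: poweR_ge0.
apply: (measurableT_comp (measurable_poweR q)).
apply: (measurable_fun2_comp (measurable_radon mf f0)); first exact: measurable_fst.
exact: measurable_tnth_comp measurable_snd.
Qed.

Lemma radon_int_ge0 n q (f : n.+2.-tuple R -> \bar R) w : 0 <= radon_int q f w.
Proof. by apply: integral_ge0 => x _; exact: poweR_ge0. Qed.

Lemma sph_int_radon n q (f : n.+2.-tuple R -> \bar R) :
  measurable_fun setT f -> (forall x, 0 <= f x) ->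
  sph_int (fun w => nu_int n.+2 (fun t => radon f w t `^ q)) =
  \int[sphM n.+2]_w radon_int q f w.
Proof.
move=> mf f0.
have -> : (fun w => nu_int n.+2 (fun t => radon f w t `^ q)) = radon_int q f.
  apply/funext => w; apply: nu_intE => [|t]; last exact: poweR_ge0.
  exact: (measurableT_comp (measurable_poweR q) (measurable_radon1 w mf f0)).
apply: sph_intE; first exact: measurable_radon_int.
exact: radon_int_ge0.
Qed.

Lemma EFin_ES_sphM n (h : n.-tuple R -> R) : sbd h -> (forall x, (0 <= h x)%R) ->
  (ES h)%:E = \int[sphM n]_x (h x)%:E.
Proof.
move=> bh h0; rewrite EFin_ES// integral_sphM//.
by have [mh _] := bh; exact/measurable_EFinP.
Qed.

Let eq_lee (x y : \bar R) : x = y -> x <= y. Proof. by move=> ->. Qed.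

Lemma sume_cst k (x : \bar R) : 0 <= x -> \sum_(i < k) x = k%:R%:E * x.
Proof.
move=> x0; elim: k => [|k IH]; first by rewrite big_ord0 mul0e.
by rewrite big_ord_recr /= IH -natr1 EFinD ge0_muleDl ?lee_fin// mul1e.
Qed.

Section Bounded.
Variables (n : nat) (f : n.+2.-tuple R -> R) (a M p q : R).
Local Notation d := n.+2.
Hypotheses (a0 : (0 < a)%R) (mf : measurable_fun setT f) (fb : forall x, (a <= f x <= M)%R)
  (p01 : (0 < p <= 1)%R) (q01 : (0 < q <= 1)%R)
  (pq : (1 / 2 * (1 - 1 / p) <= 1 / d%:R * (1 - 1 / q))%R).

Let fE x := (f x)%:E.
Let mfE : measurable_fun setT fE. Proof. exact/measurable_EFinP. Qed.
Let f0 x : 0 <= fE x.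
Proof. by rewrite lee_fin; have /andP[h _] := fb x; rewrite (le_trans (ltW a0)). Qed.

Let radon_bnd w t : a%:E <= radon fE w t <= M%:E.
Proof.
have M0 : (0 <= M)%R.
  by have /andP[h1 h2] := fb [tuple 0%R | i < d]; rewrite (le_trans (ltW a0))// (le_trans h1).
apply/andP; split.
  have aE : 0 <= a%:E by rewrite lee_fin ltW.
  apply: (le_trans (eq_lee (esym (radon_cst w t aE)))).
  apply: radon_le => // x.
  by rewrite lee_fin; have /andP[] := fb x.
have ME : 0 <= M%:E by rewrite lee_fin.
apply: (le_trans _ (eq_lee (radon_cst w t ME))).
by apply: radon_le => // x; rewrite lee_fin; have /andP[] := fb x.
Qed.

Let radon_fin w t : radon fE w t \is a fin_num.
Proof.
have /andP[h1 h2] := radon_bnd w t; rewrite ge0_fin_numE.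
  by rewrite (le_lt_trans h2)// ltry.
by apply: le_trans h1; rewrite lee_fin ltW.
Qed.

(** [e i] moves the first coordinate to place i, so [e i (e0 n.+1)] is the i-th basis vector and [S]
    carries the standard basis to the frame. *)
Lemma frame_ineq (e : 'I_d -> d.-tuple R -> d.-tuple R) (S : d.-tuple R -> d.-tuple R) :
  (forall i, gauss_isom (e i) /\ forall x, tnth (e i x) i = tnth x ord0) -> gauss_isom S ->
  (ES (fun x => f x `^ p) `^ (q / p))%:E <=
  d%:R^-1%:E * \sum_(i < d) radon_int q fE (S (e i (e0 n.+1))).
Proof.
move=> eP gS; have [mS _ _ _] := gS.
pose F i t := fine (radon fE (S (e i (e0 n.+1))) t).
have FE i t : (F i t)%:E = radon fE (S (e i (e0 n.+1))) t by rewrite fineK.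
have mF i : measurable_fun setT (F i).
  apply/measurable_EFinP; rewrite (_ : EFin \o F i = radon fE (S (e i (e0 n.+1)))).
    exact: measurable_radon1.
  by apply/funext => t; rewrite /= FE.
have Fb i t : (a <= F i t <= M)%R by rewrite -!lee_fin FE.
have F0 i t : (0 <= F i t)%R by have /andP[h _] := Fb i t; rewrite (le_trans (ltW a0)).
have fabs x : (`|f x| <= M)%R.
  by have /andP[h1 h2] := fb x; rewrite ger0_norm// (le_trans (ltW a0)).
have Fabs i t : (`|F i t| <= M)%R.
  by have /andP[h1 h2] := Fb i t; rewrite ger0_norm.
have bF i : sbd (fun x : d.-tuple R => F i (tnth x i)) by apply: (sbd_coord_fun i (mF i)) => t _; exact: Fabs.
have bf : sbd f by split => //; exists M => x _; exact: fabs.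
have bfS : sbd (fun x => f (S x)) by exact: sbd_comp.
have bp (h : d.-tuple R -> R) (c : R) : (0 <= c)%R -> sbd h -> (forall x, (0 <= h x)%R) -> sbd (fun x => h x `^ c)%R.
  move=> c0 [mh [K hK]] h0; split; first exact: (measurableT_comp (@measurable_powR R c)).
  exists (K `^ c)%R => x x1; rewrite ger0_norm ?powR_ge0// ge0_ler_powR ?nnegrE//.
    exact: le_trans (hK x x1).
  by rewrite (le_trans (ler_norm _)) ?hK.
have q0 : (0 <= q)%R by case/andP: q01 => /ltW.
have p0 : (0 <= p)%R by case/andP: p01 => /ltW.
have cond i (g : R -> R) : measurable_fun setT g -> (forall t, (0 <= g t)%R) ->
    (exists K, forall t, (g t <= K)%R) ->
    ES (fun x => f (S x) * g (tnth x i))%R = ES (fun x => F i (tnth x i) * g (tnth x i))%R.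
  move=> mg g0 [K gK].
  have bg : sbd (fun x : d.-tuple R => g (tnth x i)).
    by apply: (sbd_coord_fun i mg) => t _; rewrite ger0_norm.
  have [ge ei] := eP i; have gSe := gauss_isom_comp gS ge.
  apply: EFin_inj; rewrite !EFin_ES_sphM; last 4 first.
  - exact: sbdM.
  - by move=> x; rewrite mulr_ge0.
  - exact: sbdM.
  - by move=> x; rewrite mulr_ge0// -lee_fin f0.
  have mE : measurable_fun setT (fun x : d.-tuple R => (f (S x) * g (tnth x i))%:E).
    by have [mh _] := sbdM bfS bg; exact/measurable_EFinP.
  have E0 x : 0 <= (f (S x) * g (tnth x i))%:E by rewrite lee_fin mulr_ge0// -lee_fin f0.
  have mgE : measurable_fun setT (fun t => (g t)%:E) by exact/measurable_EFinP.
  have gE0 t : 0 <= (g t)%:E by rewrite lee_fin.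
  apply: (etrans (esym (integral_sphM_isom ge mE E0))).
  transitivity (\int[sphM d]_x (fE ((S \o e i) x) * (g (tnth x ord0))%:E)).
    by apply: eq_integral => x _; rewrite ei EFinM.
  apply: (etrans (radon_disint gSe mfE f0 mgE gE0)).
  have mH : measurable_fun setT (fun t => (F i t * g t)%:E).
    by apply/measurable_EFinP; exact: measurable_funM.
  have H0 t : 0 <= (F i t * g t)%:E by rewrite lee_fin mulr_ge0.
  apply: (etrans _ (esym (coord_law i mH H0))).
  transitivity (nu_int d (fun t => (F i t * g t)%:E)); last exact: nu_intE.
  by apply: eq_integral => t _; congr (_ * _); rewrite [RHS]EFinM FE.
have := adjoint_bl a0 (measurableT_comp mf mS) (fun x => fb (S x)) mF Fb cond p01 q01 pq.
rewrite /= (ES_isom (f := fun x => f x `^ p)%R gS); last first.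
  by apply: bp => // x; rewrite -lee_fin; exact: f0.
rewrite -lee_fin EFinM => h; apply: (le_trans h).
rewrite lee_wpmul2l ?lee_fin// ?invr_ge0// -sumEFin.
apply: lee_sum => i _; rewrite EFin_ES_sphM; last 2 first.
- by apply: bp.
- by move=> x; exact: powR_ge0.
have mFq : measurable_fun setT (fun t => (F i t `^ q)%:E).
  by apply/measurable_EFinP; exact: (measurableT_comp (@measurable_powR R q)).
rewrite (coord_law i mFq) => [|t]; last by rewrite lee_fin powR_ge0.
rewrite le_eqVlt; apply/orP; left; apply/eqP; apply: eq_integral => x _.
by rewrite -FE poweR_EFin.
Qed.

(** Under the random isometry each single frame vector is uniform on the sphere, so all d terms of
    [frame_ineq] have the same mean. *)
Lemma bounded_ineq : (ES (fun x => f x `^ p) `^ (q / p))%:E <= \int[sphM d]_w radon_int q fE w.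
Proof.
have [dZ [Z [P [S [mS gS hS]]]]] := @haar_exists R n.
set c := (ES _ `^ _)%R.
have swap i : exists S : d.-tuple R -> d.-tuple R,
    gauss_isom S /\ forall x, tnth (S x) i = tnth x ord0.
  by have [T gT Ti] := @coord_swap R _ i ord0; exists T.
have [e eP] := fin_all_exists swap.
have mB := measurable_radon_int q mfE f0.
have B0 := radon_int_ge0 q fE.
have we i : dotp (e i (e0 n.+1)) (e i (e0 n.+1)) = 1%R.
  have [[_ _ -> _] _] := eP i.
  by rewrite dotp_e0 tnth_mktuple eqxx.
have mSw w : measurable_fun setT (fun z => radon_int q fE (S z w)).
  apply: (measurableT_comp mB).
  exact: (measurableT_comp mS (measurable_fun_pair (@measurable_id _ _ _) (measurable_cst w))).
have c0 : (0 <= c)%R by exact: powR_ge0.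
have h : \int[P]_z c%:E <= \int[P]_z (d%:R^-1%:E * \sum_(i < d) radon_int q fE (S z (e i (e0 n.+1)))).
  apply: ge0_le_integral => //.
  - by apply: measurable_funeM; apply: emeasurable_sum => i; exact: mSw.
  - by move=> z _; exact: frame_ineq eP (gS z).
move: h; rewrite integral_prob_cst => h.
apply: (le_trans h).
pose G (i : 'I_d) z := radon_int q fE (S z (e i (e0 n.+1))).
have mG i : measurable_fun setT (G i) by exact: mSw.
have G0 i z : setT z -> 0 <= G i z by move=> _; exact: B0.
have d0 : 0 <= d%:R^-1%:E :> \bar R by rewrite lee_fin invr_ge0.
have sG0 z : setT z -> 0 <= \sum_(i < d) G i z.
  by move=> _; apply: sume_ge0 => i _; exact: B0.
apply: (le_trans (eq_lee (ge0_integralZl P measurableT (emeasurable_sum _ mG) sG0 d0))).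
rewrite (ge0_integral_sum P measurableT mG G0).
rewrite (eq_bigr (fun=> \int[sphM d]_w radon_int q fE w)) => [|i _]; last exact: hS.
have I0 : 0 <= \int[sphM d]_w radon_int q fE w by apply: integral_ge0 => w _; exact: B0.
by rewrite (sume_cst d I0) muleA -EFinM mulVf// mul1e.
Qed.

End Bounded.

End Assembly.

(** * From bounded to general functions *)

Section Reduction.
Context {R : realType}.

(** A ratio z in [0, 1] satisfies z <= z^q; this is applied to x / (x + y) and y / (x + y), which
    add up to 1. *)
Lemma powRD_le (x y q : R) : 0 <= x -> 0 < y -> 0 < q <= 1 ->
  (x + y) `^ q <= x `^ q + y `^ q.
Proof.
move=> x0 y0 /andP[q0 q1]; have s0 : 0 < x + y by lra.
have part z : 0 <= z <= x + y -> (x + y) `^ q * (z / (x + y)) <= z `^ q.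
  move=> /andP[]; rewrite le_eqVlt => /predU1P[<- _|z0 zs]; first by rewrite mul0r mulr0 powR_ge0.
  have zs0 : 0 < z / (x + y) by rewrite divr_gt0.
  rewrite -[in leRHS](divfK (lt0r_neq0 s0) z) mulrC (powRM _ (ltW zs0) (ltW s0)).
  apply: ler_wpM2r; first exact: powR_ge0.
  rewrite /powR (gt_eqF zs0).
  rewrite -[leLHS]lnK ?posrE// ler_expR.
  have ln0 : ln (z / (x + y)) <= 0 by apply: ln_le0; rewrite ler_pdivrMr// mul1r.
  by rewrite -[leLHS]mul1r ler_wnM2r.
have px := part x; have py := part y.
rewrite x0 lerDl (ltW y0) in px; rewrite (ltW y0) lerDr x0 in py.
have -> : (x + y) `^ q = (x + y) `^ q * (x / (x + y)) + (x + y) `^ q * (y / (x + y)).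
  by rewrite -mulrDr -mulrDl divff ?mulr1// gt_eqF.
by rewrite lerD ?px ?py.
Qed.

Local Open Scope ereal_scope.

Lemma poweRD_le (x : \bar R) (y q : R) : 0 <= x -> (0 < y)%R -> (0 < q <= 1)%R ->
  (x + y%:E) `^ q <= x `^ q + (y `^ q)%:E.
Proof.
move=> x0 y0 q01; have /andP[q0 _] := q01.
case: x x0 => [x||] // x0.
  by rewrite -EFinD !poweR_EFin lee_fin powRD_le.
by rewrite addye// poweRyr ?gt_eqF// addye// leey.
Qed.

(** Adding e to f adds exactly e to every slice average, and x^q is subadditive for q <= 1. *)
Lemma radon_int_shift n (q e : R) (f : n.+2.-tuple R -> \bar R) : (0 < q <= 1)%R -> (0 < e)%R ->
  measurable_fun setT f -> (forall x, 0 <= f x) ->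
  \int[sphM n.+2]_w radon_int q (fun x => f x + e%:E) w <=
  \int[sphM n.+2]_w radon_int q f w + (e `^ q)%:E.
Proof.
move=> q01 e0 mf f0.
have eE : 0 <= e%:E by rewrite lee_fin ltW.
have eq0 : 0 <= (e `^ q)%:E by rewrite lee_fin powR_ge0.
have mfe : measurable_fun setT (fun x => f x + e%:E) by exact: emeasurable_funD.
have fe0 x : 0 <= f x + e%:E by exact: adde_ge0.
have mB := measurable_radon_int q mf f0.
have mBe := measurable_radon_int q mfe fe0.
have mq (g : n.+2.-tuple R -> \bar R) w : measurable_fun setT g -> (forall x, 0 <= g x) ->
    measurable_fun setT (fun x : n.+2.-tuple R => radon g w (tnth x ord0) `^ q).
  move=> mg g0; apply: (measurableT_comp (measurable_poweR q)).
  exact: (measurableT_comp (measurable_radon1 w mg g0) (measurable_tnth ord0)).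
have split_cst (g : n.+2.-tuple R -> \bar R) : measurable_fun setT g -> (forall x, 0 <= g x) ->
    \int[sphM n.+2]_x (g x + (e `^ q)%:E) = \int[sphM n.+2]_x g x + (e `^ q)%:E.
  move=> mg g0.
  have g0' x : setT x -> 0 <= g x by [].
  have eq0' (x : n.+2.-tuple R) : setT x -> 0 <= cst (e `^ q)%:E x by [].
  apply: (etrans (ge0_integralD (sphM n.+2) measurableT g0' mg eq0' (measurable_cst _))).
  by congr (_ + _); exact: integral_prob_cst.
have pt w : radon_int q (fun x => f x + e%:E) w <= radon_int q f w + (e `^ q)%:E.
  apply: (@le_trans _ _ (\int[sphM n.+2]_x (radon f w (tnth x ord0) `^ q + (e `^ q)%:E))).
    apply: ge0_le_integral => //.
    + by move=> x _; exact: poweR_ge0.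
    + exact: mq.
    + by apply: emeasurable_funD; [exact: mq|exact: measurable_cst].
    + by move=> x _; rewrite radonD_cst// poweRD_le// radon_ge0.
  rewrite (split_cst (fun x => radon f w (tnth x ord0) `^ q))//; first exact: mq.
  by move=> x; exact: poweR_ge0.
rewrite -(split_cst _ mB (radon_int_ge0 q f)).
have mBc : measurable_fun setT (fun w => radon_int q f w + (e `^ q)%:E).
  exact: (emeasurable_funD mB (measurable_cst _)).
have B0 w : [set: n.+2.-tuple R] w -> 0 <= radon_int q (fun x => f x + e%:E) w.
  by move=> _; exact: radon_int_ge0.
exact: (ge0_le_integral (sphM n.+2) measurableT B0 mBe mBc (fun w _ => pt w)).
Qed.

Lemma radon_int_le n (q : R) (f g : n.+2.-tuple R -> \bar R) w : (0 <= q)%R ->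
  measurable_fun setT f -> measurable_fun setT g -> (forall x, 0 <= f x) ->
  (forall x, f x <= g x) -> radon_int q f w <= radon_int q g w.
Proof.
move=> q0 mf mg f0 fg; have g0 x : 0 <= g x by exact: le_trans (fg x).
have mq (h : n.+2.-tuple R -> \bar R) : measurable_fun setT h -> (forall x, 0 <= h x) ->
    measurable_fun setT (fun x : n.+2.-tuple R => radon h w (tnth x ord0) `^ q).
  move=> mh h0; apply: (measurableT_comp (measurable_poweR q)).
  exact: (measurableT_comp (measurable_radon1 w mh h0) (measurable_tnth ord0)).
have pos x : [set: n.+2.-tuple R] x -> 0 <= radon f w (tnth x ord0) `^ q.
  by move=> _; exact: poweR_ge0.
apply: (ge0_le_integral (sphM n.+2) measurableT pos (mq _ mf f0) (mq _ mg g0)) => x _.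
apply: lee_poweR; [exact: q0|exact: radon_ge0|exact: radon_le].
Qed.

(** [h] stands for f^p: its p-th root lies below f, and after adding a small constant it lies
    between positive constants, where [bounded_ineq] applies. *)
Lemma simple_ineq n (p q : R) (f : n.+2.-tuple R -> \bar R) (h : {nnsfun n.+2.-tuple R >-> R}) :
  (0 < p <= 1)%R -> (0 < q <= 1)%R ->
  (1 / 2 * (1 - 1 / p) <= 1 / n.+2%:R * (1 - 1 / q))%R ->
  measurable_fun setT f -> (forall x, 0 <= f x) -> (forall x, (h x)%:E <= f x `^ p) ->
  (\int[sphM n.+2]_x (h x)%:E) `^ (q / p) <= \int[sphM n.+2]_w radon_int q f w.
Proof.
move=> p01 q01 pq mf f0 hf; have /andP[p0 _] := p01; have /andP[q0 _] := q01.
have mh : measurable_fun setT h by exact: measurable_funPT.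
pose k x := (h x `^ p^-1)%R.
have mk : measurable_fun setT k by exact: (measurableT_comp (@measurable_powR R p^-1)).
have mkE : measurable_fun setT (EFin \o k) by exact/measurable_EFinP.
have k0 x : (0 <= k x)%R by exact: powR_ge0.
have kp x : (k x `^ p)%R = h x by rewrite -powRrM mulVf ?gt_eqF// powRr1.
have kf x : (k x)%:E <= f x.
  rewrite /k -poweR_EFin -[leRHS]poweRe1// -(mulfV (lt0r_neq0 p0)) poweRrM.
  by apply: lee_poweR; rewrite ?lee_fin// invr_ge0 ltW.
have [K [_ /(_ (K + 1)%R)]] := simple_bounded h; rewrite ltrDl ltr01 => /(_ isT) hK.
have hb x : (h x <= K + 1)%R by rewrite (le_trans (ler_norm _))// hK.
have kb x : (k x <= (K + 1) `^ p^-1)%R.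
  rewrite /k ge0_ler_powR ?nnegrE ?invr_ge0 ?(ltW p0)//.
  by rewrite (le_trans _ (hb x)).
apply/lee_addgt0Pr => e e0.
(* Chosen so that the shift by [d] costs exactly [e] in [radon_int_shift]. *)
pose d := (e `^ q^-1)%R.
have d0 : (0 < d)%R by exact: powR_gt0.
have dq : (d `^ q)%R = e by rewrite -powRrM mulVf ?gt_eqF// powRr1// ltW.
pose kd x := (k x + d)%R.
have mkd : measurable_fun setT kd by exact: measurable_funD.
have kdb x : (d <= kd x <= (K + 1) `^ p^-1 + d)%R by rewrite lerDr k0 lerD2r kb.
have kd0 x : (0 <= kd x)%R by rewrite addr_ge0// ltW.
have := bounded_ineq d0 mkd kdb p01 q01 pq.
have sh : sbd h by split => //; exists (K + 1)%R => x _; rewrite hK.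
have sk : sbd (fun x => kd x `^ p)%R.
  split; first exact: (measurableT_comp (@measurable_powR R p)).
  exists (((K + 1) `^ p^-1 + d) `^ p)%R => x _; rewrite (ger0_norm (powR_ge0 _ _)).
  have /andP[_ kd1] := kdb x; apply: (ge0_ler_powR (ltW p0) (kd0 x) _ kd1).
  exact: le_trans (kd0 x) kd1.
have E1 : \int[sphM n.+2]_x (h x)%:E = (ES h)%:E by rewrite EFin_ES_sphM.
have hES : (0 <= ES h <= ES (fun x => kd x `^ p))%R.
  apply/andP; split.
    by rewrite -[leLHS](@ES_cst _ n.+2); apply: ES_le => //; exact: sbd_cst.
  apply: ES_le => // x _; rewrite -kp ge0_ler_powR ?nnegrE ?(ltW p0)//.
  by rewrite lerDl ltW.
have /andP[hES0 hES1] := hES.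
rewrite E1 poweR_EFin => bnd.
apply: (@le_trans _ _ (ES (fun x => kd x `^ p) `^ (q / p))%:E)%R.
  by rewrite lee_fin ge0_ler_powR ?nnegrE ?divr_ge0 ?(ltW q0) ?(ltW p0)// (le_trans hES0).
apply: (le_trans bnd); rewrite -dq.
have kE0 x : 0 <= (k x)%:E by rewrite lee_fin.
apply: (le_trans (radon_int_shift q01 d0 mkE kE0)).
apply: leeD2r.
have B0 w : [set: n.+2.-tuple R] w -> 0 <= radon_int q (EFin \o k) w.
  by move=> _; exact: radon_int_ge0.
apply: (ge0_le_integral (sphM n.+2) measurableT B0
  (measurable_radon_int q mkE kE0) (measurable_radon_int q mf f0)) => w _.
exact: (radon_int_le w (ltW q0) mkE mf kE0 kf).
Qed.

End Reduction.

Theorem theorem9p5 (R : realType) (d : nat) (p q : R) :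
  (2 <= d)%N -> 0 < p <= 1 -> 0 < q <= 1 ->
  1 / 2 * (1 - 1 / p) <= 1 / d%:R * (1 - 1 / q) ->
  forall f : d.-tuple R -> \bar R,
    measurable_fun [set: d.-tuple R] f -> (forall x, (0 <= f x)%E) ->
    (Lp_sigma p f <= Lq_nu_sigma q (radon f))%E.
Proof.
case: d => [|[|n]]// _ p01 q01 pq f mf f0.
have /andP[p0 _] := p01; have /andP[q0 _] := q01.
have mfp : measurable_fun setT (fun x => f x `^ p)%E.
  exact: (measurableT_comp (measurable_poweR p) mf).
have fp0 x : (0 <= f x `^ p)%E by exact: poweR_ge0.
rewrite /Lp_sigma /Lq_nu_sigma sph_int_radon// sph_intE//.
set Y := (\int[sphM n.+2]_w radon_int q f w)%E.
have Y0 : (0 <= Y)%E by apply: integral_ge0 => w _; exact: radon_int_ge0.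
have qp0 : 0 < q / p by rewrite divr_gt0.
(* In this form the integral of f^p stands alone on the left, where it is a supremum over simple
   functions. *)
suff : (\int[sphM n.+2]_x (f x `^ p) <= Y `^ (p / q))%E.
  move=> h; have -> : (Y `^ q^-1 = (Y `^ (p / q)) `^ p^-1)%E.
    by rewrite -poweRrM; congr (_ `^ _)%E; rewrite mulrAC divff ?gt_eqF// mul1r.
  by apply: lee_poweR => //; [rewrite invr_ge0 ltW|exact: integral_ge0].
rewrite ge0_integralTE//; apply: ge_ereal_sup => _ [h hf <-].
rewrite -integralT_nnsfun.
have := simple_ineq p01 q01 pq mf f0 hf; rewrite -/Y.
set I := (\int[_]_x _)%E => IY.
have I0 : (0 <= I)%E by apply: integral_ge0 => x _; rewrite lee_fin.
rewrite -[leLHS]poweRe1// (_ : 1 = q / p * (p / q)); last by field; rewrite !gt_eqF.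
by rewrite poweRrM; apply: lee_poweR => //; [rewrite divr_ge0 ?ltW|exact: poweR_ge0].
Qed.
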